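(* The supersingular elliptic curve $E:y^2=x^3+169x+307$ over $\mathbb{F}_{439}$, with $j(E)=247$, has two twisting endomorphisms $\alpha,\beta\in\operatorname{End}(E)$ such that $\alpha^2=-5$, $\beta^2=-22$ and $\operatorname{End}(E)=\langle 1,\alpha,\beta,\alpha\circ\beta\rangle$ (the $\mathbb{Z}$-module spanned by these four elements).
   Context: $\operatorname{End}(E)$ denotes the full geometric endomorphism ring of $E$ over $\overline{\mathbb{F}}_{439}$. A twisting endomorphism of a supersingular elliptic curve $E/\mathbb{F}_p$ is an $\alpha\in\operatorname{End}(E)$ with $\phi_{p,E}\circ\alpha=-\alpha\circ\phi_{p,E}$, where $\phi_{p,E}:(x,y)\mapsto(x^p,y^p)$ is the $p$-power Frobenius endomorphism; here $p=439$. Integers denote the corresponding multiplication maps. *)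

(* Defs.v *)
From mathcomp Require Import all_boot all_order all_algebra all_field.
From mathcomp Require Import ring mpoly.

Set Implicit Arguments.
Unset Strict Implicit.
Unset Printing Implicit Defensive.

Import GRing.Theory.
Local Open Scope ring_scope.

Definition wdiscr (K : fieldType) (a b : K) : K :=
  - 16%:R * (4%:R * a ^+ 3 + 27%:R * b ^+ 2).

(* The elliptic curve y^2 = x^3 + a x + b; wdiscr != 0 excludes
   characteristic 2. *)
Record wcurve (K : fieldType) := WCurve {
  wa : K;
  wb : K;
  wcurve_smooth : wdiscr wa wb != 0 }.

Definition jinv (K : fieldType) (E : wcurve K) : K :=
  - 1728%:R * (4%:R * wa E) ^+ 3 / wdiscr (wa E) (wb E).

Lemma wdiscr_map (F K : fieldType) (f : {rmorphism F -> K}) (E : wcurve F) :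
  wdiscr (f (wa E)) (f (wb E)) != 0.
Proof.
rewrite /wdiscr.
rewrite -(rmorph_nat f 16) -(rmorph_nat f 4) -(rmorph_nat f 27).
rewrite -!rmorphXn -!rmorphM -rmorphD -rmorphN -rmorphM fmorph_eq0.
exact: wcurve_smooth E.
Qed.

Definition base_change (F K : fieldType) (f : {rmorphism F -> K})
  (E : wcurve F) : wcurve K := WCurve (wdiscr_map f E).

Section Points.

Variables (K : fieldType) (E : wcurve K).

Implicit Types P Q : option (K * K).

(* None is the point at infinity [0 : 1 : 0]. *)
Definition oncurve P : bool :=
  if P is Some (x, y) then y ^+ 2 == x ^+ 3 + wa E * x + wb E else true.

Definition point : Type := {P : option (K * K) | oncurve P}.

Definition pzero : point := exist oncurve None isT.

Definition opp_raw P : option (K * K) :=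
  if P is Some (x, y) then Some (x, - y) else None.

Definition slope (x1 y1 x2 y2 : K) : K :=
  if x1 == x2 then (3%:R * x1 ^+ 2 + wa E) / (2%:R * y1)
  else (y2 - y1) / (x2 - x1).

Definition add_raw P Q : option (K * K) :=
  match P, Q with
  | None, _ => Q
  | _, None => P
  | Some (x1, y1), Some (x2, y2) =>
    if (x1 == x2) && (y1 == - y2) then None else
    let l := slope x1 y1 x2 y2 in
    let x3 := l ^+ 2 - x1 - x2 in
    Some (x3, l * (x1 - x3) - y1)
  end.

Lemma opp_raw_on (P : point) : oncurve (opp_raw (val P)).
Proof. by case: P => [[[x y]|] //=]; rewrite sqrrN. Qed.

Lemma add_raw_on (P Q : point) : oncurve (add_raw (val P) (val Q)).
Proof.
case: P Q => [[[x1 y1]|] hP] [[[x2 y2]|] hQ] //=.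
case: ifPn => // ne /=; move: hP hQ => /= /eqP hP /eqP hQ.
rewrite /slope; case: eqVneq ne => [x12 /= ne|x12 _].
  have two0 : 2%:R != 0 :> K.
    apply/eqP=> e2; have := wcurve_smooth E.
    by rewrite /wdiscr (natrM _ 2 8) e2 mul0r oppr0 mul0r eqxx.
  have y12 : y1 = y2.
    have /eqP : (y1 - y2) * (y1 + y2) = 0.
      by rewrite -subr_sqr hP hQ x12 subrr.
    by rewrite mulf_eq0 subr_eq0 addr_eq0 (negPf ne) orbF => /eqP.
  have y0 : y1 != 0.
    by apply: contra ne => /eqP y10; rewrite -y12 y10 oppr0.
  have -> : wb E = y1 ^+ 2 - x1 ^+ 3 - wa E * x1 by rewrite hP; ring.
  by rewrite -x12; apply/eqP; field; rewrite ?two0 ?y0.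
have d0 : x2 - x1 != 0 by rewrite subr_eq0 eq_sym.
have ea : wa E = ((y2 ^+ 2 - y1 ^+ 2) - (x2 ^+ 3 - x1 ^+ 3)) / (x2 - x1).
  by apply: (mulIf d0); rewrite mulfVK // hP hQ; ring.
have -> : wb E = y1 ^+ 2 - x1 ^+ 3 - wa E * x1 by rewrite hP; ring.
by rewrite ea; apply/eqP; field.
Qed.

Definition popp (P : point) : point := exist oncurve _ (opp_raw_on P).
Definition padd (P Q : point) : point := exist oncurve _ (add_raw_on P Q).

Definition pmulz (n : int) (P : point) : point :=
  match n with
  | Posz m => iter m (padd P) pzero
  | Negz m => popp (iter m.+1 (padd P) pzero)
  end.

Definition homog_coord (P : point) : 'I_3 -> K :=
  nth 0 (if val P is Some (x, y) then [:: x; y; 1] else [:: 0; 1; 0]).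

End Points.

Arguments pzero {K E}.

(* Over an algebraically closed field, E is identified with the set of its
   K-points, and a morphism E -> E is a map on points that is given, near each
   point, by homogeneous polynomials of the same degree. *)
Definition regular (K : closedFieldType) (E : wcurve K)
    (f : point E -> point E) : Prop :=
  forall P : point E, exists (d : nat) (F : 'I_3 -> {mpoly K[3]}),
    [/\ forall i, F i \is d.-homog,
        exists i, (F i).@[homog_coord P] != 0
      & forall Q : point E, (exists i, (F i).@[homog_coord Q] != 0) ->
          exists c : K, forall i,
            (F i).@[homog_coord Q] = c * homog_coord (f Q) i].

(* Membership in End(E); the ring operations are pointwise addition and
   composition. *)
Definition is_endo (K : closedFieldType) (E : wcurve K)
    (f : point E -> point E) : Prop :=
  regular f /\ f pzero = pzero.

Section Frobenius.

Variables (p : nat) (p_pr : prime p) (E : wcurve 'F_p).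
Variables (K : closedFieldType) (iota : {rmorphism 'F_p -> K}).

Let EK := base_change iota E.

Definition frob_raw (P : option (K * K)) : option (K * K) :=
  if P is Some (x, y) then Some (x ^+ p, y ^+ p) else None.

Lemma frob_raw_on (P : point EK) : oncurve EK (frob_raw (val P)).
Proof.
have charK : p \in [pchar K].
  by rewrite (fmorph_pchar iota) pchar_Fp.
have fixF (u : 'F_p) : iota u ^+ p = iota u.
  by rewrite -rmorphXn; congr (iota _); rewrite -[RHS]expf_card (card_Fp p_pr).
case: P => [[[x y]|] //= /eqP hP]; apply/eqP.
have FD (u v : K) : (u + v) ^+ p = u ^+ p + v ^+ p.
  by apply: exprDn_pchar; rewrite pnatE.
by rewrite exprAC hP !FD exprAC [in LHS](exprMn p (iota _)) fixF fixF.
Qed.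

Definition frob (P : point EK) : point EK := exist (oncurve EK) _ (frob_raw_on P).

Definition twisting (f : point EK -> point EK) : Prop :=
  is_endo f /\ forall P, frob (f P) = popp (f (frob P)).

(* E[p] is trivial over the algebraic closure. *)
Definition supersingular : Prop :=
  forall P : point EK, pmulz p%:Z P = pzero -> P = pzero.

End Frobenius.

Lemma prime439 : prime 439.
Proof. by []. Qed.

Lemma E439_smooth : wdiscr (169%:R : 'F_439) 307%:R != 0.
Proof. by vm_compute. Qed.

Definition E439 : wcurve 'F_439 := WCurve E439_smooth.

(* Main.v *)
(* Over an algebraically closed field the two complete addition laws make the
   regular maps E -> E closed under addition and composition, and an even
   regular map is constant: its coordinates are rational functions of x, and E
   has no nonconstant point over K(x) (descent on four squares in a pencil).
   Applied to P |-> f (T + P) + f (T - P), this shows that an endomorphism f is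
   an odd homomorphism. Hence f acts on x-coordinates by a rational function;
   its degree is multiplicative, satisfies the parallelogram law, and vanishes
   only for f = 0. So End(E) is a ring with a multiplicative positive definite
   quadratic form N, and x ^ 2 = t x - N x for all x, with t = N(x + 1) - N x - 1.

   Explicit maps alpha and beta of degrees 5 and 22 anticommute with Frobenius
   phi; then all three have trace 0, which gives alpha ^ 2 = -5, beta ^ 2 = -22
   and phi ^ 2 = -439, whence supersingularity. Comparing norms,
   2 alpha beta = t + s phi with t, s = 1 or -1, so the lattice spanned by
   1, alpha, beta, alpha beta has Gram determinant 439 ^ 2. An endomorphism has
   coordinates in (1 / 439) Z in this basis, and its norm is integral only if
   439 divides 5 x ^ 2 + y ^ 2 for the numerators x, y of its last coordinates;
   as -5 is not a square modulo 439, the coordinates are integers. *)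

(* Dual isogenies and function fields are avoided: the conjugate of [x] is taken to be [t - x], and
   its properties come only from the parallelogram law and the multiplicativity of [N]. Geometric
   identities are proved outside a finite set of points and extended because a polynomial with
   infinitely many roots vanishes.

   The anticommutation has a simple origin. As 439 is 3 modulo 4, a square root i of -1 satisfies i
   ^ 439 = -i. Without this i, the formulas for alpha and beta have coefficients in the prime field
   and describe isogenies from E to its quadratic twist by -1; the isomorphism of the twist with E
   brings in i, and Frobenius changes its sign.

   That the rank is at most 4 is not taken from the classification of quaternion algebras: an
   element orthogonal to 1, phi, alpha and alpha phi commutes with alpha phi, and multiplicativity
   of [N] then forces it to be 0. The norm comparison is 4 * 5 * 22 = 440 = t ^ 2 + 439 s ^ 2. The
   value 439 ^ 2 is the Gram determinant of a maximal order in the quaternion algebra ramified at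
   439 and infinity, so no larger order is to be expected. *)
Require Import Defs.
From Stdlib Require Import BinNat Nnat.
From HB Require Import structures.
From mathcomp Require Import all_boot all_order all_algebra all_field.
From mathcomp Require Import ring zify mpoly.
From mathcomp Require boolp.

Set Implicit Arguments.
Unset Strict Implicit.
Unset Printing Implicit Defensive.

Import GRing.Theory Num.Theory.
Local Open Scope ring_scope.

(** * The group law *)

(* The slopes of the last two additions are [k - l] and [k - m], where
   [k = (x1 - x3) / (l - m)]. *)
Lemma slope_assoc (F : fieldType) (x1 y1 x2 y2 x3 y3 l m : F) :
  (2%:R : F) != 0 ->
  y1 = y2 + l * (x1 - x2) -> y3 = y2 + m * (x3 - x2) ->
  2%:R * y2 * (l - m) + l ^+ 2 * (x1 - x2) - m ^+ 2 * (x3 - x2)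
    = (x1 - x3) * (x1 + x2 + x3) ->
  x1 != x3 ->
  let x12 := l ^+ 2 - x1 - x2 in
  let y12 := l * (x1 - x12) - y1 in
  let x23 := m ^+ 2 - x2 - x3 in
  let y23 := m * (x2 - x23) - y2 in
  x12 != x3 -> x1 != x23 ->
  let n := (y3 - y12) / (x3 - x12) in
  let r := (y23 - y1) / (x23 - x1) in
  let xn := n ^+ 2 - x12 - x3 in
  let xr := r ^+ 2 - x1 - x23 in
  xn = xr /\ n * (x12 - xn) - y12 = r * (x1 - xr) - y1.
Proof.
move=> two0 e1 e3 rel x13 x12 y12 x23 y23 h12 h23.
have lm : l - m != 0.
  apply/eqP=> /eqP; rewrite subr_eq0 => /eqP lm.
  have : (x1 - x3) * (x12 - x3) = 0.
    move/eqP: rel; rewrite -subr_eq0 => /eqP <-.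
    by rewrite /x12 lm; ring.
  by move/eqP; rewrite mulf_eq0 !subr_eq0 (negPf x13) (negPf h12).
have [k ek] : exists k, k * (l - m) = x1 - x3.
  by exists ((x1 - x3) / (l - m)); rewrite divfK.
have ex : x1 = x3 + k * (l - m) by rewrite ek; ring.
have ey : 2%:R * y2 = k * (x1 + x2 + x3 - l ^+ 2) - (l + m) * (x3 - x2).
  apply: (mulIf lm).
  have -> : 2%:R * y2 * (l - m) =
    (x1 - x3) * (x1 + x2 + x3) - l ^+ 2 * (x1 - x2) + m ^+ 2 * (x3 - x2).
    by rewrite -rel; ring.
  by rewrite ex; ring.
move=> n r.
have en : n = k - l.
  have d0 : x3 - x12 != 0 by rewrite subr_eq0 eq_sym.
  apply: (mulIf d0); rewrite /n divfK //.
  have -> : y3 - y12 = 2%:R * y2 + (l + m) * (x3 - x2) - l * (x3 - x12).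
    by rewrite /y12 e3 e1 /x12; ring.
  by rewrite ey /x12; ring.
have er : r = k - m.
  have d0 : x23 - x1 != 0 by rewrite subr_eq0 eq_sym.
  apply: (mulIf d0); rewrite /r divfK //.
  have -> : y23 - y1 = - (2%:R * y2) - (l + m) * (x1 - x2) - m * (x23 - x1).
    by rewrite /y23 /x23 e1; ring.
  by rewrite ey /x23 ex; ring.
move=> xn xr.
have exn : xn = xr by rewrite /xn /xr en er /x12 /x23 ex; ring.
split=> //; rewrite -exn en er; apply: (mulfI two0).
have -> : 2%:R * ((k - l) * (x12 - xn) - y12) =
  2%:R * ((k - l) * (x12 - xn) + l * (x12 - x2)) + 2%:R * y2.
  by rewrite /y12 e1; ring.
have -> : 2%:R * ((k - m) * (x1 - xn) - y1) =
  2%:R * ((k - m) * (x1 - xn) - l * (x1 - x2)) - 2%:R * y2.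
  by rewrite e1; ring.
by rewrite ey /xn en /x12 ex; ring.
Qed.

HB.instance Definition _ (K : fieldType) (E : wcurve K) :=
  Choice.copy (point E) {P | oncurve E P}.

Section GroupLaw.

Variables (K : fieldType) (E : wcurve K).
Implicit Types P Q S : point E.
Local Notation a := (wa E).
Local Notation b := (wb E).
Local Notation pt h := (exist (oncurve E) (Some (_, _)) h).

Lemma two_neq0 : 2%:R != 0 :> K.
Proof.
apply/eqP=> e2; have := wcurve_smooth E.
by rewrite /wdiscr (natrM _ 2 8) e2 mul0r oppr0 mul0r eqxx.
Qed.

Lemma oppr_id0 (y : K) : y = - y -> y = 0.
Proof.
move/eqP; rewrite -addr_eq0 -mulr2n -mulr_natl mulf_eq0 (negPf two_neq0).
by move/eqP.
Qed.

Lemma deriv_neq0 x : x ^+ 3 + a * x + b = 0 -> 3%:R * x ^+ 2 + a != 0.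
Proof.
move=> hb; apply/eqP=> ha; have /eqP[] := wcurve_smooth E.
have -> : b = - x ^+ 3 - a * x by apply/eqP; rewrite -subr_eq0 -hb; apply/eqP; ring.
have -> : a = - (3%:R * x ^+ 2) by apply/eqP; rewrite -subr_eq0 -ha; apply/eqP; ring.
by rewrite /wdiscr; ring.
Qed.

Lemma pointP P :
  P = pzero \/ exists x y (h : oncurve E (Some (x, y))), P = pt h.
Proof.
case: P => -[[x y]|] h; last by left; apply: val_inj.
by right; exists x, y, h.
Qed.

Lemma padd0P P : padd pzero P = P.
Proof. exact: val_inj. Qed.

Lemma paddP0 P : padd P pzero = P.
Proof. by apply: val_inj; case: P => -[[x y]|]. Qed.

Lemma poppK P : popp (popp P) = P.
Proof. by apply: val_inj; case: P => -[[x y]|] //= _; rewrite opprK. Qed.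

Lemma popp0 : popp (pzero : point E) = pzero.
Proof. exact: val_inj. Qed.

Lemma paddNP P : padd (popp P) P = pzero.
Proof. by apply: val_inj; case: P => -[[x y]|] //= _; rewrite !eqxx. Qed.

Lemma same_x x y y' : oncurve E (Some (x, y)) -> oncurve E (Some (x, y')) ->
  y' = y \/ y' = - y.
Proof.
move=> /= /eqP h /eqP h'.
have /eqP : (y' - y) * (y' + y) = 0 by rewrite -subr_sqr h h' subrr.
by rewrite mulf_eq0 subr_eq0 addr_eq0 => /orP[/eqP|/eqP]; [left|right].
Qed.

(** Chord and tangent are treated at once: the second equation is the difference of the two curve
    equations divided by [x1 - x2], and it keeps its meaning when the points coincide. *)
Lemma slope_ex x1 y1 x2 y2 :
  oncurve E (Some (x1, y1)) -> oncurve E (Some (x2, y2)) ->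
  ~~ ((x1 == x2) && (y1 == - y2)) ->
  exists l, y1 = y2 + l * (x1 - x2) /\
    l * (y1 + y2) = x1 ^+ 2 + x1 * x2 + x2 ^+ 2 + a.
Proof.
move=> h1 h2; case: eqVneq => [e|ne] /= ny.
  subst x2; have [e|e] := same_x h2 h1; last by rewrite e eqxx in ny.
  subst y2; have y0 : y1 != 0 by apply: contra ny => /eqP->; rewrite oppr0.
  exists ((3%:R * x1 ^+ 2 + a) / (2%:R * y1)); split; first by ring.
  by field; rewrite y0 two_neq0.
exists ((y1 - y2) / (x1 - x2)).
have d0 : x1 - x2 != 0 by rewrite subr_eq0.
split; first by field.
move: h1 h2 => /= /eqP h1 /eqP h2.
have -> : a = ((y1 ^+ 2 - y2 ^+ 2) - (x1 ^+ 3 - x2 ^+ 3)) / (x1 - x2).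
  by apply: (mulIf d0); rewrite mulfVK // h1 h2; ring.
by field.
Qed.

Lemma padd_slope x1 y1 x2 y2 (h1 : oncurve E (Some (x1, y1)))
    (h2 : oncurve E (Some (x2, y2))) l :
  ~~ ((x1 == x2) && (y1 == - y2)) ->
  y1 = y2 + l * (x1 - x2) ->
  l * (y1 + y2) = x1 ^+ 2 + x1 * x2 + x2 ^+ 2 + a ->
  val (padd (pt h1) (pt h2)) =
  Some (l ^+ 2 - x1 - x2, l * (x1 - (l ^+ 2 - x1 - x2)) - y1).
Proof.
move=> ne e1 e2 /=; rewrite (negPf ne).
suff -> : slope E x1 y1 x2 y2 = l by [].
rewrite /slope; case: eqVneq ne => [e|n12] /= ne.
  subst x2; have ey : y1 = y2 by rewrite e1 subrr mulr0 addr0.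
  subst y2; have y0 : y1 != 0 by apply: contra ne => /eqP->; rewrite oppr0.
  have d0 : 2%:R * y1 != 0 by rewrite mulf_neq0 // two_neq0.
  apply: (mulIf d0); rewrite divfK //.
  have -> : l * (2%:R * y1) = l * (y1 + y1) by ring.
  by rewrite e2; ring.
have d0 : x2 - x1 != 0 by rewrite subr_eq0 eq_sym.
by apply: (mulIf d0); rewrite divfK // e1; ring.
Qed.

Lemma paddC P Q : padd P Q = padd Q P.
Proof.
have [->|[x1 [y1 [h1 ->]]]] := pointP P; first by rewrite padd0P paddP0.
have [->|[x2 [y2 [h2 ->]]]] := pointP Q; first by rewrite padd0P paddP0.
apply: val_inj; have [op|nop] := boolP ((x1 == x2) && (y1 == - y2)).
  move: (op) => /andP[/eqP ex /eqP ey] /=.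
  by rewrite op ex ey opprK !eqxx.
have [l [e1 e2]] := slope_ex h1 h2 nop.
rewrite (padd_slope h1 h2 nop e1 e2) (@padd_slope _ _ _ _ _ _ (l)).
- by congr (Some (_, _)); [ring|rewrite e1; ring].
- by rewrite eq_sym -eqr_oppLR [- _ == _]eq_sym.
- by rewrite e1; ring.
by rewrite addrC e2; ring.
Qed.

Lemma paddPN P : padd P (popp P) = pzero.
Proof. by rewrite paddC paddNP. Qed.

(** This case of associativity comes first because it makes translations injective, which the
    general case uses to cancel. Adding [- Q] back runs along the reflected line, of slope [- l]. *)
Lemma padd_opp P Q : padd (padd P Q) (popp Q) = P.
Proof.
have [->|[x1 [y1 [h1 ->]]]] := pointP P; first by rewrite padd0P paddPN.
have [->|[x2 [y2 [h2 ->]]]] := pointP Q; first by rewrite popp0 !paddP0.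
have [op|nop] := boolP ((x1 == x2) && (y1 == - y2)).
  have -> : padd (pt h1) (pt h2) = pzero.
    by apply: val_inj; rewrite /= op.
  by rewrite padd0P; apply: val_inj => /=; case/andP: op => /eqP-> /eqP->.
have [l [e1 e2]] := slope_ex h1 h2 nop.
have := padd_slope h1 h2 nop e1 e2.
set R := padd _ _; set x3 := l ^+ 2 - _ - _; set y3 := l * _ - _.
case: R => R hR /= ER; subst R.
have h2' : oncurve E (Some (x2, - y2)) by move: h2; rewrite /= sqrrN.
have -> : popp (pt h2) = pt h2' by apply: val_inj.
have el : l ^+ 2 = x1 + x2 + x3 by rewrite /x3; ring.
have e2y : l * (2%:R * y2) = x1 ^+ 2 + x1 * x2 + x2 ^+ 2 + a - l ^+ 2 * (x1 - x2).
  by rewrite -e2 e1; ring.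
have e3 : y3 = - y2 - l * (x3 - x2) by rewrite /y3 e1; ring.
apply: val_inj; rewrite (@padd_slope _ _ _ _ _ _ (- l)) /=.
- by congr (Some (_, _)); [rewrite sqrrN el; ring | rewrite e3 e1 sqrrN el; ring].
(* The excluded case is [P + Q = Q]. It would give [y2 = 0], and the slope relation would make [x2]
   a double root of the cubic. *)
- rewrite opprK; apply/negP=> /andP[/eqP ex /eqP ey].
  have y20 : y2 = 0 by apply: oppr_id0; rewrite -{1}ey e3 ex; ring.
  have /deriv_neq0/eqP[] : x2 ^+ 3 + a * x2 + b = 0.
    by move: h2 => /= /eqP <-; rewrite y20 expr0n.
  have /eqP := e2y; rewrite y20 !mulr0 eq_sym => /eqP.
  by rewrite el ex => <-; ring.
- by rewrite e3; ring.
have -> : - l * (y3 + - y2) = l * (2%:R * y2) + l ^+ 2 * (x3 - x2).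
  by rewrite e3; ring.
by rewrite e2y el; ring.
Qed.

Lemma padd_injr S : injective (fun P => padd P S).
Proof. by move=> P Q /= e; rewrite -(padd_opp P S) e padd_opp. Qed.

End GroupLaw.

Lemma sqrt_ex (K : closedFieldType) (c : K) : exists d, d ^+ 2 = c.
Proof.
have /closed_rootP[x /rootP hx] : size ('X^2 - c%:P) != 1 by rewrite size_XnsubC.
by exists x; move: hx; rewrite !hornerE => /eqP; rewrite subr_eq0 => /eqP.
Qed.

(** * Properties of all but finitely many points; associativity *)

Section Almost.

Variables (K : closedFieldType) (E : wcurve K).
Implicit Types P Q S T : point E.
Local Notation a := (wa E).
Local Notation b := (wb E).
Local Notation pt h := (exist (oncurve E) (Some (_, _)) h).

(** Cofinite sets stand in for dense open sets: they are stable under intersection and translation,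
    and they are nonempty because the field is infinite. *)
Definition almost (Pr : point E -> Prop) :=
  exists s : seq (point E), forall P, P \notin s -> Pr P.

Lemma almost_and (A B : point E -> Prop) :
  almost A -> almost B -> almost (fun P => A P /\ B P).
Proof.
move=> [s hs] [t ht]; exists (s ++ t) => P.
by rewrite mem_cat negb_or => /andP[/hs ? /ht].
Qed.

Lemma almostW (A B : point E -> Prop) :
  (forall P, A P -> B P) -> almost A -> almost B.
Proof. by move=> h [s hs]; exists s => P /hs/h. Qed.

Lemma almost_neq Q : almost (fun P => P <> Q).
Proof. by exists [:: Q] => P; rewrite inE => /eqP. Qed.

Lemma point_over x : exists y, oncurve E (Some (x, y)).
Proof.
by have [y hy] := sqrt_ex (x ^+ 3 + a * x + b); exists y; rewrite /= hy.
Qed.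

Lemma almost_ex (A : point E -> Prop) : almost A -> exists P, A P.
Proof.
move=> [s hs].
pose xs := [seq (if val P is Some (x, _) then x else 0) | P <- s].
have /closed_nonrootP[x] : \prod_(z <- xs) ('X - z%:P) != 0.
  by rewrite monic_neq0 // monic_prod_XsubC.
rewrite root_prod_XsubC => hx; have [y h] := point_over x.
exists (pt h); apply: hs; apply: contra hx.
by move=> /(map_f (fun P => if val P is Some (x, _) then x else 0)).
Qed.

Lemma almost_ex2 (A B : point E -> Prop) :
  almost A -> almost B -> exists2 P, A P & B P.
Proof. by move=> hA hB; have [P []] := almost_ex (almost_and hA hB); exists P. Qed.

Lemma almost_bij (f g : point E -> point E) (A : point E -> Prop) :
  cancel f g -> almost A -> almost (fun P => A (f P)).
Proof.
move=> fg [s hs]; exists (map g s) => P nP; apply: hs.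
by apply: contra nP => /(map_f g); rewrite fg.
Qed.

Lemma almost_opp (A : point E -> Prop) :
  almost A -> almost (fun P => A (popp P)).
Proof. exact: almost_bij (@poppK _ E). Qed.

Lemma almost_addr Q (A : point E -> Prop) :
  almost A -> almost (fun P => A (padd P Q)).
Proof. by apply: (@almost_bij _ (fun P => padd P (popp Q))) => P; exact: padd_opp. Qed.

Lemma padd_generic P Q : almost (fun S => padd (padd P Q) S = padd P (padd Q S)).
Proof.
have [->|[x1 [y1 [h1 eP]]]] := pointP P; first by exists [::] => S _; rewrite !padd0P.
have [->|[x2 [y2 [h2 eQ]]]] := pointP Q.
  by exists [::] => S _; rewrite padd0P paddP0.
have [op|nop] := boolP ((x1 == x2) && (y1 == - y2)).
  have -> : P = popp Q.
    by apply: val_inj; rewrite eP eQ /=; case/andP: op => /eqP-> /eqP->.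
  exists [::] => S _; rewrite paddNP padd0P [padd Q S]paddC [RHS]paddC.
  by rewrite -{2}[Q]poppK -{1}[S](padd_opp S Q) poppK.
have [l [e1 e2]] := slope_ex h1 h2 nop.
have := padd_slope h1 h2 nop e1 e2.
set x12 := l ^+ 2 - _ - _; set y12 := l * _ - _ => vPQ.
have h12 : oncurve E (Some (x12, y12)) by rewrite -vPQ; exact: (valP (padd _ _)).
have ePQ : padd P Q = pt h12 by apply: val_inj; rewrite eP eQ vPQ.
(* Outside this list all remaining additions are chords: the abscissa of [S] differs from those of
   [P], [Q] and [P + Q], and the last two entries keep [Q + S] away from [P] and [- P]. *)
pose bad := [:: pzero; P; popp P; Q; popp Q; padd P Q; popp (padd P Q);
  padd P (popp Q); padd (popp P) (popp Q)].
exists bad => S.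
rewrite !inE !negb_or => /and5P[S0 SP SP' SQ /and5P[SQ' SPQ SPQ' SPmQ SmPQ]].
have [eS|[x3 [y3 [h3 eS]]]] := pointP S; first by rewrite eS eqxx in S0.
have nx x y (h : oncurve E (Some (x, y))) : S != pt h -> S != popp (pt h) -> x3 != x.
  move=> n1 n2; apply/eqP=> e; subst x.
  have [e'|e'] := same_x h h3.
    by case/eqP: n1; rewrite eS; apply: val_inj; rewrite /= e'.
  by case/eqP: n2; rewrite eS; apply: val_inj; rewrite /= e'.
have x31 : x3 != x1 by apply: (nx _ _ h1); rewrite -eP.
have x32 : x3 != x2 by apply: (nx _ _ h2); rewrite -eQ.
have x312 : x3 != x12 by apply: (nx _ _ h12); rewrite -ePQ.
have nop23 : ~~ ((x2 == x3) && (y2 == - y3)) by rewrite eq_sym (negPf x32).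
have [m [m1 m2]] := slope_ex h2 h3 nop23.
have := padd_slope h2 h3 nop23 m1 m2.
set x23 := m ^+ 2 - _ - _; set y23 := m * _ - _ => vQS.
have h23 : oncurve E (Some (x23, y23)) by rewrite -vQS; exact: (valP (padd _ _)).
have eQS : padd Q S = pt h23 by apply: val_inj; rewrite eQ eS vQS.
have x231 : x23 != x1.
  apply/eqP=> e; have [e'|e'] : padd Q S = P \/ padd Q S = popp P.
  - move: (h23); rewrite e => h23'.
    have [ey|ey] := same_x h1 h23'; [left|right]; rewrite eQS eP; apply: val_inj;
      by rewrite /= e ey.
  - by case/eqP: SPmQ; rewrite -e' [padd Q S]paddC padd_opp.
  by case/eqP: SmPQ; rewrite -e' [padd Q S]paddC padd_opp.
have x123 : x12 != x3 by rewrite eq_sym.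
have x123' : x1 != x23 by rewrite eq_sym.
apply: val_inj; rewrite ePQ eQS eP eS /= /slope.
rewrite (negPf x123) (negPf x123') /=.
have x13 : x1 != x3 by rewrite eq_sym.
have e3 : y3 = y2 + m * (x3 - x2) by rewrite m1; ring.
have rel : 2%:R * y2 * (l - m) + l ^+ 2 * (x1 - x2) - m ^+ 2 * (x3 - x2) =
    (x1 - x3) * (x1 + x2 + x3).
  have -> : 2%:R * y2 * (l - m) + l ^+ 2 * (x1 - x2) - m ^+ 2 * (x3 - x2) =
    l * (y1 + y2) - m * (y2 + y3) by rewrite e1 e3; ring.
  by rewrite e2 m2; ring.
have [-> ->] := slope_assoc (two_neq0 E) e1 e3 rel x13 x123 x123'.
by [].
Qed.

(* Both sides agree after adding a generic point [S]. *)
Lemma paddA P Q T : padd P (padd Q T) = padd (padd P Q) T.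
Proof.
have [S [h1 [h2 [h3 h4]]]] := almost_ex (almost_and (padd_generic (padd P Q) T)
  (almost_and (padd_generic P (padd Q T)) (almost_and (padd_generic Q T)
   (almost_bij (f := padd T) (g := fun P => padd P (popp T))
     (fun P => etrans (congr1 (fun R => padd R _) (paddC _ _)) (padd_opp P T))
     (padd_generic P Q))))).
apply: (@padd_injr _ _ S); by rewrite h1 h2 h3 h4.
Qed.

End Almost.

(** * Complete addition laws *)

HB.instance Definition _ (K : closedFieldType) (E : wcurve K) :=
  GRing.isZmodule.Build (point E) (@paddA K E) (@paddC K E) (@padd0P K E)
    (@paddNP K E).

Lemma pmulzE (K : closedFieldType) (E : wcurve K) n (P : point E) :
  pmulz n P = P *~ n.
Proof.
have h m : iter m (padd P) pzero = P *+ m.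
  by elim: m => // m IH; rewrite mulrS -IH.
by case: n => m; [exact: h | exact: (congr1 (@popp K E) (h m.+1))].
Qed.

Notation i0 := (@Ordinal 3 0 isT).
Notation i1 := (@Ordinal 3 1 isT).
Notation i2 := (@Ordinal 3 2 isT).

Section Laws.

Variable R : comNzRingType.
Implicit Types u v : 'I_3 -> R.

(* The addition laws of Bosma and Lenstra attached to the lines [Z = 0] and
   [Y = 0]: the first one vanishes exactly when [P = Q], where the second one
   does not. *)
Definition law1 (a b : R) u v : 'I_3 -> R :=
  let: (x1, y1, z1) := (u i0, u i1, u i2) in
  let: (x2, y2, z2) := (v i0, v i1, v i2) in
  let s := a * (x1 * z2 + x2 * z1) + 3%:R * b * z1 * z2 - y1 * y2 in
  nth 0 [::
    (x1 * y2 - x2 * y1) * (y1 * z2 + y2 * z1) - (x1 * z2 - x2 * z1) * s;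
    (y1 * z2 - y2 * z1) * s
      - (3%:R * x1 * x2 + a * z1 * z2) * (x1 * y2 - x2 * y1);
    (3%:R * x1 * x2 + a * z1 * z2) * (x1 * z2 - x2 * z1)
      - (y1 * z2 + y2 * z1) * (y1 * z2 - y2 * z1)].

Definition law2 (a b : R) u v : 'I_3 -> R :=
  let: (x1, y1, z1) := (u i0, u i1, u i2) in
  let: (x2, y2, z2) := (v i0, v i1, v i2) in
  let s := a * (x1 * z2 + x2 * z1) + 3%:R * b * z1 * z2 in
  let t := a * x1 * x2 + 3%:R * b * (x1 * z2 + x2 * z1) - a ^+ 2 * z1 * z2 in
  nth 0 [::
    (x1 * y2 + x2 * y1) * (y1 * y2 - s) - (y1 * z2 + y2 * z1) * t;
    (y1 * y2 + s) * (y1 * y2 - s) + (3%:R * x1 * x2 + a * z1 * z2) * t;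
    (y1 * z2 + y2 * z1) * (y1 * y2 + s)
      + (x1 * y2 + x2 * y1) * (3%:R * x1 * x2 + a * z1 * z2)].

Definition law (k : bool) := if k then law1 else law2.

Lemma ord3P (A : 'I_3 -> Prop) : (forall i, A i) <-> [/\ A i0, A i1 & A i2].
Proof.
split=> [h|[h0 h1 h2]]; first by split.
by case=> -[|[|[|//]]] /= h; [move: h0|move: h1|move: h2];
  congr A; apply: val_inj.
Qed.

Lemma law_scale k a b c d u v u' v' :
  (forall i, u' i = c * u i) -> (forall i, v' i = d * v i) ->
  forall i, law k a b u' v' i = (c * d) ^+ 2 * law k a b u v i.
Proof.
by move=> hu hv; apply/ord3P; case: k; rewrite /law /law1 /law2 !hu !hv /=; split; ring.
Qed.

End Laws.

Lemma law_morph (R S : comNzRingType) (f : {rmorphism R -> S}) k a b u v i :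
  f (law k a b u v i) = law k (f a) (f b) (f \o u) (f \o v) i.
Proof.
move: i; apply/ord3P; case: k; rewrite /law /law1 /law2 /=;
  by rewrite !(rmorphB, rmorphD, rmorphM, rmorphXn, rmorph1); split.
Qed.

Section LawsPoint.

Variables (K : closedFieldType) (E : wcurve K).
Implicit Types P Q S T : point E.
Local Notation a := (wa E).
Local Notation b := (wb E).
Local Notation pt h := (exist (oncurve E) (Some (_, _)) h).
Local Notation hc := (@homog_coord K E).

Lemma hc_neq0 P : exists i, hc P i != 0.
Proof.
case: P => -[[x y]|] h.
  by exists i2; rewrite /homog_coord /= oner_neq0.
by exists i1; rewrite /homog_coord /= oner_neq0.
Qed.

Lemma hc_inj c P Q : (forall i, hc Q i = c * hc P i) -> P = Q.
Proof.
move=> /(iffLR (ord3P _)); case: P Q => [[[x y]|] h] [[[x' y']|] h']; rewrite /homog_coord /=.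
- move=> [e0 e1 /esym]; rewrite mulr1 => e2; apply: val_inj => /=.
  by rewrite e0 e1 e2 !mul1r.
- move=> [_ /esym + /esym]; rewrite mulr1 => + c0.
  by rewrite c0 mul0r => /eqP; rewrite eq_sym oner_eq0.
- by move=> [_ _ /eqP]; rewrite mulr0 oner_eq0.
by move=> _; apply: val_inj.
Qed.

Lemma law_padd k P Q :
  exists c, forall i, law k a b (hc P) (hc Q) i = c * hc (padd P Q) i.
Proof.
suff [c h] : exists c,
   [/\ law k a b (hc P) (hc Q) i0 = c * hc (padd P Q) i0,
       law k a b (hc P) (hc Q) i1 = c * hc (padd P Q) i1 &
       law k a b (hc P) (hc Q) i2 = c * hc (padd P Q) i2] by exists c; apply/ord3P.
have [->|[x1 [y1 [h1 ->]]]] := pointP P.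
  rewrite padd0P; have [->|[x2 [y2 [h2 ->]]]] := pointP Q.
    exists (if k then 0 else 1); rewrite /homog_coord /law /law1 /law2 /=.
    by case: k => /=; split; ring.
  exists (if k then - 1 else y2); rewrite /homog_coord /law /law1 /law2 /=.
  by case: k => /=; split; ring.
have [->|[x2 [y2 [h2 ->]]]] := pointP Q.
  rewrite paddP0.
  exists (if k then 1 else y1); rewrite /homog_coord /law /law1 /law2 /=.
  by case: k => /=; split; ring.
have eb : b = y1 ^+ 2 - x1 ^+ 3 - a * x1 by move: h1 => /= /eqP->; ring.
have [op|nop] := boolP ((x1 == x2) && (y1 == - y2)).
  have -> : padd (pt h1) (pt h2) = pzero by apply: val_inj; rewrite /= op.
  case/andP: op => /eqP ex /eqP ey.
  have ey2 : y2 = - y1 by rewrite ey opprK.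
  (* The factor is the coordinate that [homog_coord] normalises to 1: Y here, where the sum is at
     infinity, and Z below, where it is affine. *)
  exists (law k a b (hc (pt h1)) (hc (pt h2)) i1).
  rewrite /homog_coord /law /law1 /law2 /=.
  by case: k => /=; rewrite -ex ey2 eb; split; ring.
have [l [e1 e2]] := slope_ex h1 h2 nop.
have := padd_slope h1 h2 nop e1 e2.
case: (padd _ _) => R hR /= ER; subst R.
exists (law k a b (hc (pt h1)) (hc (pt h2)) i2).
have ea : a = l * (y1 + y2) - (x1 ^+ 2 + x1 * x2 + x2 ^+ 2) by rewrite e2; ring.
rewrite /homog_coord /law /law1 /law2 /=.
by case: k => /=; rewrite eb ea e1; split; ring.
Qed.

(** For affine points the nonzero coordinate is a cube up to a constant: [(x2 - x1) ^ 3] for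
    distinct abscissas, [8 y1 ^ 3] for equal ones with [y1] nonzero, and at a 2-torsion point minus
    the cube of the derivative of the cubic. *)
Lemma law_neq0 P Q : exists k i, law k a b (hc P) (hc Q) i != 0.
Proof.
have n2 := two_neq0 E.
have n8 : 8%:R != 0 :> K by rewrite (natrX _ 2 3) expf_neq0.
have [->|[x1 [y1 [h1 ->]]]] := pointP P.
  have [->|[x2 [y2 [h2 ->]]]] := pointP Q.
    exists false, i1; rewrite /homog_coord /law /law2 /=.
    by apply: contra_neq (oner_neq0 K) => <-; ring.
  exists true, i2; rewrite /homog_coord /law /law1 /=.
  by apply: contra_neq (oner_neq0 K) => /(congr1 -%R); rewrite oppr0 => <-; ring.
have [->|[x2 [y2 [h2 ->]]]] := pointP Q.
  exists true, i2; rewrite /homog_coord /law /law1 /=.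
  by apply: contra_neq (oner_neq0 K) => <-; ring.
have eb : b = y1 ^+ 2 - x1 ^+ 3 - a * x1 by move: h1 => /= /eqP->; ring.
have [ex|nx] := eqVneq x1 x2.
  subst x2; have [y0|y0] := eqVneq y1 0.
    have y20 : y2 = 0 by have [->|->] := same_x h1 h2; rewrite ?y0 ?oppr0.
    exists false, i1; rewrite /homog_coord /law /law2 /=.
    rewrite eb y20 y0.
    have : 3%:R * x1 ^+ 2 + a != 0.
      by apply: (@deriv_neq0 _ E); rewrite eb y0; ring.
    move/(expf_neq0 3); apply: contra_neq => /(congr1 -%R); rewrite oppr0 => <-.
    ring.
  have nz : 8%:R * y1 ^+ 3 != 0 by rewrite mulf_neq0 ?expf_neq0.
  have [ey|ey] := same_x h1 h2.
    exists false, i2; rewrite /homog_coord /law /law2 /=.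
    by apply: contra_neq nz => <-; rewrite ey eb; ring.
  exists true, i1; rewrite /homog_coord /law /law1 /=.
  by apply: contra_neq nz => <-; rewrite ey eb; ring.
have nop : ~~ ((x1 == x2) && (y1 == - y2)) by rewrite (negPf nx).
have [l [e1 e2]] := slope_ex h1 h2 nop.
have ea : a = l * (y1 + y2) - (x1 ^+ 2 + x1 * x2 + x2 ^+ 2) by rewrite e2; ring.
exists true, i2; rewrite /homog_coord /law /law1 /=.
have : (x2 - x1) ^+ 3 != 0 by rewrite expf_neq0 // subr_eq0 eq_sym.
by apply: contra_neq => <-; rewrite ea e1; ring.
Qed.

End LawsPoint.

(** * Regular maps *)

Lemma dhomogC (n : nat) (R : comNzRingType) (c : R) :
  c%:MP_[n] \is 0.-homog.
Proof. by rewrite -[c%:MP]mulr1 mul_mpolyC; apply: dhomogZ; exact: dhomog1. Qed.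

Lemma meval_dhomog (n : nat) (R : comNzRingType) d (p : {mpoly R[n]}) c v w :
  p \is d.-homog -> (forall i, w i = c * v i) -> p.@[w] = c ^+ d * p.@[v].
Proof.
move=> /dhomogP hp hw; rewrite !mevalE mulr_sumr; apply: eq_big_seq => m /hp hm.
rewrite mulrCA; congr (_ * _).
have {}hm : mdeg m = d := hm; rewrite -hm mdegE -prodrXr -big_split /=.
by apply: eq_bigr => i _; rewrite hw exprMn.
Qed.

Lemma comp_dhomog (n : nat) (R : comNzRingType) d e (p : {mpoly R[n]})
    (q : n.-tuple {mpoly R[n]}) :
  p \is d.-homog -> (forall i, tnth q i \is e.-homog) ->
  p \mPo q \is (d * e).-homog.
Proof.
move=> /dhomogP hp hq; rewrite comp_mpolyEX big_seq; apply: rpred_sum => m /hp hm.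
apply: dhomogZ; have {}hm : mdeg m = d := hm; rewrite comp_mpolyX -hm mdegE.
suff : \prod_(i < n) tnth q i ^+ m i \is (\sum_(i < n) m i * e).-homog.
  by rewrite big_distrl.
elim/big_rec2: _ => [|i k r _ IH]; first exact: dhomog1.
by apply: dhomogM => //; rewrite mulnC; apply: dhomogMn.
Qed.

Lemma law_dhomog (R : comNzRingType) k (a b : R) d e (F G : 'I_3 -> {mpoly R[3]}) :
  (forall i, F i \is d.-homog) -> (forall i, G i \is e.-homog) ->
  forall i, law k a%:MP b%:MP F G i \is (d + e + (d + e)).-homog.
Proof.
move=> hF hG; set D := (d + e)%N.
have hFG i j : F i * G j \is D.-homog by apply: dhomogM.
have hGF i j : G j * F i \is D.-homog by rewrite mulrC.
pose V := {mpoly R[3]}.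
have hC c (p : V) : p \is D.-homog -> c%:MP * p \is D.-homog.
  by move=> hp; rewrite mul_mpolyC dhomogZ.
have h3 (p : V) : p \is D.-homog -> 3%:R * p \is D.-homog.
  by move=> hp; rewrite mulr_natl rpredMn.
have hM (p q : V) : p \is D.-homog -> q \is D.-homog -> p * q \is (D + D).-homog.
  exact: dhomogM.
have hB n (p q : V) : p \is n.-homog -> q \is n.-homog -> p - q \is n.-homog.
  exact: rpredB.
have hD n (p q : V) : p \is n.-homog -> q \is n.-homog -> p + q \is n.-homog.
  exact: rpredD.
apply/(ord3P (fun i => law k a%:MP b%:MP F G i \is (D + D).-homog)).
case: k; rewrite /law /law1 /law2 /= -?mulrA -?rmorphXn /=; split;
  repeat (first [ simple apply hFG | simple apply hGF | simple apply hC
    | simple apply h3 | simple apply hB | simple apply hD | simple apply hM]).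
Qed.

Section Regular.

Variables (K : closedFieldType) (E : wcurve K).
Implicit Types (P Q S T : point E) (f g : point E -> point E).
Local Notation a := (wa E).
Local Notation b := (wb E).
Local Notation hc := (@homog_coord K E).

Lemma regular_cst Q : regular (fun _ : point E => Q).
Proof.
move=> P; exists 0, (fun i => (hc Q i)%:MP); split.
- by move=> i; exact: dhomogC.
- by have [i hi] := hc_neq0 Q; exists i; rewrite mevalC.
by move=> R _; exists 1 => i; rewrite mevalC mul1r.
Qed.

Lemma regular_id : regular (@id (point E)).
Proof.
move=> P; exists 1, (fun i => 'X_i); split.
- by move=> i; rewrite dhomogX; apply/eqP; exact: mdeg1.
- by have [i hi] := hc_neq0 P; exists i; rewrite mevalXU.
by move=> R _; exists 1 => i; rewrite mevalXU mul1r.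
Qed.

Lemma hc_opp P : forall i, hc (popp P) i =
  (if val P is None then 1 else -1) * (if i == i1 then hc P i else - hc P i).
Proof.
by apply/ord3P; case: P => -[[x y]|] h; rewrite /homog_coord /=; split; ring.
Qed.

Lemma regular_opp f : regular f -> regular (fun P => - f P).
Proof.
move=> hf P; have [d [F [h1 [i hi] h3]]] := hf P.
exists d, (fun i => if i == i1 then F i else - F i); split.
- by move=> j; case: ifP => // _; rewrite rpredN.
- by exists i; case: ifP; rewrite // mevalN oppr_eq0.
move=> Q [j]; rewrite (fun_if (meval _)) mevalN => hj.
have [|c hc'] := h3 Q.
  by exists j; case: ifP hj; rewrite ?oppr_eq0.
exists (c * if val (f Q) is None then 1 else -1) => k.
rewrite (fun_if (meval _)) mevalN hc' hc_opp.
by case: ifP => _; case: (val (f Q)) => [_|]; ring.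
Qed.

Lemma regular_add f g :
  regular f -> regular g -> regular (fun P => f P + g P).
Proof.
move=> hf hg P; have [d [F [F1 [i Fi] F3]]] := hf P.
have [e [G [G1 [j Gj] G3]]] := hg P.
(* Near [P] it suffices to use one law that does not vanish at the pair of values taken at [P]. *)
have [k [l hl]] := law_neq0 (f P) (g P).
exists (d + e + (d + e))%N, (law k a%:MP b%:MP F G).
have ev Q m : (law k a%:MP b%:MP F G m).@[hc Q] =
    law k a b (fun i => (F i).@[hc Q]) (fun i => (G i).@[hc Q]) m.
  by rewrite law_morph /= !mevalC.
have prop Q c c' : (forall i, (F i).@[hc Q] = c * hc (f Q) i) ->
   (forall i, (G i).@[hc Q] = c' * hc (g Q) i) ->
   forall m, (law k a%:MP b%:MP F G m).@[hc Q] =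
      (c * c') ^+ 2 * law k a b (hc (f Q)) (hc (g Q)) m.
  by move=> h h' m; rewrite ev (law_scale _ _ _ h h').
split.
- exact: law_dhomog.
- have [c hF] := F3 P (ex_intro _ i Fi); have [c' hG] := G3 P (ex_intro _ j Gj).
  exists l; rewrite (prop _ _ _ hF hG) mulf_neq0 // expf_neq0 // mulf_neq0 //.
    by apply: contraNneq Fi => c0; rewrite hF c0 mul0r.
  by apply: contraNneq Gj => c0; rewrite hG c0 mul0r.
move=> Q [m]; rewrite ev => hm.
have FQ : exists i, (F i).@[hc Q] != 0.
  apply/existsP; apply: contraNT hm => /existsPn h0.
  rewrite (@law_scale _ k a b 0 1 (fun=> 0) (fun i => (G i).@[hc Q]) _ _ _ _ m).
  - by rewrite mul0r expr0n mul0r.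
  - by move=> i'; rewrite mul0r; apply/eqP; rewrite -[_ == _]negbK; exact: h0.
  by move=> i'; rewrite mul1r.
have GQ : exists i, (G i).@[hc Q] != 0.
  apply/existsP; apply: contraNT hm => /existsPn h0.
  rewrite (@law_scale _ k a b 1 0 (fun i => (F i).@[hc Q]) (fun=> 0) _ _ _ _ m).
  - by rewrite mulr0 expr0n mul0r.
  - by move=> i'; rewrite mul1r.
  by move=> i'; rewrite mul0r; apply/eqP; rewrite -[_ == _]negbK; exact: h0.
have [c hF] := F3 Q FQ; have [c' hG] := G3 Q GQ.
have [c'' hL] := law_padd k (f Q) (g Q).
by exists ((c * c') ^+ 2 * c'') => i'; rewrite (prop _ _ _ hF hG) hL mulrA.
Qed.

Lemma regular_comp f g : regular f -> regular g -> regular (f \o g).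
Proof.
move=> hf hg P; have [e [G [G1 [j Gj] G3]]] := hg P.
have [d [F [F1 [i Fi] F3]]] := hf (g P).
(* Degree 0 is separate: constant forms do not vanish where all the [G l] vanish, so substituting
   could give a nonzero triple at a point where [G] says nothing about [g]. *)
case: d F1 => [|d] F1.
  have cF m v w : (F m).@[v] = (F m).@[w].
    have c0 u : (F m).@[u] = (F m).@[fun=> 0].
      rewrite [RHS](meval_dhomog (c := 0) (v := u) (F1 m)) ?mul1r // => l.
      by rewrite mul0r.
    by rewrite c0 [RHS]c0.
  exists 0, F; split=> [//||Q _].
    by exists i; rewrite (cF _ _ (hc (g P))).
  have [|c hF] := F3 (g Q); first by exists i; rewrite (cF _ _ (hc (g P))).
  by exists c => m; rewrite (cF _ _ (hc (g Q))) hF.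
pose H m := F m \mPo [tuple G l | l < 3].
have ev Q m : (H m).@[hc Q] = (F m).@[fun l => (G l).@[hc Q]].
  by rewrite comp_mpoly_meval; apply: meval_eq => l; rewrite tnth_mktuple.
exists (d.+1 * e)%N, H; split.
- by move=> m; apply: comp_dhomog => // l; rewrite tnth_mktuple.
- have [c hG] := G3 P (ex_intro _ j Gj).
  exists i; rewrite ev (meval_dhomog (F1 i) hG) mulf_neq0 // expf_neq0 //.
  by apply: contraNneq Gj => c0; rewrite hG c0 mul0r.
move=> Q [m]; rewrite ev => hm.
have GQ : exists i, (G i).@[hc Q] != 0.
  apply/existsP; apply: contraNT hm => /existsPn h0.
  rewrite (meval_dhomog (c := 0) (v := fun=> 0) (F1 m)) ?expr0n ?mul0r // => l.
  by apply/eqP; rewrite -[_ == _]negbK; exact: h0.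
have [c hG] := G3 Q GQ; move: hm; rewrite (meval_dhomog (F1 m) hG).
rewrite mulf_eq0 negb_or => /andP[_ hm].
have [c' hF] := F3 (g Q) (ex_intro _ m hm).
by exists (c ^+ d.+1 * c') => l; rewrite ev (meval_dhomog (F1 l) hG) hF mulrA.
Qed.

End Regular.

(** * Points over a rational function field *)

Section Pencil.

Variable K : closedFieldType.
Hypothesis two0 : 2%:R != 0 :> K.
Implicit Types p q u v : {poly K}.

Definition is_square p := exists u, p = u ^+ 2.

Lemma square_scale c p : is_square p -> is_square (c *: p).
Proof.
by move=> [u ->]; have [d <-] := sqrt_ex c; exists (d *: u); rewrite exprZn.
Qed.

Lemma square_scaleK c p : c != 0 -> is_square (c *: p) -> is_square p.
Proof.
by move=> c0 /(square_scale c^-1); rewrite scalerA mulVf // scale1r.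
Qed.

(** Up to a constant, [p] is the square of its gcd with [w]; over an algebraically closed field the
    constant is itself a square. *)
Lemma square_coprime p q w : coprimep p q -> p * q = w ^+ 2 -> is_square p.
Proof.
move=> cpq e; have [p0|p0] := eqVneq p 0; first by exists 0; rewrite p0 expr0n.
have : p %= gcdp p w ^+ 2.
  rewrite /eqp; apply/andP; split.
    rewrite expr2; apply: (@dvdp_trans _ (gcdp (p * gcdp p w) (w * gcdp p w))); last first.
      by rewrite (eqp_dvdr _ (mulp_gcdl _ _ _)) dvdpp.
    rewrite dvdp_gcd dvdp_mulr //= mulrC.
    apply: (@dvdp_trans _ (gcdp (p * w) (w * w))); last first.
      by rewrite (eqp_dvdr _ (mulp_gcdl _ _ _)) mulrC dvdpp.
    by rewrite dvdp_gcd dvdp_mulr //= -expr2 -e dvdp_mulr.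
  have cg : coprimep (gcdp p w ^+ 2) q.
    by rewrite coprimep_expl //; apply: coprimep_dvdr cpq; exact: dvdp_gcdl.
  by rewrite -(Gauss_dvdpl _ cg) e dvdp_exp2r // dvdp_gcdr.
move=> /eqpP[[c d] /= /andP[c0 d0] h].
apply: (square_scaleK c0); rewrite h.
by apply: square_scale; exists (gcdp p w).
Qed.

Lemma coprimep_lin u v (c1 d1 c2 d2 : K) : c1 * d2 - c2 * d1 != 0 ->
  coprimep u v -> coprimep (c1 *: u + d1 *: v) (c2 *: u + d2 *: v).
Proof.
move=> hd /coprimepP cuv; apply/coprimepP => r r1 r2; apply: cuv.
  have : r %| d2 *: (c1 *: u + d1 *: v) - d1 *: (c2 *: u + d2 *: v).
    by rewrite dvdp_sub // -mul_polyC dvdp_mull.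
  have -> : d2 *: (c1 *: u + d1 *: v) - d1 *: (c2 *: u + d2 *: v) =
     (c1 * d2 - c2 * d1) *: u.
    by rewrite -!mul_polyC !(rmorphB, rmorphM) /=; ring.
  by rewrite dvdpZr.
have : r %| c1 *: (c2 *: u + d2 *: v) - c2 *: (c1 *: u + d1 *: v).
  by rewrite dvdp_sub // -mul_polyC dvdp_mull.
have -> : c1 *: (c2 *: u + d2 *: v) - c2 *: (c1 *: u + d1 *: v) =
   (c1 * d2 - c2 * d1) *: v.
  by rewrite -!mul_polyC !(rmorphB, rmorphM) /=; ring.
by rewrite dvdpZr.
Qed.

(** Descent on the degree. With [p = u ^ 2], [q = v ^ 2] and [l = m ^ 2], the squares [p - q] and
    [p - l q] split into the coprime factors [u - v], [u + v] and [u - m v], [u + m v]. These four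
    are again squares and form, after rescaling, a pencil of the same kind with half the degree. *)
Lemma pencil n p q (l : K) :
  (size p <= n)%N -> (size q <= n)%N -> coprimep p q -> l != 0 -> l != 1 ->
  is_square p -> is_square q -> is_square (p - q) -> is_square (p - l *: q) ->
  (size p <= 1)%N /\ (size q <= 1)%N.
Proof.
elim: n p q l => [|n IH] p q l sp sq cpq l0 l1 [u eu] [v ev] [s es] [t et].
  by rewrite (leq_trans sp) // (leq_trans sq).
have cuv : coprimep u v.
  by move: cpq; rewrite eu ev coprimep_pexpl // coprimep_pexpr.
have [m em] := sqrt_ex l.
have m0 : m != 0 by apply: contraNneq l0 => m0; rewrite -em m0 expr0n.
have m1 : 1 + m != 0.
  apply: contraNneq l1 => h0; move/eqP: h0.
  by rewrite addrC addr_eq0 => /eqP h; rewrite -em h sqrrN expr1n.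
have m1' : m - 1 != 0.
  by apply: contraNneq l1 => h0; move/eqP: h0; rewrite subr_eq0 => /eqP h; rewrite -em h expr1n.
have fac (k : K) (w : {poly K}) : u ^+ 2 - k ^+ 2 *: v ^+ 2 = w ^+ 2 -> k != 0 ->
    is_square (u - k *: v) /\ is_square (u + k *: v).
  move=> e k0.
  have e' : (u - k *: v) * (u + k *: v) = w ^+ 2.
    by rewrite -e -subr_sqr exprZn.
  have c : coprimep (u - k *: v) (u + k *: v).
    have := @coprimep_lin u v 1 (- k) 1 k _ cuv; rewrite !scale1r scaleNr; apply.
    by rewrite !mul1r opprK -mulr2n -mulr_natl mulf_neq0.
  split; first exact: square_coprime c e'.
  by rewrite coprimep_sym in c; apply: square_coprime c _; rewrite mulrC; exact: e'.
have [s1 s2] : is_square (u - 1 *: v) /\ is_square (u + 1 *: v).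
  by apply: (@fac 1 s); rewrite ?oner_neq0 // expr1n scale1r -eu -ev.
have [t1 t2] : is_square (u - m *: v) /\ is_square (u + m *: v).
  by apply: (@fac m t) => //; rewrite em -eu -ev.
rewrite !scale1r in s1 s2.
(* The scalars are chosen so that [p' - q'] is a multiple of [u - m v]; then [u + m v] is the member
   of parameter [((1 + m) / (m - 1)) ^ 2], which is not 1 because
   [(1 + m) ^ 2 - (m - 1) ^ 2 = 4 m]. *)
pose p' : {poly K} := (1 + m) *: (u - v); pose q' : {poly K} := (m - 1) *: (u + v).
have size_sq (w : {poly K}) : (size (w ^+ 2) <= n.+1)%N -> (size w <= n)%N \/ (size w <= 1)%N.
  have := size_exp w 2; case: (size w) => [|[|k]]; [by left|by right|].
  case: (size (w ^+ 2)) => [|k'] /=; first by rewrite mulSn.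
  move=> ->; rewrite ltnS => h; left; apply: leq_trans h.
  by rewrite muln2 -addnn addSn addnS !ltnS leq_addr.
have small (w : {poly K}) : (size w <= 1)%N -> (size (w ^+ 2) <= 1)%N.
  by move=> /size1_polyC->; rewrite -rmorphXn size_polyC leq_b1.
have [/andP[un vn]|uv1] : ((size u <= n)%N && (size v <= n)%N) \/
    ((size u <= 1)%N && (size v <= 1)%N).
  case: n sp sq {IH} size_sq => [|n] sp sq size_sq.
    right; apply/andP; split.
      by move: sp; rewrite eu => /size_sq[]// h; exact: leq_trans h _.
    by move: sq; rewrite ev => /size_sq[]// h; exact: leq_trans h _.
  left; rewrite eu in sp; rewrite ev in sq; apply/andP; split.
    by case: (size_sq _ sp) => // h; exact: leq_trans h _.
  by case: (size_sq _ sq) => // h; exact: leq_trans h _.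
have [sp' sq'] : (size p' <= 1)%N /\ (size q' <= 1)%N.
  apply: (IH p' q' (((1 + m) / (m - 1)) ^+ 2)).
  - apply: leq_trans (size_scale_leq _ _) _; apply: leq_trans (size_polyD _ _) _.
    by rewrite size_polyN geq_max un.
  - apply: leq_trans (size_scale_leq _ _) _; apply: leq_trans (size_polyD _ _) _.
    by rewrite geq_max un.
  - have := @coprimep_lin u v (1 + m) (- (1 + m)) (m - 1) (m - 1) _ cuv.
    rewrite scaleNr /p' /q' scalerBr scalerDr; apply.
    have -> : (1 + m) * (m - 1) - (m - 1) * - (1 + m) = 2%:R * ((1 + m) * (m - 1)) by ring.
    by rewrite !mulf_neq0.
  - by rewrite expf_neq0 // mulf_neq0 // invr_eq0.
  - apply/eqP; rewrite expr_div_n => h.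
    have /eqP : 4%:R * m = ((1 + m) ^+ 2 / (m - 1) ^+ 2 - 1) * (m - 1) ^+ 2.
      by field.
    by rewrite h subrr mul0r (natrM _ 2 2) !mulf_eq0 !(negPf two0) (negPf m0).
  - exact: square_scale.
  - exact: square_scale.
  - have -> : p' - q' = 2%:R *: (u - m *: v); last exact: square_scale.
    by rewrite /p' /q' -!mul_polyC !(rmorphB, rmorphD, rmorph1) /=; ring.
  have -> : p' - ((1 + m) / (m - 1)) ^+ 2 *: q' =
      (- 2%:R * ((1 + m) / (m - 1))) *: (u + m *: v); last exact: square_scale.
    have -> : p' = (1 + m) / (m - 1) * (m - 1) *: (u - v) by rewrite divfK.
    set r := _ / _; have hr : 1 + m = r * (m - 1) by rewrite /r divfK.
    have -> : r ^+ 2 *: q' = (r * (1 + m)) *: (u + v).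
      by rewrite /q' scalerA hr; congr (_ *: _); ring.
    by rewrite -!mul_polyC !(rmorphB, rmorphD, rmorphN, rmorphM, rmorph1) /=; ring.
have S1 : (size ((1 + m)^-1 *: p') <= 1)%N := leq_trans (size_scale_leq _ _) sp'.
have S2 : (size ((m - 1)^-1 *: q') <= 1)%N := leq_trans (size_scale_leq _ _) sq'.
have lin (w : {poly K}) : 2%:R *: w = ((1 + m)^-1 *: p' + (m - 1)^-1 *: q') \/
   2%:R *: w = ((m - 1)^-1 *: q' - (1 + m)^-1 *: p') -> (size w <= 1)%N.
  move=> h; rewrite -(size_scale w two0); case: h => ->;
    apply: leq_trans (size_polyD _ _) _; rewrite ?size_polyN geq_max;
    by rewrite S1 S2.
have ep : (1 + m)^-1 *: p' = u - v by rewrite /p' scalerA mulVf // scale1r.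
have eq' : (m - 1)^-1 *: q' = u + v by rewrite /q' scalerA mulVf // scale1r.
rewrite eu ev; split; apply: small; apply: lin; rewrite ep eq'.
  by left; rewrite -mul_polyC rmorph_nat; ring.
by right; rewrite -mul_polyC rmorph_nat; ring.
rewrite eu ev; case/andP: uv1 => u1 v1; split; exact: small.
Qed.

End Pencil.

Section RationalPoint.

Variables (K : closedFieldType) (E : wcurve K).
Local Notation a := (wa E).
Local Notation b := (wb E).

Lemma cubic_roots : exists e1 e2 e3 : K,
  [/\ e1 != e2, e1 != e3, e2 != e3, e3 = - (e1 + e2) &
    a = e1 * e2 - (e1 + e2) ^+ 2 /\ b = e1 * e2 * (e1 + e2)].
Proof.
have two0 := two_neq0 E.
have /closed_rootP[e1 /rootP] : size ('X^3 + (a *: 'X + b%:P)) != 1.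
  rewrite size_polyDl ?size_polyXn // (leq_ltn_trans (size_polyD _ _)) //.
  rewrite gtn_max (leq_ltn_trans (size_scale_leq _ _)) ?size_polyX //.
  by rewrite (leq_ltn_trans (size_polyC_leq1 _)).
rewrite !(hornerD, hornerXn, hornerZ, hornerX, hornerC) addrA => h1.
have [d hd] := sqrt_ex (e1 ^+ 2 - 4%:R * (a + e1 ^+ 2)).
pose e2 := (- e1 + d) / 2%:R; pose e3 := (- e1 - d) / 2%:R.
have ea : a = (e1 ^+ 2 - d ^+ 2) / 4%:R - e1 ^+ 2.
  by rewrite hd; field; rewrite (natrM _ 2 2) mulf_neq0.
have n4 : 4%:R != 0 :> K by rewrite (natrM _ 2 2) mulf_neq0.
have eb : b = - e1 ^+ 3 - a * e1.
  by apply/eqP; rewrite -subr_eq0 -h1; apply/eqP; ring.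
have e3E : e3 = - (e1 + e2) by rewrite /e2 /e3; field; rewrite two0.
have eaE : a = e1 * e2 - (e1 + e2) ^+ 2.
  by rewrite ea /e2; field; rewrite ?two0 ?n4.
have ebE : b = e1 * e2 * (e1 + e2) by rewrite eb eaE; ring.
have h2 : e2 ^+ 3 + a * e2 + b = 0 by rewrite ebE eaE; ring.
have d1 : (e1 - e2) * (e1 - e3) != 0.
  suff -> : (e1 - e2) * (e1 - e3) = 3%:R * e1 ^+ 2 + a.
    by apply: deriv_neq0; rewrite -h1; ring.
  by rewrite ea /e2 /e3; field; rewrite ?two0 ?n4.
have d2 : (e2 - e1) * (e2 - e3) != 0.
  suff -> : (e2 - e1) * (e2 - e3) = 3%:R * e2 ^+ 2 + a.
    by apply: deriv_neq0.
  by rewrite ea /e2 /e3; field; rewrite ?two0 ?n4.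
exists e1, e2, e3; split => //.
- by apply: contraNneq d1 => ->; rewrite subrr mul0r.
- by apply: contraNneq d1 => ->; rewrite subrr mulr0.
by apply: contraNneq d2 => ->; rewrite subrr mulr0.
Qed.

(** Write [g0 / g2 = A / B] in lowest terms. The curve equation makes the product of [B] and the
    three [A - e B], with [e] a root of the cubic, a square. These factors are pairwise coprime, so
    each is a square, and all four belong to one pencil: hence [A] and [B] are constant. *)
Lemma rational_point_const (g0 g1 g2 : {poly K}) : g2 != 0 ->
  g1 ^+ 2 * g2 = g0 ^+ 3 + a%:P * g0 * g2 ^+ 2 + b%:P * g2 ^+ 3 ->
  exists c0 c1, g0 = c0 *: g2 /\ g1 = c1 *: g2.
Proof.
move=> g20 curve; have two0 := two_neq0 E.
have [e1 [e2 [e3 [n12 n13 n23 e3E [ea eb]]]]] := cubic_roots.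
have facP (u v : {poly K}) : u ^+ 3 + a%:P * u * v ^+ 2 + b%:P * v ^+ 3 =
    (u - e1 *: v) * (u - e2 *: v) * (u - e3 *: v).
  by rewrite ea eb e3E -!mul_polyC !(rmorphD, rmorphN, rmorphB, rmorphXn, rmorphM) /=; ring.
have [d [A [B [d0 eA eB cAB]]]] : exists d A B,
    [/\ d != 0, g0 = A * d, g2 = B * d & coprimep A B].
  exists (gcdp g0 g2), (g0 %/ gcdp g0 g2), (g2 %/ gcdp g0 g2).
  rewrite !divpK ?dvdp_gcdl ?dvdp_gcdr // gcdp_eq0 (negPf g20) andbF.
  by split=> //; apply: coprimep_div_gcd; rewrite g20 orbT.
have B0 : B != 0 by apply: contraNneq g20 => B0; rewrite eB B0 mul0r.
pose F (e : K) := A - e *: B.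
have Fd e : g0 - e *: g2 = F e * d by rewrite eA eB /F mulrBl scalerAl.
have eq1 : g1 ^+ 2 * B = d ^+ 2 * (F e1 * F e2 * F e3).
  apply: (mulIf d0); have -> : g1 ^+ 2 * B * d = g1 ^+ 2 * g2 by rewrite eB; ring.
  by rewrite curve facP !Fd; ring.
have : d ^+ 2 %| (g1 * B ^+ 2) ^+ 2.
  have -> : (g1 * B ^+ 2) ^+ 2 = (g1 ^+ 2 * B) * B ^+ 3 by ring.
  by rewrite eq1 -mulrA dvdp_mulr.
rewrite dvdp_pexp2r // => /dvdpP[W eW].
have sqW : W ^+ 2 = B * (F e1 * F e2 * F e3) * B ^+ 2.
  have d20 : d ^+ 2 != 0 by rewrite expf_neq0.
  apply: (mulIf d20); rewrite -exprMn -eW.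
  have -> : (g1 * B ^+ 2) ^+ 2 = (g1 ^+ 2 * B) * B ^+ 3 by ring.
  by rewrite eq1; ring.
have B20 : B ^+ 2 != 0 by rewrite expf_neq0.
have {W eW sqW} [W sqW] : exists W, W ^+ 2 = B * (F e1 * F e2 * F e3).
  have : B ^+ 2 %| W ^+ 2 by rewrite sqW dvdp_mull.
  rewrite dvdp_pexp2r // => /dvdpP[V eV]; exists V.
  by apply: (mulIf B20); rewrite -sqW eV; ring.
have cFB e : coprimep (F e) B.
  have := @coprimep_lin _ A B 1 (- e) 0 1 _ cAB.
  by rewrite !scale1r scale0r add0r scaleNr; apply; rewrite !mul1r mul0r subr0 oner_neq0.
have cFF e e' : e != e' -> coprimep (F e) (F e').
  move=> ne; have := @coprimep_lin _ A B 1 (- e) 1 (- e') _ cAB.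
  rewrite !scale1r !scaleNr; apply.
  by rewrite !mul1r opprK addrC subr_eq0.
have n21 : e2 != e1 by rewrite eq_sym.
have n31 : e3 != e1 by rewrite eq_sym.
have n32 : e3 != e2 by rewrite eq_sym.
have cBF e : coprimep B (F e) by rewrite coprimep_sym.
have sB : is_square B.
  by apply: (square_coprime _ (esym sqW)); rewrite !coprimepMr !cBF.
have s1 : is_square (F e1).
  apply: (@square_coprime _ _ (B * F e2 * F e3) W); last by rewrite sqW; ring.
  by rewrite !coprimepMr cFB !cFF.
have s2 : is_square (F e2).
  apply: (@square_coprime _ _ (B * F e1 * F e3) W); last by rewrite sqW; ring.
  by rewrite !coprimepMr cFB !cFF.
have s3 : is_square (F e3).
  apply: (@square_coprime _ _ (B * F e1 * F e2) W); last by rewrite sqW; ring.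
  by rewrite !coprimepMr cFB !cFF.
have hF e : F e1 - (e - e1) *: B = F e by rewrite /F scalerBl; ring.
have d21 : e2 - e1 != 0 by rewrite subr_eq0.
have [] := @pencil K two0 _ (F e1) ((e2 - e1) *: B) ((e3 - e1) / (e2 - e1))
  (leq_maxl _ _) (leq_maxr _ _).
- by rewrite coprimepZr.
- by rewrite mulf_neq0 ?invr_eq0 ?subr_eq0.
- rewrite -subr_eq0 -[X in _ - X](divff d21) -mulrBl mulf_neq0 ?invr_eq0 //.
  by rewrite opprB addrA subrK subr_eq0.
- exact: s1.
- exact: square_scale.
- by rewrite hF.
- by rewrite scalerA divfK // hF.
rewrite size_scale // => sF sB1.
have [c2 ec2] : exists c2, B = c2%:P by exists B`_0; exact: size1_polyC.
have [c1 ec1] : exists c1, F e1 = c1%:P by exists (F e1)`_0; exact: size1_polyC.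
have c20 : c2 != 0 by apply: contraNneq B0 => c0; rewrite ec2 c0.
have [c ec] : exists c, g0 = c *: g2.
  exists (e1 + c1 / c2).
  have : F e1 = (c1 / c2) *: B by rewrite ec1 ec2 -mul_polyC -polyCM divfK.
  rewrite scalerDl => eF; have := Fd e1; rewrite eF => /eqP.
  by rewrite subr_eq eB -scalerAl addrC => /eqP.
have [k ek] := sqrt_ex (c ^+ 3 + a * c + b).
have : (g1 - k *: g2) * (g1 + k *: g2) = 0.
  apply: (mulIf g20); rewrite mul0r -subr_sqr mulrBl curve ec !exprZn ek -!mul_polyC.
  by rewrite !(rmorphD, rmorphXn, rmorphM) /=; ring.
move/eqP; rewrite mulf_eq0 => /orP[|].
  by rewrite subr_eq0 => /eqP h; exists c, k.
by rewrite addr_eq0 -scaleNr => /eqP h; exists c, (- k).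
Qed.

End RationalPoint.

(** * Functions on the curve *)

Section CurveFunctions.

Variables (K : closedFieldType) (E : wcurve K).
Implicit Types (P Q S T : point E) (f g h : point E -> point E).
Local Notation a := (wa E).
Local Notation b := (wb E).
Local Notation pt h := (exist (oncurve E) (Some (_, _)) h).
Local Notation hc := (@homog_coord K E).

Definition px P : K := if val P is Some (x, _) then x else 0.
Definition py P : K := if val P is Some (_, y) then y else 0.

Lemma px_opp P : px (- P) = px P.
Proof. by case: P => -[[x y]|]. Qed.

Lemma py_opp P : py (- P) = - py P.
Proof. by case: P => -[[x y]|] h; rewrite /py /= ?oppr0. Qed.

Lemma opp_neq0 P : P <> 0 -> - P <> 0.
Proof. by move=> P0 /eqP; rewrite oppr_eq0 => /eqP. Qed.

Lemma hcE P : P <> 0 -> hc P =1 nth 0 [:: px P; py P; 1].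
Proof. by case: P => -[[x y]|] h // []; exact: val_inj. Qed.

Lemma hc0 : hc 0 =1 nth 0 [:: 0; 1; 0].
Proof. by []. Qed.

Lemma pyE P : P <> 0 -> py P ^+ 2 = px P ^+ 3 + a * px P + b.
Proof.
by case: P => -[[x y]|] // h; [move=> _; apply/eqP | case; exact: val_inj].
Qed.

Lemma px_eq P Q : P <> 0 -> Q <> 0 -> px P = px Q -> P = Q \/ P = - Q.
Proof.
have [->//|[x [y [h ->]]]] := pointP P; have [->//|[x' [y' [h' ->]]]] := pointP Q.
move=> _ _; rewrite /px /= => e; subst x'.
by have [e|e] := same_x h' h; [left|right]; apply: val_inj; rewrite /= e.
Qed.

Lemma hc_curve c P :
  (c * hc P i1) ^+ 2 * (c * hc P i2) = (c * hc P i0) ^+ 3 +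
    a * (c * hc P i0) * (c * hc P i2) ^+ 2 + b * (c * hc P i2) ^+ 3.
Proof.
have [->|/eqP P0] := eqVneq P 0; first by rewrite !hc0 /=; ring.
rewrite !(hcE P0) /=; rewrite exprMn (pyE P0); ring.
Qed.

Lemma almost_neq0 (U : {poly K}) : U != 0 -> almost (fun P => U.[px P] != 0).
Proof.
move=> U0; have [rs eU] := closed_field_poly_normal U.
have lc : lead_coef U != 0 by rewrite lead_coef_eq0.
suff : almost (fun P => P <> 0 /\ px P \notin rs).
  apply: almostW => P [_ hP]; rewrite eU hornerZ mulf_neq0 //.
  by have := root_prod_XsubC rs (px P); rewrite (negPf hP) /root => ->.
elim: rs {eU} => [|z rs IH]; first by apply: almostW (almost_neq 0).
have [y h] := point_over E z.
have hn := almost_and (almost_neq (pt h)) (almost_neq (- (pt h : point E))).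
apply: almostW (almost_and hn IH) => P [[n1 n2] [P0 hP]].
split=> //; rewrite inE negb_or hP andbT; apply/eqP => e.
have [] : P = pt h \/ P = - (pt h : point E) by apply: px_eq.
  by [].
by [].
Qed.

Lemma almost_eq0 (U : {poly K}) : almost (fun P => U.[px P] = 0) -> U = 0.
Proof.
move=> h; apply/eqP; apply/negPn/negP=> /almost_neq0 h'.
by have [P e /eqP] := almost_ex2 h h'.
Qed.

Lemma rhs_poly : exists2 g : {poly K},
  g != 0 & forall P, P <> 0 -> g.[px P] = py P ^+ 2.
Proof.
exists ('X^3 + (a *: 'X + b%:P)) => [|P P0]; last first.
  by rewrite (pyE P0) !(hornerD, hornerXn, hornerZ, hornerX, hornerC) addrA.
rewrite -size_poly_eq0 size_polyDl ?size_polyXn //.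
rewrite (leq_ltn_trans (size_polyD _ _)) // gtn_max.
rewrite (leq_ltn_trans (size_scale_leq _ _)) ?size_polyX //.
by rewrite (leq_ltn_trans (size_polyC_leq1 _)).
Qed.

(** The affine coordinate ring is generated over [K[x]] by 1 and [y], since [y ^ 2] is a polynomial
    in [x]. *)
Lemma curve_poly (F : {mpoly K[3]}) : exists U V : {poly K},
  forall P, P <> 0 -> F.@[hc P] = U.[px P] + py P * V.[px P].
Proof.
have [g _ gE] := rhs_poly.
pose A (H : {mpoly K[3]}) := exists U V : {poly K},
  forall P, P <> 0 -> H.@[hc P] = U.[px P] + py P * V.[px P].
have AM p q : A p -> A q -> A (p * q).
  move=> [U [V hp]] [U' [V' hq]]; exists (U * U' + g * V * V'), (U * V' + U' * V).
  move=> P P0; rewrite mevalM (hp P P0) (hq P P0) !(hornerD, hornerM) gE //.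
  by ring.
have AX i : A 'X_i.
  suff: exists U V : {poly K}, forall P, P <> 0 ->
     nth 0 [:: px P; py P; 1] i = U.[px P] + py P * V.[px P].
    move=> [U [V h]]; exists U, V => P P0.
    by rewrite mevalXU (hcE P0) h.
  case: i => -[|[|[|//]]] /= _.
  - by exists 'X, 0 => P _; rewrite !hornerE ?mulr0 ?addr0.
  - by exists 0, 1 => P _; rewrite !hornerE ?mulr1 ?add0r.
  by exists 1, 0 => P _; rewrite !hornerE ?mulr0 ?addr0.
rewrite -/(A F); elim/mpolyind: F => [|c m p _ _ [U' [V' hp]]].
  by exists 0, 0 => P _; rewrite meval0 !hornerE ?mulr0 ?addr0.
have [U [V hm]] : A 'X_[m].
  rewrite mpolyXE_id; elim/big_ind: _ => // [|i _].
    by exists 1, 0 => P _; rewrite meval1 !hornerE ?mulr0 ?addr0.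
  elim: (m i) => [|k IH]; last by rewrite exprS; apply: AM.
  by exists 1, 0 => P _; rewrite expr0 meval1 !hornerE ?mulr0 ?addr0.
exists (c *: U + U'), (c *: V + V') => P P0.
by rewrite mevalD mevalZ (hm P P0) (hp P P0) !(hornerD, hornerZ); ring.
Qed.

(** Comparing the values at [P] and [- P] separates the even part from the odd part. *)
Lemma curve_poly_eq0 (U V : {poly K}) :
  almost (fun P => U.[px P] + py P * V.[px P] = 0) -> U = 0 /\ V = 0.
Proof.
move=> h; have two0 := two_neq0 E.
have [g g0 gE] := rhs_poly.
have hh : almost (fun P => U.[px P] = 0 /\ py P * V.[px P] = 0).
  apply: almostW (almost_and h (almost_opp h)) => P [].
  have -> : popp P = - P by [].
  rewrite px_opp py_opp mulNr => e1 e2; split; apply: (mulfI two0); rewrite mulr0.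
    by rewrite -[0]addr0 -{1}e1 -e2; ring.
  by rewrite -[0]subr0 -{1}e1 -e2; ring.
have -> : U = 0 by apply: almost_eq0; apply: almostW hh => P [].
split=> //; have /eqP : g * V = 0.
  apply: almost_eq0; apply: almostW (almost_and hh (almost_neq 0)) => P [[_ e] P0].
  have -> : (g * V).[px P] = py P * (py P * V.[px P]).
    by rewrite hornerM mulrA -expr2 gE.
  by rewrite e mulr0.
by rewrite mulf_eq0 (negPf g0) => /eqP.
Qed.

(** The factor may be 0 away from [P], so that proportionality holds at every point without a
    nonvanishing condition. *)
Lemma regular_locus f P : regular f -> exists d (F : 'I_3 -> {mpoly K[3]}),
  [/\ forall i, F i \is d.-homog,
      exists2 c : K, c != 0 & forall i, (F i).@[hc P] = c * hc (f P) i
    & forall Q, exists c : K, forall i, (F i).@[hc Q] = c * hc (f Q) i].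
Proof.
move=> /(_ P)[d [F [F1 [i Fi] F3]]]; exists d, F; split=> //.
  have [c hc] := F3 P (ex_intro _ i Fi); exists c => //.
  by apply: contraNneq Fi => c0; rewrite hc c0 mul0r.
move=> Q; have [/existsP[j hj]|/existsPn hn] := boolP [exists j, (F j).@[hc Q] != 0].
  by apply: F3; exists j.
by exists 0 => j; rewrite mul0r; apply/eqP; rewrite -[_ == _]negbK.
Qed.

Lemma hc_prop_inj P Q (u : 'I_3 -> K) c d : c != 0 ->
  (forall i, u i = c * hc P i) -> (forall i, u i = d * hc Q i) -> P = Q.
Proof.
move=> c0 h1 h2; apply/esym.
by apply: (@hc_inj _ _ (d / c)) => i; rewrite mulrAC -h2 h1 mulrAC divff // mul1r.
Qed.

(** The minors [F i * G j - F j * G i] of local representatives vanish at almost all points, hence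
    at all affine ones, in particular at the point where both representatives are valid. *)
Lemma eq_regular f g : regular f -> regular g ->
  almost (fun P => f P = g P) -> f =1 g.
Proof.
have aff f' g' : regular f' -> regular g' -> almost (fun P => f' P = g' P) ->
   forall P, P <> 0 -> f' P = g' P.
  move=> hf hg hfg P P0.
  have [d [F [_ [c c0 cF] F3]]] := regular_locus P hf.
  have [e [G [_ [c' c'0 cG] G3]]] := regular_locus P hg.
  have cross i j : (F i).@[hc P] * (G j).@[hc P] = (F j).@[hc P] * (G i).@[hc P].
    apply/eqP; rewrite -subr_eq0 -!mevalM -mevalB; apply/eqP.
    have [U [V hUV]] := curve_poly (F i * G j - F j * G i).
    rewrite hUV //; have [-> ->] : U = 0 /\ V = 0; last by rewrite !horner0 mulr0 addr0.
    apply: curve_poly_eq0; apply: almostW (almost_and hfg (almost_neq 0)).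
    move=> Q [efg Q0]; rewrite -hUV // mevalB !mevalM.
    have [k hk] := F3 Q; have [k' hk'] := G3 Q.
    by rewrite !hk !hk' efg; ring.
  have [i hi] := hc_neq0 (f' P).
  have Fi : (F i).@[hc P] != 0 by rewrite cF mulf_neq0.
  apply: (@hc_prop_inj _ _ (fun j => (F j).@[hc P]) c
    ((F i).@[hc P] / (G i).@[hc P] * c') c0 cF) => j.
  have -> : (F i).@[hc P] / (G i).@[hc P] * c' * hc (g' P) j =
     (F i).@[hc P] / (G i).@[hc P] * (G j).@[hc P] by rewrite (cG j) mulrA.
  have [G0|G0] := eqVneq (G i).@[hc P] 0.
    have [l hl] := hc_neq0 (g' P); have := cross i l.
    move/eqP; rewrite G0 mulr0 mulf_eq0 (negPf Fi) cG mulf_eq0 (negPf c'0).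
    by rewrite (negPf hl).
  by rewrite mulrAC cross mulfK.
move=> hf hg hfg P; have [->|/eqP P0] := eqVneq P 0; last exact: (aff _ _ hf hg).
(* The point at infinity is reached by composing with a nonzero translation, which moves it to the
   affine point [- T]. *)
have [T T0] := almost_ex (almost_neq (0 : point E)).
have tr : regular (fun Q => Q + T) by apply: regular_add (@regular_id _ E) (regular_cst T).
have := aff _ _ (regular_comp hf tr) (regular_comp hg tr) (almost_addr T hfg) (- T).
by rewrite /= addNr; apply; exact: opp_neq0.
Qed.

End CurveFunctions.

(** * Rigidity *)

Section Rigidity.

Variables (K : closedFieldType) (E : wcurve K).
Implicit Types (P Q S T : point E) (f g h : point E -> point E).
Local Notation a := (wa E).
Local Notation b := (wb E).
Local Notation pt h := (exist (oncurve E) (Some (_, _)) h).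
Local Notation hc := (@homog_coord K E).

(* For [F = U + y V] representing [f] near [P], parity of the coordinates
   selected by [A] makes [U] and [y V] both proportional to them. *)
Lemma even_coord_poly f (A : pred 'I_3) : regular f ->
  (forall Q i, A i -> hc (f (- Q)) i = hc (f Q) i) ->
  (exists2 P, P <> 0 & exists2 i, A i & hc (f P) i != 0) ->
  exists G : 'I_3 -> {poly K}, (exists2 i, A i & G i != 0) /\
    forall Q, Q <> 0 -> exists c : K,
      forall i, A i -> (G i).[px Q] = c * hc (f Q) i.
Proof.
move=> hf ev [P P0 [i Ai hi]]; have two0 := two_neq0 E.
have [d [F [_ [c c0 cF] F3]]] := regular_locus P hf.
have /fin_all_exists[UV hUV] j : exists UV : {poly K} * {poly K},
    forall Q, Q <> 0 -> (F j).@[hc Q] = UV.1.[px Q] + py Q * UV.2.[px Q].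
  by have [U [V h]] := curve_poly E (F j); exists (U, V).
have sum Q : Q <> 0 -> exists c c' : K, forall j, A j ->
    (UV j).1.[px Q] = c * hc (f Q) j /\ py Q * (UV j).2.[px Q] = c' * hc (f Q) j.
  move=> Q0; have [k hk] := F3 Q; have [k' hk'] := F3 (- Q).
  exists ((k + k') / 2%:R), ((k - k') / 2%:R) => j Aj.
  have e1 := hk j; have e2 := hk' j; rewrite (ev _ _ Aj) in e2.
  rewrite hUV // in e1; rewrite hUV ?px_opp ?py_opp in e2; last exact: opp_neq0.
  have half (r w : K) : 2%:R * (r / 2%:R * w) = r * w by field; rewrite two0.
  split; apply: (mulfI two0); rewrite half.
    by rewrite [RHS]mulrDl -e1 -e2; ring.
  by rewrite [RHS]mulrBl -e1 -e2; ring.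
have [/existsP[j /andP[Aj Uj]]|/existsPn U0] :=
    boolP [exists j, A j && ((UV j).1 != 0)].
  exists (fun j => (UV j).1); split; first by exists j.
  by move=> Q /sum[k [k' hk]]; exists k => l /hk[].
have [g g0 gE] := rhs_poly E.
exists (fun j => g * (UV j).2); split.
  exists i => //; rewrite mulf_neq0 //; apply: contraNneq hi => V0.
  have := U0 i; rewrite Ai /= negbK => /eqP Ui.
  have := cF i; rewrite hUV // Ui V0 !horner0 mulr0 addr0 => /esym/eqP.
  by rewrite mulf_eq0 (negPf c0).
move=> Q Q0; have [k' [k hk]] := sum Q Q0; exists (py Q * k) => j /hk[_ h].
by rewrite hornerM gE // expr2 -!mulrA h.
Qed.

Lemma even_regular_const f : regular f -> (forall P, f (- P) = f P) ->
  forall P, f P = f 0.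
Proof.
move=> hf ev; suff [c hc] : exists c, almost (fun P => f P = c).
  have h := eq_regular hf (regular_cst c) hc.
  by move=> P; rewrite h -(h 0).
have [T T0] := almost_ex (almost_neq (0 : point E)).
have [||G [[i _ Gi] hG]] := @even_coord_poly f xpredT hf.
- by move=> Q j _; rewrite ev.
- by exists T => //; have [j hj] := hc_neq0 (f T); exists j.
have curve : G i1 ^+ 2 * G i2 =
    G i0 ^+ 3 + a%:P * G i0 * G i2 ^+ 2 + b%:P * G i2 ^+ 3.
  apply/eqP; rewrite -subr_eq0; apply/eqP.
  apply: (@almost_eq0 _ E); apply: almostW (almost_neq (0 : point E)) => P /hG[c hc].
  rewrite !(hornerD, hornerN, hornerM, horner_exp, hornerC) !hc //.
  by rewrite hc_curve subrr.
have good : almost (fun P => exists2 c : K, c != 0 &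
    forall j, (G j).[px P] = c * hc (f P) j).
  apply: almostW (almost_and (almost_neq 0) (almost_neq0 E Gi)) => P [/hG[c hc] nz].
  exists c => [|j]; last exact: hc.
  by apply: contraNneq nz => c0; rewrite hc // c0 mul0r.
have [[P [c c0 hP]] hgood] : (exists P, exists2 c : K, c != 0 &
    forall j, (G j).[px P] = c * hc (f P) j) /\ True.
  by split=> //; exact: almost_ex good.
have [G20|G20] := eqVneq (G i2) 0.
  exists 0; apply: almostW good => Q [k k0 hQ].
  have := hQ i2; rewrite G20 horner0 => /esym/eqP.
  rewrite mulf_eq0 (negPf k0) /= => /eqP; case: (eqVneq (f Q) 0) => // /eqP n0.
  by rewrite hcE //= => /eqP; rewrite oner_eq0.
have [k0 [k1 [e0 e1]]] := rational_point_const G20 curve.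
have [S [[s s0 hS] S2]] := almost_ex (almost_and good (almost_neq0 E G20)).
exists (f S); apply: almostW (almost_and good (almost_neq0 E G20)) => Q [[q q0 hQ] Q2].
apply: (@hc_prop_inj _ _ _ _ (fun j => (G j).[px Q]) q
  ((G i2).[px Q] / (G i2).[px S] * s) q0 hQ).
suff hr j : (G j).[px Q] = (G i2).[px Q] / (G i2).[px S] * (G j).[px S].
  by move=> j; rewrite hr (hS j) mulrA.
move: j; apply/ord3P; rewrite e0 e1 !hornerZ; split.
- by rewrite mulrCA divfK.
- by rewrite mulrCA divfK.
by rewrite divfK.
Qed.

Lemma halving P : exists Q, P = Q + Q.
Proof.
have two0 := two_neq0 E.
have [->|[x0 [y0 [h0 eP]]]] := pointP P.
  by exists 0; rewrite addr0.
(* The duplication formula for [x(2 Q) = x0], cleared of denominators: [(x ^ 2 - a) ^ 2 - 8 b x - 4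
   x0 (x ^ 3 + a x + b)]. *)
pose q : {poly K} := 'X^4 + \poly_(i < 4)
   nth 0 [:: a ^+ 2 - 4%:R * x0 * b; - 8%:R * b - 4%:R * x0 * a;
             - 2%:R * a; - 4%:R * x0] i.
have /closed_rootP[x /rootP] : size q != 1.
  by rewrite /q size_polyDl size_polyXn // ltnS size_poly.
rewrite /q hornerD hornerXn horner_poly !big_ord_recl big_ord0 /= => hx.
have [y h] := point_over E x.
have hb : b = y ^+ 2 - x ^+ 3 - a * x by move: h => /= /eqP->; ring.
have num : (x ^+ 2 - a) ^+ 2 - 8%:R * b * x = x0 * (4%:R * y ^+ 2).
  apply/eqP; rewrite -subr_eq0 -hx; apply/eqP.
  rewrite /bump /= !add1n ?addn0 hb; ring.
(* For [y = 0] the numerator [(x ^ 2 - a) ^ 2 - 8 b x] is the square of the derivative of the cubic,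
   which is nonzero there, although the quartic would make it 0. *)
have y0n : y != 0.
  apply/eqP=> y00; have := @deriv_neq0 _ E x.
  rewrite {1}hb y00; move=> /(_ ltac:(ring))/(expf_neq0 2)/eqP[].
  apply: etrans (_ : (x ^+ 2 - a) ^+ 2 - 8%:R * b * x = _).
    by rewrite hb y00; ring.
  by rewrite num y00; ring.
have nop : ~~ ((x == x) && (y == - y)).
  by rewrite eqxx /=; apply: contra y0n => /eqP/(oppr_id0 E)->.
have [l [e1 e2]] := slope_ex h h nop.
have := padd_slope h h nop e1 e2; set R := padd _ _ => vR.
have ex : l ^+ 2 - x - x = x0.
  have d0 : 4%:R * y ^+ 2 != 0 by rewrite (natrM _ 2 2) !mulf_neq0 ?expf_neq0.
  apply: (mulIf d0); rewrite -num.
  have -> : (l ^+ 2 - x - x) * (4%:R * y ^+ 2) = (l * (y + y)) ^+ 2 - 8%:R * x * y ^+ 2 by ring.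
  by rewrite e2 hb; ring.
have [] : P = R \/ P = - R.
- apply: px_eq; first by rewrite eP.
    by move=> R0; move: vR; rewrite R0.
  by rewrite eP /px vR /= ex.
- by move=> ->; exists (pt h).
by move=> ->; exists (- (pt h : point E)); rewrite -opprD.
Qed.

Lemma endo_hom f : is_endo f -> {morph f : P Q / P + Q}.
Proof.
move=> [hf f0] P Q.
have key T S : f (T + S) + f (T - S) = f T + f T.
  have reg : regular (fun S => f (T + S) + f (T - S)).
    apply: regular_add.
      exact: regular_comp hf (regular_add (regular_cst T) (@regular_id _ E)).
    apply: regular_comp hf _.
    exact: regular_add (regular_cst T) (regular_opp (@regular_id _ E)).
  rewrite (even_regular_const reg) ?addr0 ?subr0 // => R.
  by rewrite opprK addrC.
have dbl T : f (T + T) = f T + f T.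
  by rewrite -(key T T) subrr [f 0]f0 addr0.
(* With [T] half of [P + Q] and [S = P - T], the two arguments are [T + S] and [T - S]. *)
have [T eT] := halving (P + Q).
have eP : T + (P - T) = P by rewrite addrC subrK.
have eQ : T - (P - T) = Q by rewrite opprB addrA -eT addrAC subrr add0r.
by have := key T (P - T); rewrite eP eQ -dbl -eT.
Qed.

Lemma endoN f P : is_endo f -> f (- P) = - f P.
Proof.
move=> hf; apply: (addIr (f P)); rewrite -(endo_hom hf) !addNr.
by case: hf.
Qed.

End Rigidity.

(** * The degree of an endomorphism *)

(* [ftop p n c]: as a form of degree [n], [p] takes the value [c] at the point
   at infinity. *)
Section FormalTop.

Variable R : comNzRingType.
Implicit Types p q : {poly R}.

Definition ftop p n c := (size p <= n.+1)%N /\ p`_n = c.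

Lemma ftopM p q m n c d : ftop p m c -> ftop q n d -> ftop (p * q) (m + n) (c * d).
Proof.
move=> [sp <-] [sq <-]; split.
  apply: leq_trans (size_polyMleq _ _) _.
  by rewrite -subn1 leq_subLR add1n -addSn (leq_trans (leq_add sp sq)) // addnS.
have lm : (m < (m + n).+1)%N by rewrite ltnS leq_addr.
rewrite coefM (bigD1 (Ordinal lm)) //= addKn big1 ?addr0 // => j jm.
have [jlt|jgt|jeq] := ltngtP j m.
- by rewrite [q`_ _]nth_default ?mulr0 // (leq_trans sq) // ltn_subRL ltn_add2r.
- by rewrite [p`_ _]nth_default ?mul0r // (leq_trans sp).
by case/eqP: jm; apply: val_inj.
Qed.

Lemma ftopD p q n c d : ftop p n c -> ftop q n d -> ftop (p + q) n (c + d).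
Proof.
move=> [sp <-] [sq <-]; split; last by rewrite coefD.
by rewrite (leq_trans (size_polyD _ _)) // geq_max sp.
Qed.

Lemma ftopN p n c : ftop p n c -> ftop (- p) n (- c).
Proof. by move=> [sp <-]; split; rewrite ?size_polyN ?coefN. Qed.

Lemma ftopZ p n c k : ftop p n c -> ftop (k *: p) n (k * c).
Proof.
move=> [sp <-]; split; last by rewrite coefZ.
exact: leq_trans (size_scale_leq _ _) sp.
Qed.

Lemma ftopX p n c k : ftop p n c -> ftop (p ^+ k) (k * n) (c ^+ k).
Proof.
move=> h; elim: k => [|k IH]; last by rewrite !exprS mulSn; apply: ftopM.
by split; rewrite ?expr0 ?mul0n ?size_poly1 ?coef1.
Qed.

Lemma ftop_sum n k (F : 'I_k -> {poly R}) (c : 'I_k -> R) :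
  (forall i, ftop (F i) n (c i)) -> ftop (\sum_i F i) n (\sum_i c i).
Proof.
move=> h; elim/big_rec2: _ => [|i p q _ h']; last exact: ftopD.
by split; rewrite ?size_poly0 ?coef0.
Qed.

End FormalTop.

(* With [x1 : z1] and [x2 : z2] the x-coordinates of [P] and [Q], these three
   forms are the elementary symmetric functions of the x-coordinates of
   [P + Q] and [P - Q]. *)
Section SumForms.

Variables (R : comNzRingType) (a b : R).

Definition sumform (x1 z1 x2 z2 : R) : 'I_3 -> R := nth 0 [::
  (x1 * z2 - x2 * z1) ^+ 2;
  (x1 * x2 + a * (z1 * z2)) * (x1 * z2 + x2 * z1) *+ 2
    + b * (z1 * z2 * (z1 * z2)) *+ 4;
  (x1 * x2 - a * (z1 * z2)) ^+ 2 - b * (z1 * z2 * (x1 * z2 + x2 * z1)) *+ 4].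

Definition symform (x1 z1 x2 z2 : R) : 'I_3 -> R := nth 0 [::
  z1 * z2; x1 * z2 + x2 * z1; x1 * x2].

Lemma sumform_scale c d x1 z1 x2 z2 i :
  sumform (c * x1) (c * z1) (d * x2) (d * z2) i =
  (c * d) ^+ 2 * sumform x1 z1 x2 z2 i.
Proof. by move: i; apply/ord3P; rewrite /sumform /=; split; ring. Qed.

Lemma symform_scale c d x1 z1 x2 z2 i :
  symform (c * x1) (c * z1) (d * x2) (d * z2) i = c * d * symform x1 z1 x2 z2 i.
Proof. by move: i; apply/ord3P; rewrite /symform /=; split; ring. Qed.

End SumForms.

Section XCoordinate.

Variables (K : closedFieldType) (E : wcurve K).
Implicit Types (P Q S T : point E) (f g h : point E -> point E).
Local Notation a := (wa E).
Local Notation b := (wb E).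
Local Notation pt h := (exist (oncurve E) (Some (_, _)) h).
Local Notation hc := (@homog_coord K E).

Definition xn1 P : K := if val P is Some (x, _) then x else 1.
Definition xn2 P : K := if val P is Some _ then 1 else 0.

Lemma xn_opp P : xn1 (- P) = xn1 P /\ xn2 (- P) = xn2 P.
Proof. by case: P => -[[x y]|]. Qed.

Lemma sumform_points P Q : exists2 c, c != 0 &
  forall i, sumform a b (xn1 P) (xn2 P) (xn1 Q) (xn2 Q) i =
    c * symform (xn1 (P + Q)) (xn2 (P + Q)) (xn1 (P - Q)) (xn2 (P - Q)) i.
Proof.
have two0 := two_neq0 E.
have n4 : 4%:R != 0 :> K by rewrite (natrM _ 2 2) mulf_neq0.
have [->|[x1 [y1 [h1 eP]]]] := pointP P.
  have -> : pzero = 0 :> point E by [].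
  rewrite add0r sub0r; have [-> ->] := xn_opp Q.
  exists 1; first exact: oner_neq0.
  by apply/ord3P; rewrite /sumform /symform /xn1 /xn2 /=; split; ring.
have [->|[x2 [y2 [h2 eQ]]]] := pointP Q.
  have -> : pzero = 0 :> point E by [].
  rewrite addr0 subr0.
  exists 1; first exact: oner_neq0.
  by apply/ord3P; rewrite /sumform /symform /xn1 /xn2 /=; split; ring.
have hb : b = y1 ^+ 2 - x1 ^+ 3 - a * x1 by have /= /eqP-> := h1; ring.
have [ex|nx] := eqVneq x1 x2.
  (* Changing the sign of [Q] only exchanges [P + Q] and [P - Q], and the symmetric forms do not see
     it. *)
  wlog eQP : Q y2 h2 eQ / P = Q.
    move=> hw; have [e|e] : P = Q \/ P = - Q.
    - by apply: px_eq; rewrite ?eP ?eQ // /px /= ex.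
    - exact: hw eQ e.
    have h2' : oncurve E (Some (x2, - y2)) by have := h2; rewrite /= sqrrN.
    have eQ' : - Q = pt h2' by rewrite eQ; apply: val_inj.
    have [c c0 hc] := hw _ _ h2' eQ' e; exists c => // i.
    have [n1 n2] := xn_opp Q.
    rewrite -n1 -n2 hc opprK; move: i {hc}; apply/ord3P.
    by rewrite /symform /=; split; ring.
  rewrite -eQP subrr.
  have [y0|y0] := eqVneq y1 0.
    have -> : P + P = 0.
      by rewrite eP; apply: val_inj => /=; rewrite y0 oppr0 !eqxx.
    exists ((3%:R * x1 ^+ 2 + a) ^+ 2).
      by rewrite expf_neq0 // (@deriv_neq0 _ E) // hb y0; ring.
    rewrite eP; apply/ord3P; rewrite /sumform /symform /xn1 /xn2 /= hb y0.
    by split; ring.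
  have nop : ~~ ((x1 == x1) && (y1 == - y1)).
    by rewrite eqxx /=; apply: contra y0 => /eqP/(oppr_id0 E)->.
  have [l [e1 e2]] := slope_ex h1 h1 nop.
  have := padd_slope h1 h1 nop e1 e2.
  have -> : padd (pt h1) (pt h1) = P + P by rewrite eP.
  move: (P + P) => R vR.
  have y4 : 4%:R * y1 ^+ 2 != 0 by rewrite mulf_neq0 // expf_neq0.
  exists (4%:R * y1 ^+ 2) => //.
  have el : 4%:R * y1 ^+ 2 * (l ^+ 2 - x1 - x1) =
      (l * (y1 + y1)) ^+ 2 - 4%:R * y1 ^+ 2 * (x1 + x1) by ring.
  rewrite eP /xn1 /xn2 vR /=; apply/ord3P; rewrite /sumform /symform /=.
  by split; rewrite ?mulr1 ?mul1r ?el ?e2 ?hb; ring.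
have d0 : x1 - x2 != 0 by rewrite subr_eq0.
have nop : ~~ ((x1 == x2) && (y1 == - y2)) by rewrite (negPf nx).
have [l [e1 e2]] := slope_ex h1 h2 nop.
have := padd_slope h1 h2 nop e1 e2.
have h2' : oncurve E (Some (x2, - y2)) by have := h2; rewrite /= sqrrN.
have nop' : ~~ ((x1 == x2) && (y1 == - - y2)) by rewrite (negPf nx).
have [m [m1 m2]] := slope_ex h1 h2' nop'.
have := padd_slope h1 h2' nop' m1 m2.
have -> : padd (pt h1) (pt h2) = P + Q by rewrite eP eQ.
have -> : padd (pt h1) (pt h2') = P - Q.
  by rewrite eP eQ; congr padd; apply: val_inj.
move: (P + Q) (P - Q) => R S vS vR.
exists ((x1 - x2) ^+ 2); first by rewrite expf_neq0.
have ea : a = l * (y1 + y2) - (x1 ^+ 2 + x1 * x2 + x2 ^+ 2) by rewrite e2; ring.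
have lE : l * (x1 - x2) = y1 - y2 by rewrite e1; ring.
have mE : m * (x1 - x2) = y1 + y2 by rewrite m1; ring.
(* The slopes [l] and [m] of the lines through [P] and [Q], respectively [- Q], determine both
   ordinates, which leaves an identity between rational functions of [x1], [x2], [l] and [m]. *)
have ey1 : y1 = (l + m) * (x1 - x2) / 2%:R by rewrite mulrDl lE mE; field.
have ey2 : y2 = (m - l) * (x1 - x2) / 2%:R by rewrite mulrBl lE mE; field.
rewrite eP eQ /xn1 /xn2 vS vR /=; apply/ord3P; rewrite /sumform /symform /=.
by split; rewrite ?hb ?ea ?ey1 ?ey2; field; rewrite ?two0.
Qed.

Lemma xn_surj x z : (x != 0) || (z != 0) ->
  exists P c, [/\ c != 0, x = c * xn1 P & z = c * xn2 P].
Proof.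
have [-> /[!orbF] x0|z0 _] := eqVneq z 0.
  by exists 0, x; rewrite /xn1 /xn2 /= mulr1 mulr0.
have [y h] := point_over E (x / z); exists (pt h), z.
by rewrite /xn1 /xn2 /= mulr1 mulrC divfK.
Qed.

Lemma symform_neq0 x1 z1 x2 z2 : (x1 != 0) || (z1 != 0) -> (x2 != 0) || (z2 != 0) ->
  exists i, symform x1 z1 x2 z2 i != 0 :> K.
Proof.
move=> h1 h2.
have [z10|z10] := eqVneq z1 0.
  have x10 : x1 != 0 by rewrite z10 eqxx orbF in h1.
  case/orP: h2 => h; first by exists i2; rewrite /symform /= mulf_neq0.
  by exists i1; rewrite /symform /= z10 mulr0 addr0 mulf_neq0.
have [z20|z20] := eqVneq z2 0.
  have x20 : x2 != 0 by rewrite z20 eqxx orbF in h2.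
  by exists i1; rewrite /symform /= z20 mulr0 add0r mulf_neq0.
by exists i0; rewrite /symform /= mulf_neq0.
Qed.

Lemma xn_neq0 P : (xn1 P != 0) || (xn2 P != 0).
Proof. by case: P => -[[x y]|] h; rewrite /xn1 /xn2 /= oner_neq0 ?orbT. Qed.

(** Every point of the projective line is the abscissa of a point of the curve, so the claim reduces
    to [symform], which is the product of two nonzero linear forms. *)
Lemma sumform_neq0 x1 z1 x2 z2 : (x1 != 0) || (z1 != 0) -> (x2 != 0) || (z2 != 0) ->
  exists i, sumform a b x1 z1 x2 z2 i != 0.
Proof.
move=> /xn_surj[P [c [c0 -> ->]]] /xn_surj[Q [d [d0 -> ->]]].
have [k k0 h] := sumform_points P Q.
have [i hi] := symform_neq0 (xn_neq0 (P + Q)) (xn_neq0 (P - Q)).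
by exists i; rewrite sumform_scale h !mulf_neq0 // expf_neq0 // mulf_neq0.
Qed.

End XCoordinate.

(** * The rational function induced on abscissas *)

Section XRep.

Variables (K : closedFieldType) (E : wcurve K).
Implicit Types (P Q S T : point E) (f g h : point E -> point E).
Implicit Types (A B C D : {poly K}) (m n : nat).
Local Notation a := (wa E).
Local Notation b := (wb E).
Local Notation hc := (@homog_coord K E).

(* [A / B] is the rational function of degree [n] induced by [f] on
   x-coordinates. *)
Definition xrep f A B n := [/\ coprimep A B, maxn (size A) (size B) = n.+1 &
  almost (fun P => A.[px P] * xn2 (f P) = B.[px P] * xn1 (f P))].

Lemma coprimep_horner A B x : coprimep A B -> (A.[x] != 0) || (B.[x] != 0).
Proof.
move=> cAB; rewrite -negb_and; apply/negP=> /andP[/eqP hA].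
by apply/negP; apply: (coprimep_root cAB); apply/rootP.
Qed.

Lemma xrep_top f A B n : xrep f A B n ->
  [/\ ftop A n A`_n, ftop B n B`_n & (A`_n != 0) || (B`_n != 0)].
Proof.
move=> [_ s _]; have sA : (size A <= n.+1)%N by rewrite -s leq_maxl.
have sB : (size B <= n.+1)%N by rewrite -s leq_maxr.
split=> //; rewrite -negb_and; apply/negP=> /andP[/eqP hA /eqP hB].
have lt C : (size C <= n.+1)%N -> C`_n = 0 -> (size C <= n)%N.
  move=> sC cn; rewrite leqNgt; apply/negP=> h.
  have e : size C = n.+1 by apply/eqP; rewrite eqn_leq sC.
  have : lead_coef C = 0 by rewrite lead_coefE e.
  by move/eqP; rewrite lead_coef_eq0 => /eqP C0; rewrite C0 size_poly0 in e.
have : (maxn (size A) (size B) <= n)%N by rewrite geq_max !lt.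
by rewrite s ltnn.
Qed.

Lemma xrep_prop f A B n : xrep f A B n -> almost (fun P =>
  exists2 c, c != 0 & A.[px P] = c * xn1 (f P) /\ B.[px P] = c * xn2 (f P)).
Proof.
move=> [cAB _]; apply: almostW => P.
have := coprimep_horner (px P) cAB.
case: (f P) => -[[x y]|] h; rewrite /xn1 /xn2 /= => nz e.
  rewrite mulr1 in e; exists B.[px P]; last by rewrite mulr1 -e.
  by apply: contraTneq nz => B0; rewrite e B0 mul0r eqxx.
rewrite mulr0 mulr1 in e; exists A.[px P]; last by rewrite mulr1 mulr0 -e.
by apply: contraTneq nz => A0; rewrite -e A0 eqxx.
Qed.

Lemma xrep_prop_eq f g A B A' B' n m : f =1 g ->
  xrep f A B n -> xrep g A' B' m -> A * B' = A' * B.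
Proof.
move=> fg hf hg; apply/eqP; rewrite -subr_eq0; apply/eqP.
apply: (@almost_eq0 _ E).
apply: almostW (almost_and (xrep_prop hf) (xrep_prop hg)).
move=> P [[c _ [hA hB]] [d _ [hA' hB']]].
by rewrite hornerD hornerN !hornerM hA hB hA' hB' fg; ring.
Qed.

Lemma xrep_uniq f g A B A' B' n m : f =1 g ->
  xrep f A B n -> xrep g A' B' m -> n = m.
Proof.
move=> fg hf hg; have e := xrep_prop_eq fg hf hg.
have [cAB s _] := hf; have [cAB' s' _] := hg.
have eA : A %= A'.
  rewrite /eqp -(Gauss_dvdpl _ cAB) -e dvdp_mulr //=.
  by rewrite -(Gauss_dvdpl _ cAB') e dvdp_mulr.
have eB : B %= B'.
  rewrite coprimep_sym in cAB; rewrite coprimep_sym in cAB'.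
  rewrite /eqp -(Gauss_dvdpr _ cAB) e dvdp_mull //=.
  by rewrite -(Gauss_dvdpr _ cAB') -e dvdp_mull.
by move: s; rewrite (eqp_size eA) (eqp_size eB) s' => -[].
Qed.

Lemma xrep0 f : (forall P, f P = 0) -> xrep f 1 0 0.
Proof.
move=> f0; split; first exact: coprime1p.
  by rewrite size_poly1 size_poly0.
by exists [::] => P _; rewrite f0 /xn1 /xn2 !hornerE /=; ring.
Qed.

(** An endomorphism is odd, so the X and Z coordinates of its values are even and come from
    polynomials in [x]. The pair [1, 0] serves when [f] is zero. *)
Lemma xrep_ex f : is_endo f -> exists A B n, xrep f A B n.
Proof.
move=> hf; have [reg f0] := hf.
have [[T [T0 fT]]|nT] := boolp.pselect (exists T, T <> 0 /\ f T <> 0); last first.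
  exists 1, 0, 0; apply: xrep0 => P; apply: (boolp.contrapT) => fP.
  by apply: nT; exists P; split=> // P0; apply: fP; rewrite P0.
have [||G [[i Ai Gi] hG]] := @even_coord_poly _ E f (predC1 i1) reg.
- move=> Q i hi; rewrite (endoN Q hf); case: (f Q) => -[[x y]|] h //.
  by case: i hi => -[|[|[|]]].
- exists T => //; exists i2 => //; rewrite hcE //= oner_neq0 //.
pose d := gcdp (G i0) (G i2).
have G02 : (G i0 != 0) || (G i2 != 0).
  case: i Ai Gi => -[|[|[|//]]] //= hi _ h; apply/orP; [left|right];
    by apply: contra h => /eqP h; rewrite -h; apply/eqP; congr (G _); apply: val_inj.
have d0 : d != 0 by rewrite gcdp_eq0 negb_and.
exists (G i0 %/ d), (G i2 %/ d), (maxn (size (G i0 %/ d)) (size (G i2 %/ d))).-1.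
have cAB : coprimep (G i0 %/ d) (G i2 %/ d) by apply: coprimep_div_gcd.
have e0 : G i0 = G i0 %/ d * d by rewrite divpK // dvdp_gcdl.
have e2 : G i2 = G i2 %/ d * d by rewrite divpK // dvdp_gcdr.
split=> //.
  rewrite prednK // leq_max !lt0n !size_poly_eq0 -negb_and.
  apply: contraL G02 => /andP[/eqP h0 /eqP h2].
  by rewrite e0 e2 h0 h2 mul0r eqxx.
apply: almostW (almost_and (almost_neq 0) (almost_neq0 E d0)) => P [P0 dP].
have [c hc] := hG P P0; have h0 := hc i0 isT; have h2 := hc i2 isT.
rewrite e0 hornerM in h0; rewrite e2 hornerM in h2.
apply: (mulIf dP); rewrite mulrAC h0 [RHS]mulrAC h2.
by case: (f P) => -[[x y]|] h; rewrite /homog_coord /xn1 /xn2 /=; ring.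
Qed.

(** If the abscissa of [f] is generically constant and [f] is nonzero, then generically [f S] is
    [f P] or [- f P]. So [f] kills [P - S] or [P + S], which is impossible when these points are
    generic too. *)
Lemma xrep_const f A B : is_endo f -> xrep f A B 0 -> forall P, f P = 0.
Proof.
move=> hf hAB; have hom := endo_hom hf.
have [cAB s _] := hAB.
have cst C : (size C <= 1)%N -> forall x y, C.[x] = C.[y].
  by move=> /size1_polyC-> x y; rewrite !hornerC.
have cA : forall x y, A.[x] = A.[y] by apply: cst; rewrite -s leq_maxl.
have cB : forall x y, B.[x] = B.[y] by apply: cst; rewrite -s leq_maxr.
pose good P := exists2 c, c != 0 & A.[0] = c * xn1 (f P) /\ B.[0] = c * xn2 (f P).
have hg : almost good.
  by apply: almostW (xrep_prop hAB) => P; rewrite (cA _ 0) (cB _ 0).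
have same P Q : good P -> good Q -> xn1 (f P) = xn1 (f Q) /\ xn2 (f P) = xn2 (f Q).
  move=> [c c0 [h1 h2]] [d d0 [h3 h4]].
  have e1 : c * xn1 (f P) = d * xn1 (f Q) by rewrite -h1 -h3.
  have e2 : c * xn2 (f P) = d * xn2 (f Q) by rewrite -h2 -h4.
  move: e1 e2; case: (f P) (f Q) => -[[x y]|] h [[[x' y']|] h'];
    rewrite /xn1 /xn2 /= ?mulr1 ?mulr0 => e1 e2 //.
  - by rewrite e2 in e1; rewrite (mulfI d0 e1).
  - by rewrite e2 eqxx in c0.
  by rewrite -e2 eqxx in d0.
suff hz : almost (fun P => f P = 0).
  move=> P; have [S h1 h2] := almost_ex2 hz (almost_addr P hz).
  have h2' : f (S + P) = 0 := h2.
  by rewrite -[LHS]add0r -h1 -hom h2'.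
apply: (almostW _ hg) => P gP; apply: boolp.contrapT => fP0.
have nz Q : good Q -> f Q <> 0.
  move=> gQ fQ; have [_ e] := same _ _ gP gQ; move: e fP0; rewrite fQ.
  case: (f P) => -[[x y]|] h; rewrite /xn2 /=; first by move/eqP; rewrite oner_eq0.
  by move=> _ []; apply: val_inj.
have fE Q : good Q -> f Q = f P \/ f Q = - f P.
  move=> gQ; apply: px_eq => //; first exact: nz.
  have [e _] := same _ _ gQ gP; move: e (nz _ gQ) fP0.
  case: (f P) (f Q) => -[[x y]|] h [[[x' y']|] h'] //; rewrite /xn1 /px /=.
    by move=> _ []; apply: val_inj.
  by move=> _ _ []; apply: val_inj.
have cancel1 : cancel (fun S => P + S) (fun S => S - P).
  by move=> S; rewrite addrC addKr.
have cancel2 : cancel (fun S => P - S) (fun S => P - S).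
  by move=> S; rewrite opprB addrC subrK.
have [S [gS [g1 g2]]] := almost_ex (almost_and hg (almost_and
  (almost_bij cancel1 hg) (almost_bij cancel2 hg))).
have [e|e] := fE S gS.
  by apply: (nz _ g2); rewrite hom endoN // e subrr.
by apply: (nz _ g1); rewrite hom e subrr.
Qed.

(* [L] and [M] are proportional and primitive, hence equal up to a constant. *)
Lemma tri_degree (L M : 'I_3 -> {poly K}) l m (lt mt : 'I_3 -> K) :
  (forall i j, L i * M j = L j * M i) ->
  (forall x, exists i, (L i).[x] != 0) -> (forall x, exists i, (M i).[x] != 0) ->
  (forall i, ftop (L i) l (lt i)) -> (forall i, ftop (M i) m (mt i)) ->
  (exists i, lt i != 0) -> (exists i, mt i != 0) -> l = m.
Proof.
move=> cross L0 M0 lL mM [il hl] [im hm].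
have [j Mj] : exists j, M j != 0.
  by have [j hj] := M0 0; exists j; apply: contraNneq hj => ->; rewrite horner0.
pose g := gcdp (L j) (M j); pose p := L j %/ g; pose q := M j %/ g.
have g0 : g != 0 by rewrite gcdp_eq0 (negPf Mj) andbF.
have cpq : coprimep p q by apply: coprimep_div_gcd; rewrite Mj orbT.
have ep : L j = p * g by rewrite divpK // dvdp_gcdl.
have eq : M j = q * g by rewrite divpK // dvdp_gcdr.
have e i : L i * q = p * M i.
  by apply: (mulIf g0); rewrite -mulrA -eq cross ep; ring.
have sz r s (U V : 'I_3 -> {poly K}) : coprimep r s ->
    (forall i, U i * r = s * V i) -> (forall x, exists i, (V i).[x] != 0) ->
    exists2 k, r = k%:P & k != 0.
  move=> crs h V0; have : size r == 1.
    apply/negPn/negP => /closed_rootP[x rx].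
    have sx := coprimep_root crs rx; have [i] := V0 x; rewrite -(inj_eq (mulfI sx)).
    by rewrite -hornerM -h hornerM (rootP rx) !mulr0 eqxx.
  by case/size_poly1P => k k0 ->; exists k.
have [k ek k0] : exists2 k, q = k%:P & k != 0.
  by apply: (sz q p L M) => //; rewrite coprimep_sym.
have [k' ek' k0'] : exists2 k, p = k%:P & k != 0.
  by apply: (sz p q M L) => // i; rewrite mulrC -e mulrC.
have e' i : k *: L i = k' *: M i by rewrite -!mul_polyC -ek -ek' -e mulrC.
have [lm|ml|//] := ltngtP l m.
  have [sM eM] := mM im; have [sL _] := lL im; case/eqP: hm; rewrite -eM.
  apply: (mulfI k0'); rewrite mulr0 -coefZ -e' coefZ nth_default ?mulr0 //.
  exact: leq_trans sL lm.
have [sM _] := mM il; have [sL eL] := lL il; case/eqP: hl; rewrite -eL.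
apply: (mulfI k0); rewrite mulr0 -coefZ e' coefZ nth_default ?mulr0 //.
exact: leq_trans sM ml.
Qed.

End XRep.

Lemma ftopMn (R : comNzRingType) (p : {poly R}) n c k :
  ftop p n c -> ftop (p *+ k) n (c *+ k).
Proof. by move=> h; rewrite -[p *+ k]scaler_nat -[c *+ k]mulr_natl; apply: ftopZ. Qed.

Lemma ftop_symform (R : comNzRingType) (A B C D : {poly R}) m n p q r s :
  ftop A m p -> ftop B m q -> ftop C n r -> ftop D n s ->
  forall i, ftop (symform A B C D i) (m + n) (symform p q r s i).
Proof.
move=> hA hB hC hD.
apply/(ord3P (fun i => ftop (symform A B C D i) (m + n) (symform p q r s i))).
have hX (X Y : {poly R}) x y : ftop X m x -> ftop Y n y -> ftop (X * Y) (m + n) (x * y).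
  exact: ftopM.
have hX' (X Y : {poly R}) x y : ftop X m x -> ftop Y n y -> ftop (Y * X) (m + n) (y * x).
  by rewrite addnC => h1 h2; apply: ftopM.
by split; rewrite /symform /=; [exact: hX | apply: ftopD; [exact: hX|exact: hX'] | exact: hX].
Qed.

Lemma ftop_sumform (R : comNzRingType) (a b : R) (A B C D : {poly R}) m n p q r s :
  ftop A m p -> ftop B m q -> ftop C n r -> ftop D n s ->
  forall i, ftop (sumform a%:P b%:P A B C D i) (m + n + (m + n)) (sumform a b p q r s i).
Proof.
move=> hA hB hC hD.
apply/(ord3P (fun i => ftop (sumform a%:P b%:P A B C D i) (m + n + (m + n))
  (sumform a b p q r s i))).
pose N := (m + n)%N.
have hX (X Y : {poly R}) x y : ftop X m x -> ftop Y n y -> ftop (X * Y) N (x * y).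
  exact: ftopM.
have hX' (X Y : {poly R}) x y : ftop X m x -> ftop Y n y -> ftop (Y * X) N (y * x).
  by rewrite /N addnC => h1 h2; apply: ftopM.
have hN (X Y : {poly R}) x y : ftop X N x -> ftop Y N y -> ftop (X * Y) (N + N) (x * y).
  exact: ftopM.
have hS (X : {poly R}) x k c : ftop X k x -> ftop (c%:P * X) k (c * x).
  by rewrite mul_polyC; exact: ftopZ.
have hB' (X Y : {poly R}) x y k : ftop X k x -> ftop Y k y -> ftop (X - Y) k (x - y).
  by move=> h1 h2; apply: ftopD => //; apply: ftopN.
rewrite /sumform /= !expr2 -/N; split;
repeat (first [ apply: hS | apply: hN | apply: hB' | apply: ftopMn | apply: ftopD
  | apply: ftopN | by [] | exact: hX hA hD | exact: hX hA hC | exact: hX hB hD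
  | exact: hX' hB hC ]).
Qed.

Lemma horner_symform (R : comNzRingType) (A B C D : {poly R}) i x :
  (symform A B C D i).[x] = symform A.[x] B.[x] C.[x] D.[x] i.
Proof.
by move: i; apply/ord3P; rewrite /symform /=; split; rewrite ?hornerD !hornerM.
Qed.

Lemma horner_sumform (R : comNzRingType) (a b : R) (A B C D : {poly R}) i x :
  (sumform a%:P b%:P A B C D i).[x] = sumform a b A.[x] B.[x] C.[x] D.[x] i.
Proof.
move: i; apply/ord3P; rewrite /sumform /=; split;
by rewrite !(hornerD, hornerN, hornerMn, hornerM, horner_exp, hornerC).
Qed.

(** * Parallelogram law and multiplicativity of the degree *)

Section Degree.

Variables (K : closedFieldType) (E : wcurve K).
Implicit Types (P Q S T : point E) (f g h : point E -> point E).
Implicit Types (A B C D : {poly K}) (m n : nat).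
Local Notation a := (wa E).
Local Notation b := (wb E).

(** The same point of the projective plane is given by forms of degree [n3 + n4], through [symform],
    and of degree [2 (n1 + n2)], through [sumform]. Neither triple has a common zero, not even at
    infinity, so the degrees agree. *)
Lemma xrep_parallelogram f g A1 B1 A2 B2 A3 B3 A4 B4 n1 n2 n3 n4 :
  xrep f A1 B1 n1 -> xrep g A2 B2 n2 ->
  xrep (fun P => f P + g P) A3 B3 n3 -> xrep (fun P => f P - g P) A4 B4 n4 ->
  (n3 + n4 = (n1 + n2).*2)%N.
Proof.
move=> h1 h2 h3 h4; rewrite -addnn.
have [c1 _ _] := h1; have [t1 t1' z1] := xrep_top h1.
have [c2 _ _] := h2; have [t2 t2' z2] := xrep_top h2.
have [c3 _ _] := h3; have [t3 t3' z3] := xrep_top h3.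
have [c4 _ _] := h4; have [t4 t4' z4] := xrep_top h4.
apply: (@tri_degree _ (symform A3 B3 A4 B4) (sumform a%:P b%:P A1 B1 A2 B2)).
- move=> i j; apply/eqP; rewrite -subr_eq0; apply/eqP; apply: (@almost_eq0 _ E).
  apply: almostW (almost_and (almost_and (xrep_prop h1) (xrep_prop h2))
    (almost_and (xrep_prop h3) (xrep_prop h4))).
  move=> P [[[k1 _ [e1 e1']] [k2 _ [e2 e2']]] [[k3 _ [e3 e3']] [k4 _ [e4 e4']]]].
  rewrite hornerD hornerN !hornerM !horner_symform !horner_sumform.
  rewrite e1 e1' e2 e2' e3 e3' e4 e4' !symform_scale !sumform_scale.
  by have [c _ hc] := sumform_points (f P) (g P); rewrite !hc; ring.
- move=> x; have [i hi] := symform_neq0 (coprimep_horner x c3) (coprimep_horner x c4).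
  by exists i; rewrite horner_symform.
- move=> x; have [i hi] := sumform_neq0 E (coprimep_horner x c1) (coprimep_horner x c2).
  by exists i; rewrite horner_sumform.
- exact: ftop_symform t3 t3' t4 t4'.
- exact: ftop_sumform t1 t1' t2 t2'.
- exact: symform_neq0.
exact: sumform_neq0.
Qed.

(** This is [D ^ n * A(C / D)] without denominators, so it also makes sense at the zeros of [D]. *)
Definition homog_comp A n C D : {poly K} :=
  \sum_(i < n.+1) A`_i *: (C ^+ i * D ^+ (n - i)).

Lemma homog_comp_ftop A n C D m c d : ftop C m c -> ftop D m d ->
  ftop (homog_comp A n C D) (n * m) (\sum_(i < n.+1) A`_i * (c ^+ i * d ^+ (n - i))).
Proof.
move=> hC hD; apply: ftop_sum => i; apply: ftopZ.
have -> : (n * m = i * m + (n - i) * m)%N by rewrite -mulnDl subnKC // -ltnS.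
by apply: ftopM; apply: ftopX.
Qed.

Lemma horner_homog_comp A n C D x : (homog_comp A n C D).[x] =
  \sum_(i < n.+1) A`_i * (C.[x] ^+ i * D.[x] ^+ (n - i)).
Proof.
rewrite /homog_comp horner_sum; apply: eq_bigr => i _.
by rewrite hornerZ hornerM !horner_exp.
Qed.

Lemma homog_comp_div A n (c d : K) : (size A <= n.+1)%N -> d != 0 ->
  \sum_(i < n.+1) A`_i * (c ^+ i * d ^+ (n - i)) = d ^+ n * A.[c / d].
Proof.
move=> sA d0; rewrite (horner_coef_wide _ sA) mulr_sumr; apply: eq_bigr => i _.
have -> : d ^+ n = d ^+ (n - i) * d ^+ i by rewrite -exprD subnK // -ltnS.
by rewrite expr_div_n; field; rewrite expf_neq0.
Qed.

Lemma homog_comp_neq0 A B n (c d : K) : (size A <= n.+1)%N -> (size B <= n.+1)%N ->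
  coprimep A B -> (A`_n != 0) || (B`_n != 0) -> (c != 0) || (d != 0) ->
  (\sum_(i < n.+1) A`_i * (c ^+ i * d ^+ (n - i)) != 0) ||
  (\sum_(i < n.+1) B`_i * (c ^+ i * d ^+ (n - i)) != 0).
Proof.
move=> sA sB cAB nz cd; have [d0|d0] := eqVneq d 0; last first.
  rewrite !homog_comp_div // !mulf_eq0 expf_eq0 (negPf d0) andbF /=.
  exact: coprimep_horner.
have c0 : c != 0 by rewrite d0 eqxx orbF in cd.
have top (U : {poly K}) : \sum_(i < n.+1) U`_i * (c ^+ i * d ^+ (n - i)) = U`_n * c ^+ n.
  rewrite big_ord_recr /= subnn big1 ?add0r ?expr0 ?mulr1 // => i _.
  by rewrite d0 expr0n subn_eq0 leqNgt ltn_ord /= !mulr0.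
by rewrite !top !mulf_eq0 expf_eq0 (negPf c0) andbF !orbF.
Qed.

(** Positive degree means finite fibres: the fibre over abscissa [x] lies, up to finitely many
    points, over the zeros of [A - x B], and the fibre at infinity over those of [B]. Neither
    polynomial is 0, for otherwise coprimality would make [A] and [B] constant. *)
Lemma almost_preim f A B n (X : point E -> Prop) : xrep f A B n.+1 ->
  almost X -> almost (fun P => X (f P)).
Proof.
move=> hf; have [cAB s ae] := hf.
have fiber Q : almost (fun P => f P <> Q).
  have nconst C D : coprimep C D -> C = 0 -> (size D <= 1)%N.
    by move=> + C0; rewrite C0 coprime0p => /eqp_size ->; rewrite size_poly1.
  case: (Q) => -[[x y]|] h.
    have nz : A - x *: B != 0.
      apply/eqP => /eqP; rewrite subr_eq0 => /eqP eA.
      have sB : (size B <= 1)%N.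
        apply: (@nconst (A - x *: B)); last by rewrite eA subrr.
        have := @coprimep_lin _ A B 1 (- x) 0 1 _ cAB.
        by rewrite !scale1r scale0r add0r scaleNr; apply; rewrite !mul1r mul0r subr0 oner_neq0.
      have sA : (size A <= 1)%N by rewrite eA (leq_trans (size_scale_leq _ _)).
      have : (maxn (size A) (size B) <= 1)%N by rewrite geq_max sA.
      by rewrite s.
    apply: almostW (almost_and ae (almost_neq0 E nz)) => P [+ /eqP nzP] fP.
    rewrite fP /xn1 /xn2 /= mulr1 => e; apply: nzP.
    by rewrite hornerD hornerN hornerZ e mulrC subrr.
  have nz : B != 0.
    apply/eqP => B0; have sA : (size A <= 1)%N by apply: (nconst B) => //; rewrite coprimep_sym.
    have : (maxn (size A) (size B) <= 1)%N by rewrite B0 size_poly0 geq_max sA.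
    by rewrite s.
  apply: almostW (almost_and ae (almost_neq0 E nz)) => P [+ /eqP nzP] fP.
  by rewrite fP /xn1 /xn2 /= mulr1 mulr0 => /esym.
move=> [l hl]; suff : almost (fun P => f P \notin l) by apply: almostW => P; exact: hl.
elim: l {hl} => [|Q l IH]; first by exists [::].
apply: almostW (almost_and (fiber Q) IH) => P [/eqP n1 n2].
by rewrite inE negb_or n1.
Qed.

(** Substitution causes no cancellation, since the homogenised pair has no common zero, at infinity
    included. Degree 0 of [g] is apart, as finite fibres are lost there. *)
Lemma xrep_comp f g A B C D n m : is_endo f -> is_endo g ->
  xrep f A B n -> xrep g C D m -> exists U V, xrep (f \o g) U V (n * m).
Proof.
move=> hf hg hAB hCD; case: m hCD => [|m] hCD.
  have g0 := xrep_const hg hCD; exists 1, 0; rewrite muln0; apply: xrep0 => P /=.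
  by rewrite g0; case: hf.
exists (homog_comp A n C D), (homog_comp B n C D).
have [cAB s _] := hAB; have [cCD s' _] := hCD.
have sA : (size A <= n.+1)%N by rewrite -s leq_maxl.
have sB : (size B <= n.+1)%N by rewrite -s leq_maxr.
have [_ _ nz] := xrep_top hAB; have [tC tD nz'] := xrep_top hCD.
have nzx x : ((homog_comp A n C D).[x] != 0) || ((homog_comp B n C D).[x] != 0).
  by rewrite !horner_homog_comp; apply: homog_comp_neq0 => //; exact: coprimep_horner.
split.
- apply/Pdiv.ClosedField.coprimepP => x /rootP rx.
  by have := nzx x; rewrite rx eqxx.
- have [sU tU] := homog_comp_ftop A n tC tD.
  have [sV tV] := homog_comp_ftop B n tC tD.
  apply/eqP; rewrite eqn_leq geq_max sU sV /=.
  have := homog_comp_neq0 sA sB cAB nz nz'; rewrite -tU -tV leq_max.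
  by case/orP=> h; apply/orP; [left|right]; rewrite ltnNge; apply: contra h => h;
    rewrite nth_default.
apply: almostW (almost_and (xrep_prop hCD) (almost_preim hCD
  (almost_and (almost_neq 0) (xrep_prop hAB)))).
move=> P [[c c0 [hC hD]] [gP [d d0 [hA hB]]]] /=.
have e1 : xn1 (g P) = px (g P).
  by move: gP; case: (g P) => -[[x y]|] h // []; apply: val_inj.
have e2 : xn2 (g P) = 1.
  by move: gP; case: (g P) => -[[x y]|] h // []; apply: val_inj.
rewrite e1 in hC; rewrite e2 mulr1 in hD.
have D0 : D.[px P] != 0 by rewrite hD.
have eq : C.[px P] / D.[px P] = px (g P) by rewrite hC hD mulrAC divff // mul1r.
by rewrite !horner_homog_comp !homog_comp_div // eq hA hB; ring.
Qed.

End Degree.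

(** * The norm form on the endomorphism ring *)

Lemma dvd439E (z : int) : (439 %| z)%Z = (z%:~R == 0 :> 'F_439).
Proof. by rewrite (dvdz_pcharf (pchar_Fp (isT : prime 439))). Qed.

Lemma no_sqrtN5 (z : 'F_439) : z ^+ 2 + 5%:R != 0.
Proof.
rewrite -(natr_Zp z) -natrX -natrD -(dvdn_pcharf (pchar_Fp (isT : prime 439))).
have /allP h : all (fun m => ~~ (439 %| m ^ 2 + 5)%N) (iota 0 439) by vm_compute.
by apply: h; rewrite mem_iota; have := ltn_ord z.
Qed.

Lemma anisotropic (F : fieldType) (c x y : F) :
  (forall z, z ^+ 2 + c != 0) -> c * x ^+ 2 + y ^+ 2 = 0 -> x = 0 /\ y = 0.
Proof.
move=> hc h; suff x0 : x = 0.
  by move/eqP: h; rewrite x0 expr0n mulr0 add0r expf_eq0 => /eqP.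
apply/eqP/negPn/negP => x0; have := hc (y / x); rewrite expr_div_n => /eqP[].
have x20 : x ^+ 2 != 0 by rewrite expf_neq0.
by apply: (mulIf x20); rewrite mulrDl divfK // mul0r addrC.
Qed.

Lemma dvd439_sqr_sum (x y : int) :
  (439 %| 5 * x ^+ 2 + y ^+ 2)%Z -> (439 %| x)%Z /\ (439 %| y)%Z.
Proof.
rewrite !dvd439E intrD intrM !rmorphXn /= => /eqP /(anisotropic no_sqrtN5)[-> ->].
by split; apply/eqP.
Qed.

Lemma norm_form440 (x y : int) :
  440 = x ^+ 2 + 439 * y ^+ 2 -> y ^+ 2 = 1 /\ x ^+ 2 = 1.
Proof.
move=> h; have : [\/ y = -1, y = 0 | y = 1].
  have h1 : -2 < y by nia.
  have h2 : y < 2 by nia.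
  have [|] : y = -1 \/ (y = 0 \/ y = 1) by lia.
    by constructor 1.
  by case; [constructor 2|constructor 3].
case=> ey; rewrite {}ey in h *; [by split; lia| |by split; lia].
have h1 : x <= 20 by nia.
have h2 : -20 <= x by nia.
by exfalso; nia.
Qed.

Section NormRing.

Variables (R : nzRingType) (N : R -> int).
Hypothesis N_par : forall x y, N (x + y) + N (x - y) = 2 * (N x + N y).
Hypothesis N_mul : forall x y, N (x * y) = N x * N y.
Hypothesis N_eq0 : forall x, N x = 0 -> x = 0.
Implicit Types x y z w : R.

(** The bilinear form attached to [N]; [polar x 1] plays the role of the reduced trace. *)
Definition polar x y := N (x + y) - N x - N y.
Local Notation T := polar.

Ltac abstract_norms :=
  repeat match goal with H : _ = _ :> _ |- _ => revert H end;
  repeat match goal with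
  | |- context [N ?x] => move: (N x) => ?
  | |- context [polar ?x ?y] => move: (polar x y) => ?
  end; intros.
Ltac ilia := abstract_norms; lia.
Ltac inia := abstract_norms; nia.

Lemma qnorm0 : N 0 = 0.
Proof. by have := N_par 0 0; rewrite subrr addr0; ilia. Qed.

Lemma polarC x y : T x y = T y x.
Proof. by rewrite /polar [x + y]addrC; ilia. Qed.

(** As in the theorem of Jordan and von Neumann, additivity follows from four instances of the
    parallelogram law. *)
Lemma polarDl x y z : T (x + y) z = T x z + T y z.
Proof.
have h1 := N_par (x + z) y; have h2 := N_par x (z - y); have h3 := N_par (x + y) z.
have h4 := N_par z y.
have e1 : x + z + y = x + y + z by rewrite addrAC.
have e2 : x + (z - y) = x + z - y by rewrite addrA.
have e3 : x - (z - y) = x + y - z by rewrite opprB addrA.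
rewrite e1 in h1; rewrite e2 e3 in h2.
by rewrite /polar [y + z]addrC; ilia.
Qed.

Lemma polarNl x y : T (- x) y = - T x y.
Proof.
have : T (x - x) y = 0 by rewrite subrr /polar add0r qnorm0; ilia.
by rewrite polarDl; ilia.
Qed.

Lemma polarBl x y z : T (x - y) z = T x z - T y z.
Proof. by rewrite polarDl polarNl. Qed.

Lemma polar0l y : T 0 y = 0.
Proof. by rewrite -[0](subrr y) polarBl subrr. Qed.

Lemma polarMzl x n y : T (x *~ n) y = n * T x y.
Proof.
have h k : T (x *+ k) y = k%:Z * T x y.
  elim: k => [|k IH]; first by rewrite mulr0n polar0l mul0r.
  by rewrite mulrS polarDl IH; ilia.
case: n => k; first exact: h.
by rewrite NegzE mulrNz polarNl h mulNr.
Qed.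

Lemma polarDr x y z : T z (x + y) = T z x + T z y.
Proof. by rewrite ![T z _]polarC polarDl. Qed.

Lemma polarNr x y : T y (- x) = - T y x.
Proof. by rewrite ![T y _]polarC polarNl. Qed.

Lemma polarBr x y z : T z (x - y) = T z x - T z y.
Proof. by rewrite ![T z _]polarC polarBl. Qed.

Lemma polarMzr x n y : T y (x *~ n) = n * T y x.
Proof. by rewrite ![T y _]polarC polarMzl. Qed.

Lemma polarxx x : T x x = 2 * N x.
Proof. by have := N_par x x; rewrite subrr qnorm0 /polar; ilia. Qed.

Lemma qnormMz x n : N (x *~ n) = n ^+ 2 * N x.
Proof. by have := polarxx (x *~ n); rewrite polarMzl polarMzr polarxx; ilia. Qed.

Lemma qnormD x y : N (x + y) = N x + N y + T x y.
Proof. by rewrite /polar; ilia. Qed.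

Lemma polar_nondeg z : (forall y, T y z = 0) -> z = 0.
Proof. by move=> /(_ z); rewrite polarxx => h; apply: N_eq0; ilia. Qed.

Lemma polar_mull x y z : T (x * y) (x * z) = N x * T y z.
Proof. by rewrite /polar -mulrDr !N_mul; ilia. Qed.

Lemma polar_mulr x y z : T (y * x) (z * x) = N x * T y z.
Proof. by rewrite /polar -mulrDl !N_mul; ilia. Qed.

Lemma qnorm1 : N 1 = 1.
Proof.
have := N_mul 1 1; rewrite mulr1.
have : N 1 != 0 by apply/eqP=> /N_eq0/eqP; rewrite oner_eq0.
by inia.
Qed.

Lemma qnorm_int n : N (n%:~R) = n ^+ 2.
Proof. by rewrite qnormMz qnorm1 mulr1. Qed.

Lemma intr_norm_eq0 n : n%:~R = 0 :> R -> n = 0.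
Proof. by move=> h; have := qnorm_int n; rewrite h qnorm0; inia. Qed.

(** The adjoint of left multiplication by [x] is left multiplication by the conjugate [T x 1 - x];
    this comes from expanding [polar_mull] at [x + 1]. *)
Lemma polar_adj x y w : T (x * y) w = T y (w *~ T x 1 - x * w).
Proof.
have := polar_mull (x + 1) y w.
rewrite !mulrDl !mul1r polarDl !polarDr !polar_mull qnormD qnorm1 polarNr polarMzr.
by ilia.
Qed.

(** Both sides pair equally with every [y], by [polar_adj], and the form is nondegenerate. *)
Lemma sqr_trace x : x * x = x *~ T x 1 - (N x)%:~R.
Proof.
apply/eqP; rewrite -subr_eq0; apply/eqP; apply: polar_nondeg => y.
rewrite !polarBr !polarMzr.
by have := polar_mull x y 1; rewrite mulr1 polar_adj polarBr polarMzr; ilia.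
Qed.

Lemma sqr_trace0 x : T x 1 = 0 -> x * x = - (N x)%:~R.
Proof. by move=> h; rewrite sqr_trace h mulr0z sub0r. Qed.

(** Both [T (x * y) y] and [T (y * x) y] equal [N y * T x 1], while anticommutation makes them
    opposite. *)
Lemma anticomm_trace x y : N y != 0 -> x * y = - (y * x) -> T x 1 = 0.
Proof.
move=> y0 e; have h1 := polar_mulr y x 1; have h2 := polar_mull y x 1.
rewrite mul1r e polarNl in h1; rewrite mulr1 in h2.
have /eqP : N y * T x 1 = 0 by ilia.
by rewrite mulf_eq0 (negPf y0) => /eqP.
Qed.

Lemma trace0_comm x y : T x 1 = 0 -> T y 1 = 0 ->
  x * y + y * x = - (T x y)%:~R.
Proof.
move=> hx hy; have hxy : T (x + y) 1 = 0 by rewrite polarDl hx hy.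
have -> : x * y + y * x = (x + y) * (x + y) - (x * x + y * y).
  apply/eqP; rewrite eq_sym subr_eq mulrDl !mulrDr.
  by rewrite [X in _ == X]addrACA [x * y + x * x]addrC.
rewrite !sqr_trace0 // opprD !opprK -intrD -!mulrNz -intrD; congr (_%:~R).
by rewrite /polar; ilia.
Qed.

Lemma trace0_anticomm x y : T x 1 = 0 -> T y 1 = 0 -> T x y = 0 -> x * y = - (y * x).
Proof.
move=> hx hy hxy; apply/eqP; rewrite -addr_eq0 trace0_comm // hxy.
by rewrite mulr0z oppr0.
Qed.

Lemma anticomm_polar x y : T x 1 = 0 -> T y 1 = 0 -> x * y = - (y * x) -> T x y = 0.
Proof.
move=> hx hy e; have := trace0_comm hx hy; rewrite e addNr => /esym/eqP.
by rewrite oppr_eq0 => /eqP/intr_norm_eq0.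
Qed.

(** Here [x * y] has trace 0, so its square is [- (N x * N y)]; by commutation the square is also
    [x ^ 2 * y ^ 2], which is [N x * N y]. *)
Lemma comm_orth0 x y : N x != 0 -> x * y = y * x ->
  T x 1 = 0 -> T y 1 = 0 -> T y x = 0 -> y = 0.
Proof.
move=> x0 e hx hy hyx.
have hxy : T (x * y) 1 = 0 by rewrite polar_adj hx mulr0z sub0r mulr1 polarNr hyx.
have := sqr_trace0 hxy.
have -> : x * y * (x * y) = (x * x) * (y * y) by rewrite -!mulrA [y * (x * y)]mulrA -e !mulrA.
rewrite !sqr_trace0 // mulrNN -intrM N_mul => /eqP.
rewrite -addr_eq0 -intrD => /eqP/intr_norm_eq0 h.
by apply: N_eq0; apply/eqP; move/eqP: h; rewrite -mulr2n -mulr_natl !mulf_eq0 (negPf x0).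
Qed.

(** * The lattice spanned by 1, alpha, beta and alpha beta *)

Section Lattice.

Variables phi al be : R.
Hypotheses (N_phi : N phi = 439) (N_al : N al = 5) (N_be : N be = 22).
Hypothesis al_phi : al * phi = - (phi * al).
Hypothesis be_phi : be * phi = - (phi * be).

Let phi_al : phi * al = - (al * phi). Proof. by rewrite al_phi opprK. Qed.
Let tr_al : T al 1 = 0. Proof. by apply: (anticomm_trace _ al_phi); rewrite N_phi. Qed.
Let tr_be : T be 1 = 0. Proof. by apply: (anticomm_trace _ be_phi); rewrite N_phi. Qed.
Let tr_phi : T phi 1 = 0. Proof. by apply: (anticomm_trace _ phi_al); rewrite N_al. Qed.

Lemma sqr_al : al * al = (- 5)%:~R.
Proof. by rewrite sqr_trace0 // N_al mulrNz. Qed.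

Lemma sqr_be : be * be = (- 22)%:~R.
Proof. by rewrite sqr_trace0 // N_be mulrNz. Qed.

Lemma sqr_phi : phi * phi = (- 439)%:~R.
Proof. by rewrite sqr_trace0 // N_phi mulrNz. Qed.

Let al_phi0 : T al phi = 0. Proof. exact: anticomm_polar. Qed.
Let be_phi0 : T be phi = 0. Proof. exact: anticomm_polar. Qed.

(** The elements [1], [phi], [al], [v] are pairwise orthogonal. The two integers [t] and [S]
    determine all inner products of [u] and [be] with them. *)
Let v := al * phi.
Let u := al * be.
Let t := T u 1.
Let S := T u phi.

Let Nv : N v = 5 * 439. Proof. by rewrite N_mul N_al N_phi. Qed.
Let Nu : N u = 5 * 22. Proof. by rewrite N_mul N_al N_be. Qed.
Let v_1 : T v 1 = 0.
Proof. by rewrite polar_adj tr_al mulr0z sub0r mulr1 polarNr polarC al_phi0 oppr0. Qed.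
Let v_phi : T v phi = 0.
Proof. by have := polar_mulr phi al 1; rewrite mul1r tr_al mulr0. Qed.
Let v_al : T v al = 0.
Proof. by have := polar_mull al phi 1; rewrite mulr1 tr_phi mulr0. Qed.
Let u_al : T u al = 0.
Proof. by have := polar_mull al be 1; rewrite mulr1 tr_be mulr0. Qed.
Let u_be : T u be = 0.
Proof. by have := polar_mulr be al 1; rewrite mul1r tr_al mulr0. Qed.
Let u_v : T u v = 0.
Proof. by rewrite polar_mull be_phi0 mulr0. Qed.
Let be_al : T be al = - t.
Proof.
have := polar_adj al be 1; rewrite tr_al mulr0z sub0r mulr1 polarNr -/u -/t => ->.
by rewrite opprK.
Qed.
Let be_v : T be v = - S.
Proof. by rewrite polarC polar_adj tr_al mulr0z sub0r polarNr polarC. Qed.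
Let one_one : T 1 1 = 2. Proof. by rewrite polarxx qnorm1. Qed.

(** Such a [y] anticommutes with [al] and with [phi], hence commutes with their product [v], to
    which it is orthogonal. This bounds the rank by 4 and turns each linear relation below into four
    scalar products. *)
Lemma orthogonal_eq0 y :
  T y 1 = 0 -> T y phi = 0 -> T y al = 0 -> T y v = 0 -> y = 0.
Proof.
move=> y1 yphi yal yv; apply: (@comm_orth0 v) => //; first by rewrite Nv.
have e1 : y * al = - (al * y) by apply: trace0_anticomm.
have e2 : y * phi = - (phi * y) by apply: trace0_anticomm.
by rewrite /v -mulrA [RHS]mulrA e1 mulNr -[al * y * phi]mulrA e2 mulrN opprK.
Qed.

Lemma polar3 x0 x1 x2 n0 n1 n2 y :
  T (x0 *~ n0 + x1 *~ n1 + x2 *~ n2) y = n0 * T x0 y + n1 * T x1 y + n2 * T x2 y.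
Proof. by rewrite !polarDl !polarMzl. Qed.

Let t_1 : T u 1 = t. Proof. by []. Qed.
Let S_phi : T u phi = S. Proof. by []. Qed.
Let tr_C x : T 1 x = T x 1. Proof. exact: polarC. Qed.
Let phi_C x : T phi x = T x phi. Proof. exact: polarC. Qed.
Let al_v : T al v = 0. Proof. by rewrite polarC. Qed.
Let phi_phi : T phi phi = 2 * 439. Proof. by rewrite polarxx N_phi. Qed.
Let al_al : T al al = 2 * 5. Proof. by rewrite polarxx N_al. Qed.
Let v_v : T v v = 2 * (5 * 439). Proof. by rewrite polarxx Nv. Qed.
Let u_u : T u u = 2 * (5 * 22). Proof. by rewrite polarxx Nu. Qed.

Let polarv := (al_v, t_1, S_phi, tr_al, tr_be, tr_phi, al_phi0, be_phi0, v_1,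
  v_phi, v_al, u_al, u_be, u_v, be_al, be_v, one_one, phi_phi, al_al, v_v, u_u, tr_C, phi_C).

(** The orthogonal projection of [u] is [t / 2 + (S / 878) phi]; the relation is this one multiplied
    by [878 = 2 * 439]. *)
Lemma al_be_rel : exists m n k : int, [/\ m = 878, n = - (439 * t), k = - S &
  u *~ m + 1 *~ n + phi *~ k = 0].
Proof.
exists 878, (- (439 * t)), (- S); split=> //.
apply: orthogonal_eq0; rewrite polar3 !polarv; move: t S; ilia.
Qed.

(** Pairing the relation with [u], of norm 110, gives [S ^ 2 = 439 (440 - t ^ 2)]. Hence 439 divides
    [S], and [440 = t ^ 2 + 439 s ^ 2] leaves only signs. *)
Lemma trace_al_be : exists2 s, S = 439 * s & (s ^+ 2 = 1) /\ (t ^+ 2 = 1).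
Proof.
have [m [n [k [em en ek e]]]] := al_be_rel.
have := polar3 u 1 phi m n k u; rewrite e polar0l !polarv em en ek => h.
have hS : S ^+ 2 = 439 * (440 - t ^+ 2) by move: h; clear; move: t S; ilia.
have /dvd439_sqr_sum[_ /dvdzP[s es]] : (439 %| 5 * 0 ^+ 2 + S ^+ 2)%Z.
  by rewrite expr0n mulr0 add0r hS dvdz_mulr.
exists s; first by rewrite es mulrC.
apply: norm_form440.
by move: hS; rewrite es; clear; move: t s; inia.
Qed.

Lemma polar5 x0 x1 x2 x3 x4 n0 n1 n2 n3 n4 y :
  T (x0 *~ n0 + x1 *~ n1 + x2 *~ n2 + x3 *~ n3 + x4 *~ n4) y =
  n0 * T x0 y + n1 * T x1 y + n2 * T x2 y + n3 * T x3 y + n4 * T x4 y.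
Proof. by rewrite !polarDl !polarMzl. Qed.

(** In the orthogonal basis [1], [phi], [al], [v] the coordinates of [f] are its scalar products
    divided by norms. The relations [2 u = t + s phi] and [10 be = - t al - s v] convert them to the
    basis [1], [al], [be], [u], where only the denominator 439 remains. *)
Lemma lattice_span f : exists a b c d : int,
  f = a%:~R + al *~ b + be *~ c + (al * be) *~ d.
Proof.
have [s eS [s2 t2]] := trace_al_be.
have key2 m n k : m = 2 -> n = - t -> k = - s ->
    u *~ m + 1 *~ n + phi *~ k = 0.
  move=> em en ek; apply: orthogonal_eq0; rewrite polar3 !polarv {}em {}en {}ek ?eS;
  by clear; move: t s; ilia.
have key3 m n k : m = 10 -> n = t -> k = s ->
    be *~ m + al *~ n + v *~ k = 0.
  move=> em en ek; apply: orthogonal_eq0; rewrite polar3 !polarv {}em {}en {}ek ?eS;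
  by clear; move: t s; ilia.
pose t0 := T f 1; pose T1 := T f phi; pose T2 := T f al; pose T3 := T f v.
pose a2 := T f u; pose b2 := T f be.
have e2 : 2 * a2 = t * t0 + s * T1.
  have := polar3 u 1 phi 2 (- t) (- s) f; rewrite key2 // polar0l.
  rewrite ![T _ f]polarC -/t0 -/T1 -/a2; clear.
  by move: t s t0 T1 a2; ilia.
have e3 : 10 * b2 = - (t * T2) - s * T3.
  have := polar3 be al v 10 t s f; rewrite key3 // polar0l.
  rewrite ![T _ f]polarC -/T2 -/T3 -/b2; clear.
  by move: t s T2 T3 b2; ilia.
have sqr1 (x : int) : x ^+ 2 = 1 -> x = 1 \/ x = -1.
  by move/eqP; rewrite sqrf_eq1 => /orP[/eqP|/eqP]; [left|right].
have ht := sqr1 _ t2; have hs := sqr1 _ s2.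
pose P := s * T1; pose Q := s * T3.
have orth5 k n0 n1 n2 n3 :
    k * t0 + n0 * 2 + n3 * t = 0 -> k * T1 + n3 * (439 * s) = 0 ->
    k * T2 + n1 * 10 - n2 * t = 0 -> k * T3 - n2 * (439 * s) = 0 ->
    f *~ k + 1 *~ n0 + al *~ n1 + be *~ n2 + u *~ n3 = 0.
  move=> h0 h1 h2 h3; apply: orthogonal_eq0; rewrite polar5 !polarv ?eS -/t0 -/T1 -/T2 -/T3.
  - by rewrite -[RHS]h0; clear; move: t; ilia.
  - by rewrite -[RHS]h1; clear; move: s; ilia.
  - by rewrite -[RHS]h2; clear; move: t; ilia.
  by rewrite -[RHS]h3; clear; move: s; ilia.
have key5 : (439 %| 5 * T1 ^+ 2 + T3 ^+ 2)%Z.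
  (* The coordinates of [f] on [u] and [be] are [P / 439] and [- Q / 439]. The constants 220 and 44
     are 440 / 2 and 440 / 10: eliminating [t0] and [T2] by [e2] and [e3] adds a multiple 439 to a
     multiple 1. *)
  have w0 : f *~ 439 + 1 *~ (220 * (t * P) - 439 * (t * a2))
      + al *~ (439 * (t * b2) + 44 * (t * Q)) + be *~ Q + u *~ (- P) = 0.
    apply: orth5.
    - by rewrite /P; move: e2 ht hs; clear; move: t s t0 T1 a2 => q r ? ? ? h;
      case=> e [e'|e']; rewrite e e' in h *; lia.
    - by rewrite /P; move: hs; clear; move: s T1 => r ? [->|->]; lia.
    - by rewrite /Q; move: e3 ht hs; clear; move: t s T2 T3 b2 => q r ? ? ? h;
      case=> e [e'|e']; rewrite e e' in h *; lia.
    by rewrite /Q; move: hs; clear; move: s T3 => r ? [->|->]; lia.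
  have := polar0l f; rewrite -w0 polar5.
  rewrite polarxx ![T _ f]polarC -/t0 -/T2 -/b2 -/a2 => h.
  (* Modulo 439 the pairing of [w0] with [f] reduces to [-44 (5 T1 ^ 2 + T3 ^ 2)]. Multiplying by 10
     isolates the sum, as 440 is 1 modulo 439; this determines the quotient. *)
  apply/dvdzP; exists (10 * (2 * N f + 2 * (P * a2) - 2 * a2 ^+ 2 - 10 * b2 ^+ 2
    - 2 * (Q * b2)) - (5 * T1 ^+ 2 + T3 ^+ 2)).
  move: h e2 e3 ht hs; rewrite /P /Q; clear; move: (N f) t s t0 T1 T2 T3 a2 b2.
  move=> n q r t0 T1 T2 T3 a2 b2 h e2 e3 hq hr.
  have et : t0 = q * (2 * a2 - r * T1) by case: hq e2 => ->; lia.
  have eT : T2 = - (q * (10 * b2 + r * T3)) by case: hq e3 => ->; lia.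
  have q2 : q * q = 1 by case: hq => ->.
  have r2 : r * r = 1 by case: hr => ->.
  rewrite et eT in h; set P := r * T1 in h *; set Q := r * T3 in h *.
  have P2 : P * P = T1 * T1 by rewrite /P mulrACA r2 mul1r.
  have Q2 : Q * Q = T3 * T3 by rewrite /Q mulrACA r2 mul1r.
  have h' : 439 * (2 * n) + 220 * (q * q) * (P * (2 * a2) - P * P)
     - 439 * (q * q) * a2 * (2 * a2 - P) - 439 * (q * q) * b2 * (10 * b2 + Q)
     - 44 * (q * q) * (Q * (10 * b2) + Q * Q) + Q * b2 - P * a2 = 0.
    by rewrite -h; ring.
  by move: h'; rewrite q2 P2 Q2 !mulr1; clear; move: P Q => P Q; nia.
have [/dvdzP[p1 ep1] /dvdzP[p3 ep3]] := dvd439_sqr_sum key5.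
(* The coordinates found above, now integral: [P / 439] and [Q / 439] have become [s * p1] and
   [s * p3]. *)
exists (t * a2 - 220 * (t * (s * p1))), (- (t * b2) - 44 * (t * (s * p3))), (- (s * p3)), (s * p1).
have w0 : f *~ 1 + 1 *~ (220 * (t * (s * p1)) - t * a2)
      + al *~ (t * b2 + 44 * (t * (s * p3))) + be *~ (s * p3) + u *~ (- (s * p1)) = 0.
  move: ep1 ep3 => ep1 ep3; apply: orth5; rewrite ?ep1 ?ep3.
  - move: e2 ht hs; rewrite ep1; clear; move: t s t0 p1 a2 => q r ? ? ? h;
      case=> e [e'|e']; rewrite e e' in h *; lia.
  - by move: hs; clear; move: s p1 => r ? [->|->]; lia.
  - move: e3 ht hs; rewrite ep3; clear; move: t s T2 p3 b2 => q r ? ? ? h;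
      case=> e [e'|e']; rewrite e e' in h *; lia.
  by move: hs; clear; move: s p3 => r ? [->|->]; lia.
move/eqP: w0; rewrite mulr1z -!addrA addr_eq0 => /eqP->.
by rewrite !opprD -!mulrNz opprB opprD opprK !addrA.
Qed.

End Lattice.

End NormRing.

(** * Explicit odd maps *)

Section Homogenization.

Variables (K : closedFieldType) (E : wcurve K).
Implicit Types (P Q S T : point E) (U V A B C : {poly K}).
Local Notation a := (wa E).
Local Notation b := (wb E).
Local Notation hc := (@homog_coord K E).

(* [X ^ r * w ^ q * Z ^ (d - 2 q - r)] with [w = Y ^ 2 - a X Z - b Z ^ 2], which
   equals [X ^ 3] where [Z = 1]: it represents [x ^ (3 q + r)]. *)
Definition monom_w (d k : nat) : {mpoly K[3]} :=
  'X_i0 ^+ (k %% 3) * ('X_i1 ^+ 2 - a *: ('X_i0 * 'X_i2) - b *: 'X_i2 ^+ 2) ^+ (k %/ 3)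
  * 'X_i2 ^+ (d - (2 * (k %/ 3) + k %% 3)).

Lemma meval_exp (v : 'I_3 -> K) (p : {mpoly K[3]}) n : (p ^+ n).@[v] = p.@[v] ^+ n.
Proof. exact: rmorphXn. Qed.

Lemma dhomogXi i : ('X_i : {mpoly K[3]}) \is 1.-homog.
Proof. by rewrite dhomogX; apply/eqP; exact: mdeg1. Qed.

Lemma dhomogXin i n : ('X_i ^+ n : {mpoly K[3]}) \is n.-homog.
Proof. by have := dhomogMn n (dhomogXi i); rewrite mul1n. Qed.

Lemma monom_w_dhomog d k : (2 * (k %/ 3) + k %% 3 <= d)%N -> monom_w d k \is d.-homog.
Proof.
move=> h; rewrite -[X in X.-homog](subnKC h); apply: dhomogM (dhomogXin _ _).
rewrite [(2 * _ + _)%N]addnC; apply: dhomogM (dhomogXin _ _) _.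
apply: dhomogMn; apply: rpredB; first apply: rpredB.
- exact: dhomogXin.
- by apply: dhomogZ; apply: (dhomogM (dhomogXi i0) (dhomogXi i2)).
by apply: dhomogZ; exact: dhomogXin.
Qed.

Lemma monom_w_affine d k P : P <> 0 -> (monom_w d k).@[hc P] = px P ^+ k.
Proof.
move=> P0; rewrite /monom_w !(mevalM, meval_exp, mevalB, mevalZ, mevalXU).
rewrite !(hcE P0) /= !expr1n !mulr1.
have -> : py P ^+ 2 - a * px P - b = px P ^+ 3 by rewrite (pyE P0); ring.
by rewrite -exprM -exprD mulnC addnC -divn_eq.
Qed.

Lemma monom_w_infty d k :
  (monom_w d k).@[hc 0] = ((k %% 3 == 0) && (d <= 2 * (k %/ 3) + k %% 3))%N%:R.
Proof.
rewrite /monom_w !(mevalM, meval_exp, mevalB, mevalZ, mevalXU) !hc0 /=.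
rewrite !expr0n ?mulr0 ?mul0r !subr0 mulr1 expr1n mulr1.
by rewrite -natrM mulnb -subn_eq0.
Qed.

(** Rewriting [x ^ 3] as [w] lowers the degree of [x ^ (3 q + r)] to [2 q + r]. In degree [2 m] only
    [x ^ (3 m)], which becomes [w ^ m], survives at infinity, where [w = 1]. *)
Lemma homog_even U m : (size U <= (3 * m).+1)%N -> exists H : {mpoly K[3]},
  [/\ H \is (2 * m).-homog, forall P, P <> 0 -> H.@[hc P] = U.[px P]
    & H.@[hc 0] = U`_(3 * m)].
Proof.
move=> sU; exists (\sum_(k < (3 * m).+1) U`_k *: monom_w (2 * m) k); split.
- by apply: rpred_sum => -[k hk] _ /=; apply: dhomogZ; apply: monom_w_dhomog; lia.
- move=> P P0; rewrite raddf_sum (horner_coef_wide _ sU); apply: eq_bigr => k _.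
  by rewrite /= mevalZ monom_w_affine.
rewrite raddf_sum big_ord_recr /= mevalZ monom_w_infty.
have -> : ((3 * m %% 3 == 0) && (2 * m <= 2 * (3 * m %/ 3) + 3 * m %% 3))%N by lia.
rewrite mulr1 big1 ?add0r // => -[k hk] _ /=; rewrite mevalZ monom_w_infty.
have -> : ((k %% 3 == 0) && (2 * m <= 2 * (k %/ 3) + k %% 3))%N = false by lia.
by rewrite mulr0.
Qed.

(** In degree [2 m + 1] one more power of [x] fits, and every monomial used contains [X] or [Z] as a
    factor, hence vanishes at infinity. *)
Lemma homog_odd U m : (size U <= (3 * m).+2)%N -> exists H : {mpoly K[3]},
  [/\ H \is (2 * m).+1.-homog, forall P, P <> 0 -> H.@[hc P] = U.[px P]
    & H.@[hc 0] = 0].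
Proof.
move=> sU; exists (\sum_(k < (3 * m).+2) U`_k *: monom_w (2 * m).+1 k); split.
- by apply: rpred_sum => -[k hk] _ /=; apply: dhomogZ; apply: monom_w_dhomog; lia.
- move=> P P0; rewrite raddf_sum (horner_coef_wide _ sU); apply: eq_bigr => k _.
  by rewrite /= mevalZ monom_w_affine.
rewrite raddf_sum big1 // => -[k hk] _ /=; rewrite mevalZ monom_w_infty.
have -> : ((k %% 3 == 0) && ((2 * m).+1 <= 2 * (k %/ 3) + k %% 3))%N = false by lia.
by rewrite mulr0.
Qed.

End Homogenization.

Section OddMap.

Variables (K : closedFieldType) (E : wcurve K).
Implicit Types (P Q S T : point E).
Local Notation a := (wa E).
Local Notation b := (wb E).
Local Notation hc := (@homog_coord K E).

Variables (e q D A0 B l : {poly K}) (m n : nat).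
Let g : {poly K} := 'X^3 + a *: 'X + b%:P.
(** The map [(x, y) -> (A0 / (e D ^ 2), y B / (e ^ 2 D ^ 3))] is brought to a common denominator: in
    homogeneous coordinates it is [(A : y B : C)]. *)
Let A : {poly K} := A0 * (e * D).
Let C : {poly K} := e * D ^+ 2 * (e * D).
Hypothesis gE : g = e * q.
Hypothesis curve_eq :
  q * B ^+ 2 = A0 ^+ 3 + a%:P * A0 * (e ^+ 2 * D ^+ 4) + b%:P * (e ^+ 3 * D ^+ 6).
Hypothesis coprime_gBD : coprimep (g * B) D.
Hypothesis coprime_qBe : coprimep (q * B) e.
Hypothesis coprime_A0 : coprimep A0 (e * D ^+ 2).
Hypothesis size_A0 : maxn (size A0) (size (e * D ^+ 2)) = n.+1.
Hypothesis n_gt0 : (0 < n)%N.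
Hypothesis size_lA : (size (l * A)%R <= (3 * m).+2)%N.
Hypothesis size_lB : (size (l * B)%R <= (3 * m).+1)%N.
Hypothesis size_lC : (size (l * C)%R <= (3 * m).+2)%N.
Hypothesis top_lB : (l * B)`_(3 * m) != 0.

Let g_y P : P <> 0 -> g.[px P] = py P ^+ 2.
Proof.
by move=> P0; rewrite (pyE P0) /g !(hornerD, hornerXn, hornerZ, hornerX, hornerC).
Qed.

Lemma oddmap_curve x : g.[x] * B.[x] ^+ 2 * C.[x] =
  A.[x] ^+ 3 + a * A.[x] * C.[x] ^+ 2 + b * C.[x] ^+ 3.
Proof.
have := congr1 (fun p : {poly K} => (p * (e ^+ 3 * D ^+ 3)).[x]) curve_eq.
rewrite gE /A /C !(hornerM, hornerD, horner_exp, hornerC) => h.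
apply: etrans (_ : q.[x] * B.[x] ^+ 2 * (e.[x] ^+ 3 * D.[x] ^+ 3) = _); first by ring.
by rewrite h; ring.
Qed.

Definition oddmap_raw (P : option (K * K)) : option (K * K) :=
  if P is Some (x, y) then
    if C.[x] == 0 then None else Some (A.[x] / C.[x], y * B.[x] / C.[x])
  else None.

Lemma oddmap_on P : oncurve E (oddmap_raw (val P)).
Proof.
case: P => -[[x y]|] //= hP; case: eqP => //= /eqP C0; apply/eqP.
have gx : g.[x] = y ^+ 2.
  rewrite (eqP hP) /g !(hornerD, hornerXn, hornerZ, hornerX, hornerC); ring.
have C30 : C.[x] ^+ 3 != 0 by rewrite expf_neq0.
apply: (mulIf C30); have := oddmap_curve x; rewrite gx => h.
apply: etrans (_ : y ^+ 2 * B.[x] ^+ 2 * C.[x] = _); first by field.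
by rewrite h; field.
Qed.

Definition oddmap P : point E := exist (oncurve E) _ (oddmap_on P).

Lemma oddmap0 : oddmap 0 = 0. Proof. exact: val_inj. Qed.

Lemma oddmap_C0 P : C.[px P] = 0 -> oddmap P = 0.
Proof.
by move=> h; apply: val_inj; case: P h => -[[x y]|] hP //=; rewrite /px /= => ->; rewrite eqxx.
Qed.

Lemma val_affine P x y : val P = Some (x, y) -> [/\ P <> 0, px P = x & py P = y].
Proof. by case: P => P h /= eP; subst P; split=> // /(congr1 val). Qed.

Lemma oddmap_C P : P <> 0 -> C.[px P] != 0 ->
  [/\ oddmap P <> 0, px (oddmap P) = A.[px P] / C.[px P] &
      py (oddmap P) = py P * B.[px P] / C.[px P]].
Proof.
case: P => -[[x y]|] h P0; last by case: P0; apply: val_inj.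
move=> /negPf; rewrite {1}/px /= => h0; apply: val_affine.
by rewrite /= h0.
Qed.

Lemma oddmap_prop P : P <> 0 -> exists c : K, forall i : 'I_3,
  nth 0 [:: A.[px P]; py P * B.[px P]; C.[px P]] i = c * hc (oddmap P) i.
Proof.
move=> P0; have [C0|C0] := eqVneq C.[px P] 0.
  exists (py P * B.[px P]); rewrite oddmap_C0 //; apply/ord3P; rewrite !hc0 /=.
  rewrite C0 mulr0 mulr1; split=> //.
  have := oddmap_curve (px P); rewrite C0 !expr0n !mulr0 !addr0 => /esym/eqP.
  by rewrite expf_eq0 => /eqP.
have [n0 ex ey] := oddmap_C P0 C0; exists C.[px P]; apply/ord3P.
by rewrite !(hcE n0) /= ex ey mulr1; split=> //; field.
Qed.

(** The outer coordinates are homogenised in odd degree and vanish at infinity; the middle one is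
    [Y] times an even form whose value there is the top coefficient of [r * B]. The multiplier [r]
    is [l] at infinity, to bring this coefficient to an exponent divisible by 3, and 1 elsewhere. *)
Lemma oddmap_formula (r : {poly K}) k P :
  (size (r * A)%R <= (3 * k).+2)%N -> (size (r * B)%R <= (3 * k).+1)%N ->
  (size (r * C)%R <= (3 * k).+2)%N ->
  (P <> 0 -> [|| (r * A).[px P] != 0, py P * (r * B).[px P] != 0 | (r * C).[px P] != 0]) ->
  (P = 0 -> (r * B)`_(3 * k) != 0) ->
  exists d (F : 'I_3 -> {mpoly K[3]}),
    [/\ forall i, F i \is d.-homog, exists i, (F i).@[hc P] != 0
      & forall Q, (exists i, (F i).@[hc Q] != 0) ->
        exists c : K, forall i, (F i).@[hc Q] = c * hc (oddmap Q) i].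
Proof.
move=> sA sB sC nz nz0.
have [HA [A1 A2 A3]] := homog_odd E sA.
have [HB [B1 B2 B3]] := homog_even E sB.
have [HC [C1 C2 C3]] := homog_odd E sC.
pose F : 'I_3 -> {mpoly K[3]} := nth 0 [:: HA; 'X_i1 * HB; HC].
have F0 (i : 'I_3) : (F i).@[hc 0] = (r * B)`_(3 * k) * hc 0 i.
  move: i; apply/ord3P; rewrite /F /= mevalM mevalXU A3 B3 C3 !hc0 /=.
  by rewrite !mulr0 mulr1 mul1r.
have FQ Q (i : 'I_3) : Q <> 0 -> (F i).@[hc Q] =
    r.[px Q] * nth 0 [:: A.[px Q]; py Q * B.[px Q]; C.[px Q]] i.
  move=> Q0; move: i; apply/ord3P; rewrite /F /= mevalM mevalXU A2 // B2 // C2 //.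
  by rewrite !hcE //= (hornerM r A) (hornerM r B) (hornerM r C); split=> //; ring.
exists (2 * k).+1, F; split.
- apply/(ord3P (fun i => F i \is (2 * k).+1.-homog)); rewrite /F /=; split=> //.
  exact: (dhomogM (dhomogXi K i1) B1). 
- have [P0|/eqP P0] := eqVneq P 0.
    by exists i1; rewrite P0 F0 hc0 /= mulr1 nz0.
  have := nz P0; rewrite (hornerM r A) (hornerM r B) (hornerM r C).
  case/or3P=> h; [exists i0|exists i1|exists i2]; rewrite FQ //=.
  by rewrite mulrCA.
move=> Q _; have [->|/eqP Q0] := eqVneq Q 0.
  by exists ((r * B)`_(3 * k)) => i; rewrite F0 oddmap0.
have [c hc] := oddmap_prop Q0; exists (r.[px Q] * c) => i.
by rewrite FQ // hc mulrA.
Qed.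

(* At a 2-torsion point of the kernel, multiply by [y] and divide by [e], using
   [y ^ 2 = e q]. *)
Lemma oddmap_formula_at_e P : P <> 0 -> e.[px P] = 0 ->
  exists d (F : 'I_3 -> {mpoly K[3]}),
    [/\ forall i, F i \is d.-homog, exists i, (F i).@[hc P] != 0
      & forall Q, (exists i, (F i).@[hc Q] != 0) ->
        exists c : K, forall i, (F i).@[hc Q] = c * hc (oddmap Q) i].
Proof.
move=> P0 eP.
pose U := A0 * D; pose V := q * B; pose W := e * D ^+ 3.
pose k := (size U + size V + size W)%N.
have sU : (size U <= (3 * k).+1)%N by rewrite /k; move: (size U) (size V) (size W) => *; lia.
have sV : (size V <= (3 * k).+2)%N by rewrite /k; move: (size U) (size V) (size W) => *; lia.
have sW : (size W <= (3 * k).+1)%N by rewrite /k; move: (size U) (size V) (size W) => *; lia.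
have [HU [U1 U2 U3]] := homog_even E sU.
have [HV [V1 V2 V3]] := homog_odd E sV.
have [HW [W1 W2 W3]] := homog_even E sW.
rewrite nth_default in U3; last by rewrite /k; move: (size U) (size V) (size W) => *; lia.
rewrite nth_default in W3; last by rewrite /k; move: (size U) (size V) (size W) => *; lia.
pose F : 'I_3 -> {mpoly K[3]} := nth 0 [:: 'X_i1 * HU; HV; 'X_i1 * HW].
exists (2 * k).+1, F; split.
- apply/(ord3P (fun i => F i \is (2 * k).+1.-homog)); rewrite /F /=; split=> //.
    exact: (dhomogM (dhomogXi K i1) U1).
  exact: (dhomogM (dhomogXi K i1) W1).
- exists i1; rewrite /F /= V2 //.
  have cop : coprimep e (q * B) by rewrite coprimep_sym.
  by apply: (coprimep_root cop); apply/rootP.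
move=> Q _; have [->|/eqP Q0] := eqVneq Q 0.
  exists 0 => i; rewrite mul0r; move: i; apply/ord3P.
  by rewrite /F /= !mevalM U3 V3 W3 !mulr0.
have FQ : [/\ (F i0).@[hc Q] = py Q * U.[px Q], (F i1).@[hc Q] = V.[px Q]
    & (F i2).@[hc Q] = py Q * W.[px Q]].
  by rewrite /F /= !mevalM mevalXU U2 // V2 // W2 // !hcE.
have [eQ|eQ] := eqVneq e.[px Q] 0.
  have y0 : py Q = 0.
    apply/eqP; rewrite -[_ == 0](expf_eq0 _ 2) -g_y //.
    by rewrite gE hornerM eQ mul0r.
  exists V.[px Q]; rewrite oddmap_C0; last first.
    by rewrite /C !hornerM eQ !mul0r.
  apply/ord3P; case: FQ => -> -> ->; rewrite !hc0 /= y0 !mul0r mulr0 mulr1.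
  by [].
have [c hc] := oddmap_prop Q0; exists (py Q / e.[px Q] * c) => i.
apply: (mulfI eQ).
have -> : e.[px Q] * (py Q / e.[px Q] * c * homog_coord (oddmap Q) i) =
  py Q * (c * homog_coord (oddmap Q) i) by field.
rewrite -hc; move: i {hc}; apply/ord3P; case: FQ => -> -> -> /=.
split.
- by rewrite /U /A !hornerM; ring.
- rewrite mulrA -expr2 -g_y // gE /V !hornerM; ring.
by rewrite /W /C !(hornerM, horner_exp); ring.
Qed.

Lemma oddmap_endo : is_endo oddmap.
Proof.
split; last exact: oddmap0.
move=> P; have [->|/eqP P0] := eqVneq P 0.
  by apply: (@oddmap_formula l m).
have [eP|eP] := eqVneq e.[px P] 0; first exact: oddmap_formula_at_e.
(* At an affine point any large degree will do, since the condition on the top coefficient concerns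
   only infinity. *)
pose k := (size A + size B + size C)%N.
apply: (@oddmap_formula 1 k); rewrite ?mul1r;
  try by rewrite /k; move: (size A) (size B) (size C) => *; lia.
  2: by move=> P00; case: P0.
move=> _; have [CP|CP] := eqVneq C.[px P] 0; last by rewrite !orbT.
(* At a kernel point which is not a zero of [e], coprimality of [g * B] and [D] keeps the middle
   coordinate [y B] nonzero. *)
have DP : D.[px P] = 0.
  by move: CP => /eqP; rewrite /C !hornerM !mulf_eq0 (negPf eP) /= !orbb => /eqP.
have : (g * B).[px P] != 0.
  have cop : coprimep D (g * B) by rewrite coprimep_sym.
  by apply: (coprimep_root cop); apply/rootP.
rewrite hornerM g_y // => h; apply/orP; right; apply/orP; left.
by apply: contraNneq h => h0; rewrite expr2 -mulrA h0 mulr0.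
Qed.

Lemma oddmap_xrep : xrep oddmap A0 (e * D ^+ 2) n.
Proof.
split=> //.
have C0 : C != 0.
  have : e * D ^+ 2 != 0.
    apply: contraTneq n_gt0 => h; move: size_A0 coprime_A0; rewrite h coprimep0.
    by move=> hs /eqp_size e1; move: hs; rewrite e1 size_poly1 size_poly0 => -[<-].
  by rewrite /C !mulf_eq0 !orbb.
apply: almostW (almost_and (almost_neq 0) (almost_neq0 E C0)) => P [P0 CP].
have [n0 ex _] := oddmap_C P0 CP.
have e1 : xn1 (oddmap P) = px (oddmap P).
  by move: n0; case: (oddmap P) => -[[x y]|] h // []; apply: val_inj.
have e2 : xn2 (oddmap P) = 1.
  by move: n0; case: (oddmap P) => -[[x y]|] h // []; apply: val_inj.
rewrite e1 e2 ex mulr1; apply: (mulIf CP); rewrite mulrA divfK //.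
by rewrite /A /C !(hornerM, horner_exp); ring.
Qed.

End OddMap.

(** * Polynomials modulo 439 *)

(** Polynomials over the prime field are lists of binary naturals, constant coefficient first, so
    that identities between them can be checked by evaluation. *)
Definition nmod (c : N) := N.modulo c 439%num.
Arguments nmod : simpl never.

Fixpoint ladd (s t : seq N) : seq N :=
  match s, t with
  | [::], _ => t
  | _, [::] => s
  | c :: s', d :: t' => nmod (N.add c d) :: ladd s' t'
  end.

Fixpoint lmul (s t : seq N) : seq N :=
  if s is c :: s' then
    ladd [seq nmod (N.mul c d) | d <- t] (N0 :: lmul s' t)
  else [::].

Fixpoint lnorm (s : seq N) : seq N :=
  if s is c :: s' then
    let r := lnorm s' in
    if (nmod c == 0%num) && nilp r then [::] else nmod c :: r
  else [::].

Lemma to_nat_add c d : N.to_nat (N.add c d) = (N.to_nat c + N.to_nat d)%N.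
Proof. exact: N2Nat.inj_add. Qed.

Lemma to_nat_mul c d : N.to_nat (N.mul c d) = (N.to_nat c * N.to_nat d)%N.
Proof. exact: N2Nat.inj_mul. Qed.

Section ListPoly.

Variable K : fieldType.
Hypothesis char439 : 439 \in [pchar K].
Implicit Types s t : seq N.

Definition toK (c : N) : K := (N.to_nat c)%:R.

Fixpoint lpoly s : {poly K} :=
  if s is c :: s' then lpoly s' * 'X + (toK c)%:P else 0.

Lemma toK_add c d : toK (N.add c d) = toK c + toK d.
Proof. by rewrite /toK to_nat_add natrD. Qed.

Lemma toK_mul c d : toK (N.mul c d) = toK c * toK d.
Proof. by rewrite /toK to_nat_mul natrM. Qed.

Lemma toK_mod c : toK (nmod c) = toK c.
Proof.
rewrite /toK; have [q ->] : exists q, N.to_nat c = (439 * q + N.to_nat (nmod c))%N.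
  exists (N.to_nat (N.div c 439%num)).
  have := N.div_mod c 439%num ltac:(by []); rewrite -/(nmod c).
  by move: (nmod c) (N.div _ _); lia.
by rewrite natrD natrM (pcharf0 char439) mul0r add0r.
Qed.

Lemma toK_eq0 c : (toK c == 0) = (nmod c == 0%num).
Proof.
rewrite -toK_mod /toK -(dvdn_pcharf char439).
have lt : (N.to_nat (nmod c) < 439)%N.
  have := N.mod_lt c 439%num ltac:(by []); rewrite -/(nmod c); lia.
apply/idP/eqP=> [dv|->]; last exact: dvdn0.
have inj := N2Nat.inj (nmod c) 0%num.
move: (N.to_nat (nmod c)) dv lt inj => [|k] dv lt inj; first exact: inj.
have := dvdn_leq (ltn0Sn k) dv; rewrite leqNgt lt => h; discriminate h.
Qed.

Lemma lpoly_add s t : lpoly (ladd s t) = lpoly s + lpoly t.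
Proof.
elim: s t => [|c s IH] t; first by rewrite add0r.
case: t => [|d t]; first by rewrite addr0.
rewrite [LHS]/= [lpoly (c :: s)]/= [lpoly (d :: t)]/=.
by rewrite IH toK_mod toK_add polyCD mulrDl addrACA.
Qed.

Lemma lpoly_mul s t : lpoly (lmul s t) = lpoly s * lpoly t.
Proof.
elim: s t => [|c s IH] t /=; first by rewrite mul0r.
rewrite lpoly_add /= IH addr0.
have -> : lpoly [seq nmod (N.mul c d) | d <- t] = (toK c)%:P * lpoly t.
  elim: t {IH} => [|d t IH] /=; first by rewrite mulr0.
  by rewrite IH toK_mod toK_mul polyCM; ring.
by ring.
Qed.

Lemma lpoly_norm s : lpoly (lnorm s) = lpoly s.
Proof.
elim: s => [|c s IH]; first by [].
rewrite [lpoly (c :: s)]/= [lnorm _]/=; case: ifP => [/andP[c0 /nilP e]|_].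
  by rewrite -IH e mul0r add0r -toK_mod (eqP c0) /toK polyC0.
by rewrite [LHS]/= IH toK_mod.
Qed.

Lemma size_lpoly s : size (lpoly s) = size (lnorm s).
Proof.
elim: s => [|c s IH] /=; first by rewrite size_poly0.
rewrite size_MXaddC -size_poly_eq0 IH toK_eq0 andbC.
by rewrite /nilp; case: ifP.
Qed.

Lemma lpoly_eq s t : lnorm s = lnorm t -> lpoly s = lpoly t.
Proof. by move=> e; rewrite -lpoly_norm e lpoly_norm. Qed.

Lemma lpoly_coprime s t u v :
  lnorm (ladd (lmul u s) (lmul v t)) = [:: 1%num] -> coprimep (lpoly s) (lpoly t).
Proof.
move=> e; apply/Bezout_coprimepP; exists (lpoly u, lpoly v) => /=.
rewrite -!lpoly_mul -lpoly_add -lpoly_norm e /= mul0r add0r; exact: eqpxx.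
Qed.

Lemma lpoly_frob s x : (lpoly s).[x] ^+ 439 = (lpoly s).[x ^+ 439].
Proof.
elim: s => [|c s IH] /=; first by rewrite !horner0 expr0n.
rewrite !hornerMXaddC -IH -exprMn.
by rewrite -(pFrobenius_autE char439) rmorphD /= rmorph_nat pFrobenius_autE.
Qed.

End ListPoly.

Definition lpow s k := iter k (lmul s) [:: 1%num].

(* Up to a square root [i] of -1, the map is
   [(x, y) |-> (A / (e D ^ 2), i y B / (e ^ 2 D ^ 3))], where [x ^ 3 + a x + b =
   e q] and the roots of [e] and [D] are the abscissas of the kernel; it comes
   from Velu's formulas. The factor [l] makes homogenization at infinity
   possible in degree [2 m + 1], [in_] is the degree of the map, and the last
   three pairs are Bezout coefficients. *)
Record isogeny_data := Isogeny_data {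
  ie : seq N; iq : seq N; iD : seq N; iA : seq N; iB : seq N; il : seq N;
  im : nat; in_ : nat;
  ic1 : seq N * seq N; ic2 : seq N * seq N; ic3 : seq N * seq N }.

Definition lg : seq N := [:: 307; 169; 0; 1]%num.

(** The tests mirror the hypotheses on the odd map with [i B] in place of [B]. In the curve equation
    the factor 438 stands for [i ^ 2 = -1]; elsewhere the nonzero scalar i affects neither
    coprimality nor sizes. *)
Definition check_isogeny (d : isogeny_data) : bool :=
  let: Isogeny_data e q D A B l m n c1 c2 c3 := d in
  let eD := lmul e D in let eD2 := lmul e (lmul D D) in
  [&& lnorm (lmul e q) == lnorm lg,
      lnorm (lmul [:: 438%num] (lmul q (lmul B B))) ==
      lnorm (ladd (ladd (lpow A 3)
        (lmul (lmul [:: 169%num] A) (lmul (lpow e 2) (lpow D 4))))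
        (lmul [:: 307%num] (lmul (lpow e 3) (lpow D 6)))),
      lnorm (ladd (lmul c1.1 (lmul lg B)) (lmul c1.2 D)) == [:: 1%num],
      lnorm (ladd (lmul c2.1 (lmul q B)) (lmul c2.2 e)) == [:: 1%num],
      lnorm (ladd (lmul c3.1 A) (lmul c3.2 eD2)) == [:: 1%num],
      maxn (size (lnorm A)) (size (lnorm eD2)) == n.+1,
      (0 < n)%N,
      (size (lnorm (lmul l (lmul A eD))) <= (3 * m).+2)%N,
      size (lnorm (lmul l B)) == (3 * m).+1 &
      (size (lnorm (lmul l (lmul eD2 eD))) <= (3 * m).+2)%N].

Definition alpha_data : isogeny_data := Isogeny_data
  [:: 1]%num
  [:: 307; 169; 0; 1]%num
  [:: 145; 110; 1]%num
  [:: 285; 217; 375; 248; 395; 351]%num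
  [:: 430; 45; 195; 18; 123; 430; 427]%num
  [:: 1]%num
  2 5
  ([:: 414; 166]%num,
   [:: 223; 324; 393; 76; 299; 386; 212; 257; 236]%num)
  ([::]%num,
   [:: 1]%num)
  ([:: 152; 219; 84; 351]%num,
   [:: 25; 317; 150; 368; 158]%num).

Definition beta_data : isogeny_data := Isogeny_data
  [:: 251; 1]%num
  [:: 393; 188; 1]%num
  [:: 82; 83; 416; 160; 344; 93; 135; 292; 415; 132; 1]%num
  [:: 205; 239; 333; 109; 344; 259; 162; 346; 432; 156; 285; 342; 305; 91;
    87; 71; 156; 42; 363; 25; 121; 236; 419]%num
  [:: 27; 150; 349; 151; 209; 383; 384; 29; 10; 138; 200; 232; 184; 195;
    37; 89; 317; 41; 336; 40; 376; 120; 368; 128; 334; 9; 50; 147; 299; 380;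
    244; 306; 147]%num
  [:: 0; 1]%num
  11 22
  ([:: 15; 35; 409; 371; 21; 84; 56; 427; 272; 421]%num,
   [:: 47; 160; 200; 368; 179; 133; 133; 418; 414; 355; 288; 47; 340; 420;
    353; 371; 61; 192; 26; 437; 316; 174; 324; 205; 94; 81; 326; 367; 27;
    425; 62; 109; 152; 377; 12]%num)
  ([:: 140]%num,
   [:: 259; 294; 422; 261; 299; 121; 358; 313; 402; 428; 196; 84; 332; 275;
    221; 85; 221; 42; 393; 385; 92; 307; 74; 154; 276; 248; 311; 9; 355;
    417; 403; 264; 355; 53]%num)
  ([:: 237; 94; 240; 112; 177; 10; 95; 23; 118; 211; 186; 420; 62; 360; 57;
    80; 301; 164; 287; 417; 435]%num,
   [:: 121; 68; 135; 237; 121; 427; 77; 262; 120; 382; 235; 61; 221; 233;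
    265; 317; 407; 292; 288; 40; 438; 359]%num).


Lemma alpha_check : check_isogeny alpha_data.
Proof. by vm_compute. Qed.

Lemma beta_check : check_isogeny beta_data.
Proof. by vm_compute. Qed.

(** * From the checked data to twisting endomorphisms *)

Section Explicit.

Variables (K : closedFieldType) (iota : {rmorphism 'F_439 -> K}).
Let EK := base_change iota E439.
Local Notation lp := (lpoly K).

Lemma pchar439 : 439 \in [pchar K].
Proof. by rewrite (fmorph_pchar iota) pchar_Fp. Qed.

Lemma waE : wa EK = toK K 169%num.
Proof. exact: rmorph_nat. Qed.

Lemma wbE : wb EK = toK K 307%num.
Proof. exact: rmorph_nat. Qed.

Let ch := pchar439.

Lemma lp_const c : lp [:: c] = (toK K c)%:P.
Proof. by rewrite /= mul0r add0r. Qed.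

Lemma lpow_exp s k : lp (lpow s k) = lp s ^+ k.
Proof.
elim: k => [|k IH]; first by rewrite lp_const.
by rewrite /lpow iterS -/(lpow s k) (lpoly_mul ch) IH exprS.
Qed.

Lemma lgE : 'X^3 + wa EK *: 'X + (wb EK)%:P = lp lg.
Proof.
rewrite waE wbE /lg /= -mul_polyC.
have -> : toK K 0%num = 0 by [].
have -> : toK K 1%num = 1 by [].
by rewrite polyC0 polyC1; ring.
Qed.

(** Since [439 = 2 * 219 + 1] with 219 odd, the square roots of -1 are exchanged by Frobenius. *)
Lemma sqrtN1 : exists2 i : K, i ^+ 2 = -1 & i ^+ 439 = - i.
Proof.
have [i hi] := sqrt_ex (-1 : K); exists i; first exact: hi.
have -> : 439%N = (2 * 219).+1 by [].
rewrite exprS exprM hi -signr_odd (_ : odd 219 = true); last by [].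
by rewrite expr1 mulrN1.
Qed.

Lemma toK438 : toK K 438%num = -1.
Proof.
apply/eqP; rewrite -addr_eq0; apply/eqP.
have -> : 1 = toK K 1%num by [].
have e : N.to_nat (N.add 438 1) = 439%N by vm_compute.
rewrite -toK_add /toK e; exact: pcharf0 ch.
Qed.

Lemma isogeny_of_check (d : isogeny_data) : check_isogeny d ->
  exists f : point EK -> point EK,
    twisting prime439 f /\ exists U V, xrep f U V (in_ d).
Proof.
case: d => e q D A B l m n c1 c2 c3; rewrite /check_isogeny [in_ _]/=.
case/and5P=> /eqP h1 /eqP h2 /eqP h3 /eqP h4 /and5P[/eqP h5 /eqP h6 n0 h7 /andP[/eqP h8 h9]].
have [i i2 ip] := sqrtN1.
have i0 : i != 0.
  by apply: contra_eqN i2 => /eqP->; rewrite expr0n eq_sym oppr_eq0 oner_eq0.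
have pm := lpoly_mul ch; have pa := lpoly_add ch.
have g1 : 'X^3 + wa EK *: 'X + (wb EK)%:P = lp e * lp q.
  by rewrite lgE -pm; apply: lpoly_eq.
have eD : lp (lmul e D) = lp e * lp D by rewrite pm.
have eD2 : lp (lmul e (lmul D D)) = lp e * lp D ^+ 2 by rewrite !pm expr2.
have g2 : lp q * (i *: lp B) ^+ 2 = lp A ^+ 3
    + (wa EK)%:P * lp A * (lp e ^+ 2 * lp D ^+ 4)
    + (wb EK)%:P * (lp e ^+ 3 * lp D ^+ 6).
  have := lpoly_eq ch h2; rewrite !(pa, pm, lpow_exp, lp_const) toK438 -waE -wbE => <-.
  by rewrite exprZn i2 -mul_polyC; ring.
have g3 : coprimep (('X^3 + wa EK *: 'X + (wb EK)%:P) * (i *: lp B)) (lp D).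
  by rewrite -scalerAr (coprimepZl _ _ i0) lgE -pm; apply: (lpoly_coprime ch h3).
have g4 : coprimep (lp q * (i *: lp B)) (lp e).
  by rewrite -scalerAr (coprimepZl _ _ i0) -pm; apply: (lpoly_coprime ch h4).
have g5 : coprimep (lp A) (lp e * lp D ^+ 2).
  by rewrite -eD2; apply: (lpoly_coprime ch h5).
have g6 : maxn (size (lp A)) (size (lp e * lp D ^+ 2)) = n.+1.
  by rewrite -eD2 !(size_lpoly ch).
have g7 : (size (lp l * (lp A * (lp e * lp D)))%R <= (3 * m).+2)%N.
  by rewrite -eD -!pm (size_lpoly ch).
have sB : size (lp (lmul l B)) = (3 * m).+1 by rewrite (size_lpoly ch).
have g8 : (size (lp l * (i *: lp B))%R <= (3 * m).+1)%N.
  by rewrite -scalerAr (size_scale _ i0) -pm sB.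
have g9 : (size (lp l * (lp e * lp D ^+ 2 * (lp e * lp D)))%R <= (3 * m).+2)%N.
  by rewrite -eD -eD2 -!pm (size_lpoly ch).
have g10 : (lp l * (i *: lp B))`_(3 * m) != 0.
  rewrite -scalerAr coefZ; apply: (mulf_neq0 i0); rewrite -pm.
  have -> : (3 * m)%N = (size (lp (lmul l B))).-1 by rewrite sB.
  by rewrite -lead_coefE lead_coef_eq0 -size_poly_eq0 sB.
exists (oddmap g1 g2); split; last first.
  by exists (lp A), (lp e * lp D ^+ 2); apply: oddmap_xrep.
split; first exact: (oddmap_endo g1 g2 g3 g4 g5 g6 n0 g7 g8 g9 g10).
(* Coefficients in the prime field let Frobenius pass through [A] and [C]; only the factor i in the
   ordinate changes sign, which is the required negation. *)
have fr s x : (lp s).[x] ^+ 439 = (lp s).[x ^+ 439] by exact: lpoly_frob.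
have frM (U V : {poly K}) : (forall x, U.[x] ^+ 439 = U.[x ^+ 439]) ->
    (forall x, V.[x] ^+ 439 = V.[x ^+ 439]) ->
    forall x, (U * V).[x] ^+ 439 = (U * V).[x ^+ 439].
  by move=> hU hV x; rewrite !hornerM exprMn hU hV.
have frA := frM _ _ (fr A) (frM _ _ (fr e) (fr D)).
have frC := frM _ _ (fr (lmul e (lmul D D))) (frM _ _ (fr e) (fr D)).
rewrite eD2 in frC.
have frB x : (i *: lp B).[x] ^+ 439 = - (i *: lp B).[x ^+ 439].
  by rewrite !hornerZ exprMn fr ip mulNr.
move=> P; apply: val_inj; case: P => -[[x y]|] hP /=; last by [].
rewrite -frC expf_eq0 /=; case: eqP => C0 /=; first by [].
by rewrite !exprMn !exprVn frA frC frB mulrN mulNr.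
Qed.

End Explicit.

(** * The endomorphism ring *)

Section EndoRing.

Variables (K : closedFieldType) (E : wcurve K).

Definition endo := {f : point E -> point E | is_endo f}.
Implicit Types f g h : endo.

HB.instance Definition _ := boolp.gen_eqMixin endo.
HB.instance Definition _ := boolp.gen_choiceMixin endo.

Lemma endo_eq f g : sval f =1 sval g -> f = g.
Proof. by case: f g => [f hf] [g hg] /= /boolp.funext fg; apply: boolp.eq_exist. Qed.

Lemma endo_add_subproof f g : is_endo (fun P => sval f P + sval g P).
Proof.
have [[rf f0] [rg g0]] := (svalP f, svalP g).
by split; [apply: regular_add | rewrite f0 g0; apply: add0r].
Qed.

Lemma endo_opp_subproof f : is_endo (fun P => - sval f P).
Proof.
have [rf f0] := svalP f.
by split; [apply: regular_opp | rewrite f0; apply: oppr0].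
Qed.

Lemma endo_mul_subproof f g : is_endo (sval f \o sval g).
Proof.
have [[rf f0] [rg g0]] := (svalP f, svalP g).
by split; [apply: regular_comp | rewrite /= g0 f0].
Qed.

Definition endo_zero : endo := exist _ _ (conj (@regular_cst K E 0) erefl).
Definition endo_one : endo := exist _ _ (conj (@regular_id K E) erefl).
Definition endo_add f g : endo := exist _ _ (endo_add_subproof f g).
Definition endo_opp f : endo := exist _ _ (endo_opp_subproof f).
Definition endo_mul f g : endo := exist _ _ (endo_mul_subproof f g).

Lemma endo_addA : associative endo_add.
Proof. by move=> f g h; apply: endo_eq => P; apply: addrA. Qed.
Lemma endo_addC : commutative endo_add.
Proof. by move=> f g; apply: endo_eq => P; apply: addrC. Qed.
Lemma endo_add0 : left_id endo_zero endo_add.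
Proof. by move=> f; apply: endo_eq => P; apply: add0r. Qed.
Lemma endo_addN : left_inverse endo_zero endo_opp endo_add.
Proof. by move=> f; apply: endo_eq => P; apply: addNr. Qed.

HB.instance Definition _ :=
  GRing.isZmodule.Build endo endo_addA endo_addC endo_add0 endo_addN.

Lemma endo_mulA : associative endo_mul.
Proof. by move=> f g h; apply: endo_eq. Qed.
Lemma endo_mul1 : left_id endo_one endo_mul.
Proof. by move=> f; apply: endo_eq. Qed.
Lemma endo_1mul : right_id endo_one endo_mul.
Proof. by move=> f; apply: endo_eq. Qed.
Lemma endo_mulDl : left_distributive endo_mul endo_add.
Proof. by move=> f g h; apply: endo_eq. Qed.
(** Unlike the other ring laws, this one needs endomorphisms to be additive. *)
Lemma endo_mulDr : right_distributive endo_mul endo_add.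
Proof. by move=> f g h; apply: endo_eq => P /=; apply: endo_hom (svalP f) _ _. Qed.
Lemma endo_one_neq0 : endo_one != 0.
Proof.
apply/eqP => e.
have [P P0] := almost_ex (almost_neq (0 : point E)).
have e' : sval endo_one P = sval (0 : endo) P by rewrite e.
exact: P0 e'.
Qed.

HB.instance Definition _ := GRing.Zmodule_isNzRing.Build endo
  endo_mulA endo_mul1 endo_1mul endo_mulDl endo_mulDr endo_one_neq0.

Lemma endo_addE f g P : sval (f + g) P = sval f P + sval g P. Proof. by []. Qed.
Lemma endo_oppE f P : sval (- f) P = - sval f P. Proof. by []. Qed.
Lemma endo_mulE f g P : sval (f * g) P = sval f (sval g P). Proof. by []. Qed.
Lemma endo_MzE f (n : int) P : sval (f *~ n) P = sval f P *~ n.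
Proof.
have h k : sval (f *+ k) P = sval f P *+ k.
  by elim: k => [|k IH]; rewrite ?mulr0n // !mulrS endo_addE IH.
by case: n => k; rewrite ?NegzE ?mulrNz ?endo_oppE -?pmulrn h.
Qed.

Lemma xrep_sig f : exists n, exists A B, xrep (sval f) A B n.
Proof. by have [A [B [n h]]] := xrep_ex (svalP f); exists n, A, B. Qed.

Definition degree f : nat := sval (boolp.cid (xrep_sig f)).

Lemma degreeE f A B n : xrep (sval f) A B n -> degree f = n.
Proof.
move=> h; rewrite /degree; case: boolp.cid => m [C [D h']] /=.
exact: xrep_uniq (fun=> erefl) h' h.
Qed.

Lemma degreeP f : exists A B, xrep (sval f) A B (degree f).
Proof. by rewrite /degree; case: boolp.cid => m [C [D h']] /=; exists C, D. Qed.

Lemma degree_parallelogram f g :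
  (degree (f + g)%R + degree (f - g)%R = (degree f + degree g).*2)%N.
Proof.
have [A1 [B1 h1]] := degreeP f; have [A2 [B2 h2]] := degreeP g.
have [A3 [B3 h3]] := degreeP (f + g); have [A4 [B4 h4]] := degreeP (f - g).
exact: xrep_parallelogram h1 h2 h3 h4.
Qed.

Lemma degree_mul f g : degree (f * g)%R = (degree f * degree g)%N.
Proof.
have [A1 [B1 h1]] := degreeP f; have [A2 [B2 h2]] := degreeP g.
have [U [V h]] := xrep_comp (svalP f) (svalP g) h1 h2.
exact: (@degreeE (f * g)%R U V _ h).
Qed.

Lemma degree_eq0 f : degree f = 0%N -> f = 0.
Proof.
have [A [B h]] := degreeP f => e; rewrite e in h.
by apply: endo_eq => P; apply: xrep_const (svalP f) h P.
Qed.

End EndoRing.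

(** * Frobenius as an endomorphism of degree p *)

Section FrobeniusEndo.

Variables (p : nat) (p_pr : prime p) (E : wcurve 'F_p).
Variables (K : closedFieldType) (iota : {rmorphism 'F_p -> K}).
Local Notation EK := (base_change iota E).
Local Notation hc := (@homog_coord K EK).
Local Notation phi := (@frob p p_pr E K iota).

Lemma hc_frob P i : hc (phi P) i = hc P i ^+ p.
Proof.
have p0 : (0 : K) ^+ p = 0 by rewrite expr0n eqn0Ngt prime_gt0.
by move: i; apply/ord3P; case: P => -[[x y]|] h; rewrite /homog_coord /= ?expr1n ?p0.
Qed.

Lemma frob_endo : is_endo phi.
Proof.
split; last exact: val_inj.
move=> P; exists p, (fun i => 'X_i ^+ p); split.
- by move=> i; exact: dhomogXin.
- by have [i hi] := hc_neq0 P; exists i; rewrite meval_exp mevalXU expf_neq0.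
by move=> Q _; exists 1 => i; rewrite meval_exp mevalXU mul1r hc_frob.
Qed.

Lemma frob_eq0 P : phi P = 0 -> P = 0.
Proof.
by case: P => -[[x y]|] h e; [move/(congr1 val): e | apply: val_inj].
Qed.

Lemma frob_xrep : xrep phi 'X^p 1 p.
Proof.
split; first exact: coprimep1.
  by rewrite size_polyXn size_poly1; apply/maxn_idPl.
apply: almostW (almost_neq 0) => -[[[x y]|] h] P0; last by case: P0; apply: val_inj.
by rewrite /px /xn1 /xn2 /= hornerXn hornerC mulr1 mul1r.
Qed.

End FrobeniusEndo.

Lemma jinv_E439 : jinv E439 = 247%:R.
Proof. by apply/eqP; vm_compute. Qed.

Theorem proposition5p1 (K : closedFieldType) (iota : {rmorphism 'F_439 -> K})
    (iota_alg : integralRange iota) :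
  [/\ jinv E439 = 247%:R,
      supersingular E439 iota
    & exists alpha beta :
        point (base_change iota E439) -> point (base_change iota E439),
      [/\ twisting prime439 alpha,
          twisting prime439 beta,
          forall P, alpha (alpha P) = pmulz (-5) P,
          forall P, beta (beta P) = pmulz (-22) P
        & forall f : point (base_change iota E439) ->
                     point (base_change iota E439),
          is_endo f <->
          exists a b c d : int, forall P,
            f P = padd (pmulz a P)
                 (padd (pmulz b (alpha P))
                 (padd (pmulz c (beta P))
                       (pmulz d (alpha (beta P)))))]].
Proof.
have [al [twal [Ua [Va xal]]]] := isogeny_of_check iota alpha_check.
have [be [twbe [Ub [Vb xbe]]]] := isogeny_of_check iota beta_check.
pose R : nzRingType := endo (base_change iota E439).
pose N (f : R) : int := (degree f)%:Z.
have N_par (x y : R) : N (x + y) + N (x - y) = 2 * (N x + N y).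
  have := degree_parallelogram x y; rewrite /N.
  by move: (degree (x + y)%R) (degree (x - y)%R) (degree x) (degree y); lia.
have N_mul (x y : R) : N (x * y) = N x * N y by rewrite /N degree_mul.
have N_eq0 (x : R) : N x = 0 -> x = 0 by move=> [] /degree_eq0.
pose phi : R := exist _ _ (frob_endo prime439 E439 iota).
pose a : R := exist _ _ twal.1; pose b : R := exist _ _ twbe.1.
have N_phi : N phi = 439 by rewrite /N (@degreeE _ _ phi _ _ _ (frob_xrep prime439 E439 iota)).
have N_a : N a = 5 by rewrite /N (@degreeE _ _ a _ _ _ xal).
have N_b : N b = 22 by rewrite /N (@degreeE _ _ b _ _ _ xbe).
have anti (c : R) : (forall P, sval phi (sval c P) = - sval c (sval phi P)) ->
    c * phi = - (phi * c).
  by move=> h; apply: endo_eq => P; rewrite endo_oppE !endo_mulE h opprK.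
have a_phi : a * phi = - (phi * a) := anti a twal.2.
have b_phi : b * phi = - (phi * b) := anti b twbe.2.
have intE (n : int) P : sval (n%:~R : R) P = P *~ n by rewrite endo_MzE.
have aa : a * a = (- 5)%:~R := sqr_al N_par N_mul N_eq0 N_phi N_a a_phi.
have bb : b * b = (- 22)%:~R := sqr_be N_par N_mul N_eq0 N_phi N_b b_phi.
have pp : phi * phi = (- 439)%:~R.
  exact: (sqr_phi N_par N_mul N_eq0 N_phi N_a a_phi).
split; first exact: jinv_E439.
  (* A point killed by 439 is killed by [phi * phi], which is multiplication by -439, and Frobenius
     has trivial kernel on points. *)
  move=> P; rewrite pmulzE => P439; apply: (@frob_eq0 _ prime439 E439 K iota).
  apply: (@frob_eq0 _ prime439 E439 K iota).
  have : sval (phi * phi) P = P *~ (- 439) by rewrite pp intE.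
  by rewrite endo_mulE mulrNz P439 => h; exact: etrans h (oppr0 _).
exists al, be; split=> //.
- move=> P; rewrite pmulzE.
  have : sval (a * a) P = P *~ (- 5) by rewrite aa intE.
  exact.
- move=> P; rewrite pmulzE.
  have : sval (b * b) P = P *~ (- 22) by rewrite bb intE.
  exact.
have combE (x y z w : int) P :
    sval (x%:~R + a *~ y + b *~ z + (a * b) *~ w : R) P =
    padd (pmulz x P) (padd (pmulz y (al P)) (padd (pmulz z (be P))
      (pmulz w (al (be P))))).
  by rewrite !pmulzE !endo_addE intE !endo_MzE endo_mulE -!addrA.
move=> f; split=> [hf|[x [y [z [w hf]]]]].
  have [x [y [z [w e]]]] := lattice_span N_par N_mul N_eq0 N_phi N_a N_b a_phi b_phi
    (exist _ _ hf : R).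
  by exists x, y, z, w => P; rewrite -combE -e.
have e : f = sval (x%:~R + a *~ y + b *~ z + (a * b) *~ w : R).
  by apply: boolp.funext => P; rewrite combE hf.
by rewrite e; apply: svalP.
Qed.
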